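(* Let $L_1,\dots,L_M\in\mathbb{N}$ and $q_1,\dots,q_M\in\mathbb{R}[x]$ with $\deg q_j<2L_j$, $q_j(0)=0$, and let $P(x,y)=\prod_{j=1}^M(y+q_j(x)+ix^{2L_j})$. Let $A=\tfrac12(P+\bar P)$, $B=\tfrac1{2i}(P-\bar P)$, and fix $t\in\mathbb{R}$. Then locally $A+tB$ has $M$ smooth branches $y=a_j(x;t)$, $j=1,\dots,M$, through $(0,0)$ with $a_j(\cdot;t)\in\mathbb{R}\{x\}$, and for $Q\in\mathbb{C}\{x,y\}$: $Q/P\in L^2_{loc}$ if and only if for each $j=1,\dots,M$, $$2\,\mathrm{Ord}\bigl(Q(x,a_j(x;t))\bigr)\ge\mathrm{Ord}\Bigl(B(x,a_j(x;t))\bigl(A_y(x,a_j(x;t))+tB_y(x,a_j(x;t))\bigr)\Bigr).$$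
   Context: $\bar P(x,y)=\overline{P(\bar x,\bar y)}$; subscript $y$ denotes $\partial/\partial y$. $\mathbb{C}\{x,y\}$ are convergent power series at the origin, $\mathbb{R}\{x\}$ convergent real-coefficient series in $x$. Ord is order of vanishing at $0$. $f\in L^{2}_{loc}$ means $f\in L^2(U)$ (Lebesgue measure) for some neighborhood $U$ of $(0,0)$ in $\mathbb{R}^2$. *)

(* Defs.v *)
From HB Require Import structures.
From mathcomp Require Import all_boot all_order all_algebra.
From mathcomp Require Import complex.
From mathcomp Require Import all_classical all_reals all_analysis.
Set Implicit Arguments. Unset Strict Implicit. Unset Printing Implicit Defensive.
Import Order.TTheory GRing.Theory Num.Theory.
Import numFieldNormedType.Exports.
Local Open Scope classical_set_scope.
Local Open Scope ring_scope.

Section Defs.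
Variable R : realType.
Local Notation C := R[i].

Definition iC : C := Complex 0 1.
Definition rC (r : R) : C := Complex r 0.

(* Bivariate polynomials over C: an element of {poly {poly C}} is
   sum_k p_k(x) y^k (outer variable y, inner variable x).
   Evaluation at (x, y). *)
Definition eval2 (p : {poly {poly C}}) (x y : C) : C := (p.[y%:P]).[x].

(* coefficientwise complex conjugation: Pbar(x,y) = conj (P(conj x, conj y)) *)
Definition conj2 (p : {poly {poly C}}) : {poly {poly C}} :=
  map_poly (map_poly Num.conj) p.

Definition polyRC (q : {poly R}) : {poly C} := map_poly rC q.

Definition Ppoly (M : nat) (q : 'I_M -> {poly R}) (L : 'I_M -> nat)
  : {poly {poly C}} :=
  \prod_(j < M) ('X + (polyRC (q j) + iC *: 'X^(2 * L j))%:P).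

Definition Apoly (P : {poly {poly C}}) : {poly {poly C}} :=
  (P + conj2 P) * ((2%:R : C)^-1)%:P%:P.
Definition Bpoly (P : {poly {poly C}}) : {poly {poly C}} :=
  (P - conj2 P) * ((2%:R * iC)^-1)%:P%:P.

Definition conv_series1 (b : nat -> R) : Prop :=
  exists r : R, 0 < r /\ exists K : R, forall n, `|b n| * r ^+ n <= K.
Definition limR (u : nat -> R) : R := lim (u @ \oo).
Definition eval_series1 (b : nat -> R) (x : R) : R :=
  lim ((fun N : nat => \sum_(k < N) b k * x ^+ k) @ \oo).

Definition conv_series2 (c : nat -> nat -> C) : Prop :=
  exists r : R, 0 < r /\ exists K : R,
    forall m n, `|c m n| * rC (r ^+ (m + n)) <= rC K.
Definition psum2 (c : nat -> nat -> C) (x y : C) (N : nat) : C :=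
  \sum_(m < N) \sum_(n < N) c m n * x ^+ m * y ^+ n.
Definition eval_series2 (c : nat -> nat -> C) (x y : C) : C :=
  Complex (limR (fun N : nat => complex.Re (psum2 c x y N)))
          (limR (fun N : nat => complex.Im (psum2 c x y N))).

(* order of vanishing at 0 of f : R -> C, in \bar R (= +oo iff f is
   O(|x|^n) for all n, e.g. f = 0 near 0) *)
Definition vanishes_to (f : R -> C) (n : nat) : Prop :=
  exists r : R, 0 < r /\ exists K : R,
    forall x : R, `|x| < r -> `|f x| <= rC (K * `|x| ^+ n).
Definition Ord (f : R -> C) : \bar R :=
  ereal_sup [set (n%:R : R)%:E | n in [set n : nat | vanishes_to f n]].

Definition sqnormC (z : C) : R := complex.Re z ^+ 2 + complex.Im z ^+ 2.
Definition L2_on (U : set (R * R)) (f : R * R -> C) : Prop :=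
  measurable U /\
  measurable_fun U (fun p => complex.Re (f p)) /\
  measurable_fun U (fun p => complex.Im (f p)) /\
  (\int[(@lebesgue_measure R \x @lebesgue_measure R)%E]_(p in U)
      (sqnormC (f p))%:E < +oo)%E.

(* f in L^2_loc: f in L^2(U) for some neighborhood U of (0,0); it suffices
   (equivalently) to take the open squares ]-e,e[ x ]-e,e[ *)
Definition L2loc (f : R * R -> C) : Prop :=
  exists e : R, 0 < e /\
    L2_on ([set p : R * R | `|p.1| < e /\ `|p.2| < e]) f.

End Defs.

(* Main.v *)
Require Import Defs.
From HB Require Import structures.
From mathcomp Require Import all_boot all_order all_algebra.
From mathcomp Require Import complex.
From mathcomp Require Import all_classical all_reals all_analysis.
From mathcomp Require Import measurable_realfun.
From mathcomp Require Import ring lra zify.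
Set Implicit Arguments. Unset Strict Implicit. Unset Printing Implicit Defensive.
Import Order.TTheory GRing.Theory Num.Theory.
Import numFieldNormedType.Exports.
Local Open Scope classical_set_scope.
Local Open Scope ring_scope.

(* For fixed x <> 0, view P, A, B, F = A + t B as polynomials in y.  The roots
   of P lie in the lower half plane, so the roots a_j(x) of F are real and
   simple (Hermite-Biehler), and a splitting argument with Hensel's lemma makes
   them analytic in x (Rellich).  On the real line the Wronskian
   K = B F_y - F B_y equals both |P|^2 phi with phi a sum of M Poisson kernels,
   so that the integral of K / |P|^2 is at most M pi, and a sum
   \sum_j beta_j F_j^2 with beta_j > 0 and F_j = F / (y - a_j); on the branch
   y = a_j it is B F_y.  Write Q = N + h F with N the Lagrange interpolation of
   Q at the a_j; since |F / P| is bounded, only N / P matters.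

   If |Q(a_j)|^2 <= C K(a_j) for all j, Cauchy-Schwarz gives |N|^2 <= C' K, so
   the integrals of |Q / P|^2 over the fibers x = const are bounded.
   Conversely, N / P is holomorphic in the upper half plane and, up to a
   constant factor, its real part on the line is N F / |P|^2, which vanishes at
   a_j.  Averaging over half discs centered at a_j (in polar coordinates) bounds
   |N / P|(a_j) by the integral of |N F_j| / |P|^2, and the two formulas for K
   turn this into |Q(a_j)|^2 / K(a_j) <= C (1 + integral of |Q / P|^2 dy).  If
   the order inequality fails on the branch a_j, the left-hand side is at least
   c / |x|, which is not integrable. *)

(** * Germs of real analytic functions *)

Section Germs.
Variable R : realType.
Implicit Types (f g : R -> R) (b c : nat -> R) (r K x : R).

(** Every fiber estimate needs constants that survive [x -> 0], when the roots of [P] reach the real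
    line and the [a_j] run together, so that Lagrange interpolation bounded term by term
    degenerates. Three facts are uniform: the quotient [h] in [Q = N + h F] is bounded wherever the
    nodes lie, since dividing by a linear factor costs only a constant in a weighted coefficient
    bound; a Poisson kernel has integral at most [pi] whatever its width; and the two formulas for
    [K] are identities, so that passing from one to the other loses nothing.

    Half discs are usable because [P] has no zero in the closed upper half plane for [x != 0], and
    the weight [1 / r] of polar coordinates is cancelled by the zero of [F] at [a_j]. The constant
    factor is the conjugate of [alpha = (1 - i t) / 2], as [F = 2 Re(alpha P)] on the line. The
    formula for the real part also needs [N] real there, so the real and imaginary parts of the
    values of [Q] are interpolated separately.

    The threshold [1 / |x|] appears because orders are integers: when [2 Ord Q] falls short of the
    order of [K], it does so by at least one. *)

Lemma near0P (P : R -> Prop) :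
  (\forall x \near (0 : R), P x) <-> exists e : R, 0 < e /\ forall x, `|x| < e -> P x.
Proof.
split.
  move/nbhs_ballP => [e /= e0 H]; exists e; split => // x xe; apply: H.
  by rewrite /ball /= sub0r normrN.
move=> [e [e0 H]]; apply/nbhs_ballP; exists e => //= x.
by rewrite /ball /= sub0r normrN => /H.
Qed.

Lemma near0_forall (I : finType) (P : I -> R -> Prop) :
  (forall i, \forall x \near (0 : R), P i x) -> \forall x \near (0 : R), forall i, P i x.
Proof. by move=> H; apply: (@filter_forall _ _ P (nbhs (0 : R))). Qed.

Definition germ_on f b r K := [/\ 0 < r, 0 <= K &
  forall N x, `|x| < r -> `|f x - \sum_(k < N) b k * x ^+ k| <= K * (`|x| / r) ^+ N].

(* The remainder bounds say that [f] is the sum of the power series [b] near 0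
   without mentioning limits. *)
Definition germ f b := exists r K, germ_on f b r K.

Lemma germ_on_shrink f b r r' K K' : 0 < r' -> r' <= r -> K <= K' ->
  germ_on f b r K -> germ_on f b r' K'.
Proof.
move=> r'0 r'r KK' [r0 K0 H]; split => //; first exact: le_trans KK'.
move=> N x xr'; apply: (le_trans (H N x (lt_le_trans xr' r'r))).
apply: ler_pM => //; first by rewrite exprn_ge0 // divr_ge0 // ltW.
by apply: lerXn2r; rewrite ?nnegrE ?divr_ge0 ?(ltW r0) ?(ltW r'0) // ler_wpM2l // lef_pV2 ?posrE.
Qed.

Lemma near0_all (P : R -> Prop) : (forall x, P x) -> \forall x \near (0 : R), P x.
Proof. by move=> H; apply/near0P; exists 1. Qed.

Lemma germ_common f g b c : germ f b -> germ g c ->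
  exists r K, germ_on f b r K /\ germ_on g c r K.
Proof.
move=> [r [K H]] [r' [K' H']].
have [r0 K0 _] := H; have [r'0 K'0 _] := H'.
exists (Num.min r r'), (Num.max K K').
by split; [apply: germ_on_shrink H|apply: germ_on_shrink H'];
  rewrite ?lt_min ?r0 ?r'0 ?ge_min ?le_max ?lexx ?orbT.
Qed.

(** [b n * x ^+ n] is the difference of two consecutive remainders. At [x = r / 2] this gives the
    factor [3 / 2], rounded up to [2]. *)
Lemma germ_on_coef f b r K n : germ_on f b r K -> `|b n| <= 2 * K / r ^+ n.
Proof.
move=> [r0 K0 H].
pose x := r / 2; have x0 : 0 < x by rewrite divr_gt0.
have xr : `|x| < r by rewrite gtr0_norm // /x; lra.
have := H n.+1 x xr; have := H n x xr.
rewrite big_ord_recr /=; set S := \sum_(k < n) _.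
rewrite (gtr0_norm x0) => H1 H2.
have H3 : `|b n * x ^+ n| <= K * (x / r) ^+ n + K * (x / r) ^+ n.+1.
  have -> : b n * x ^+ n = (f x - S) - (f x - (S + b n * x ^+ n)) by ring.
  by apply: (le_trans (ler_normB _ _)); apply: lerD.
have xn0 : 0 < x ^+ n by rewrite exprn_gt0.
have rn0 : 0 < r ^+ n by rewrite exprn_gt0.
have Ex : (x / r) ^+ n = x ^+ n / r ^+ n by rewrite exprMn exprVn.
have E2 : x / r = 2^-1 by rewrite /x; field; rewrite gt_eqF.
move: H3; rewrite normrM (gtr0_norm xn0) exprS Ex E2 -ler_pdivlMr // => H3; apply: (le_trans H3).
have -> : (K * (x ^+ n / r ^+ n) + K * (2^-1 * (x ^+ n / r ^+ n))) / x ^+ n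
   = (3 / 2) * K / r ^+ n by field; rewrite !gt_eqF.
by rewrite ler_wpM2r ?invr_ge0 ?(ltW rn0) // ler_wpM2r //; lra.
Qed.

Lemma germ_on_bound f b r K x : germ_on f b r K -> `|x| < r -> `|f x| <= K.
Proof. by move=> [r0 K0 H] /(H 0%N); rewrite big_ord0 subr0 expr0 mulr1. Qed.

Lemma germ_ext f g b : (\forall x \near 0, f x = g x) -> germ f b -> germ g b.
Proof.
move=> /near0P [e [e0 fg]] [r [K H]]; have [r0 K0 _] := H.
have [|||_ _ H'] := germ_on_shrink (r' := Num.min r e) (K' := K) _ _ _ H;
  rewrite ?lt_min ?r0 ?ge_min ?lexx //.
exists (Num.min r e), K; split; rewrite ?lt_min ?r0 //.
by move=> N x xm; rewrite -fg; [exact: H'|move: xm; rewrite lt_min => /andP[]].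
Qed.

Lemma germ_extc f b c : b =1 c -> germ f b -> germ f c.
Proof. by move=> /funext ->. Qed.

Lemma germ_cst a : germ (fun=> a) (fun k => if k == 0%N then a else 0).
Proof.
exists 1, `|a|; split => // [[|N]] x xr.
  by rewrite big_ord0 subr0 expr0 mulr1.
rewrite big_ord_recl /= expr0 mulr1 big1 ?addr0 ?subrr ?normr0; last by move=> i _; rewrite mul0r.
by rewrite mulr_ge0 // exprn_ge0 // divr_ge0.
Qed.

Lemma germ_id : germ id (fun k => (k == 1%N)%:R).
Proof.
exists 1, 1; split => // [[|[|N]]] x xr.
- by rewrite big_ord0 subr0 expr0 mulr1 ltW.
- by rewrite big_ord_recl big_ord0 /= mul0r addr0 subr0 expr1 divr1 mul1r.
- rewrite !big_ord_recl /= mul0r mul1r big1 ?addr0 ?add0r ?expr1 ?mul1r ?subrr ?normr0; last by move=> i _; rewrite mul0r.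
  by rewrite divr1 exprn_ge0.
Qed.

Lemma germ_add f g b c : germ f b -> germ g c ->
  germ (fun x => f x + g x) (fun k => b k + c k).
Proof.
move=> Hf Hg; have [r [K [[r0 K0 Hf'] [_ _ Hg']]]] := germ_common Hf Hg.
exists r, (K + K); split => //; first exact: addr_ge0.
move=> N x xr; under eq_bigr do rewrite mulrDl; rewrite big_split /= mulrDl.
set A := \sum_(i < N) _; set B := \sum_(i < N) _.
have -> : f x + g x - (A + B) = (f x - A) + (g x - B) by ring.
by apply: (le_trans (ler_normD _ _)); apply: lerD; [apply: Hf'|apply: Hg'].
Qed.

Lemma germ_scale a f b : germ f b -> germ (fun x => a * f x) (fun k => a * b k).
Proof.
move=> [r [K [r0 K0 H]]]; exists r, (`|a| * K); split => //; first exact: mulr_ge0.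
move=> N x xr; under eq_bigr do rewrite -mulrA; rewrite -mulr_sumr -mulrBr normrM -mulrA.
by rewrite ler_wpM2l // H.
Qed.

Lemma germ_sum n (f : 'I_n -> R -> R) (b : 'I_n -> nat -> R) :
  (forall i, germ (f i) (b i)) ->
  germ (fun x => \sum_(i < n) f i x) (fun k => \sum_(i < n) b i k).
Proof.
elim: n f b => [|n IH] f b H.
  apply: germ_ext (germ_extc _ (germ_cst 0)); first by apply: near0_all => x; rewrite big_ord0.
  by move=> k; rewrite big_ord0 if_same.
apply: germ_ext (germ_extc _ (germ_add (IH _ _ (fun i => H (widen_ord (leqnSn n) i))) (H ord_max))).
- by apply: near0_all => x; rewrite big_ord_recr.
- by move=> k; rewrite big_ord_recr.
Qed.

Definition cprod b c k := \sum_(i < k.+1) b i * c (k - i)%N.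

(** Arranged by the index of [b], the partial sum pairs each term of [b] with a partial sum of [c]
    of complementary length, so that the remainders of the second factor can be inserted. *)
Lemma cprod_psum b c N x :
  \sum_(k < N) cprod b c k * x ^+ k =
  \sum_(i < N) b i * x ^+ i * \sum_(k < (N - i)%N) c k * x ^+ k.
Proof.
elim: N => [|N IH]; first by rewrite !big_ord0.
rewrite big_ord_recr /= IH [RHS]big_ord_recr /= subSnn big_ord_recr big_ord0 /= add0r.
rewrite /cprod big_ord_recr /= subnn.
under [X in _ = X + _]eq_bigr => i _.
  rewrite subSn ?[X in (_ <= X)%N]ltnW //; last exact: ltnW (ltn_ord i).
  rewrite big_ord_recr /= mulrDr; over.
rewrite big_split /= mulrDl mulr_suml -addrA expr0; congr (_ + (_ + _)); last by ring.
apply: eq_bigr => i _; have iN := ltn_ord i.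
have -> : x ^+ N = x ^+ i * x ^+ (N - i) by rewrite -exprD subnKC // ltnW.
by ring.
Qed.

Lemma natr_le_expr2 n : n.+1%:R <= (2 : R) ^+ n.
Proof. by rewrite -natrX ler_nat ltn_expl. Qed.

Lemma germ_mul f g b c : germ f b -> germ g c ->
  germ (fun x => f x * g x) (cprod b c).
Proof.
move=> Hf Hg; have [r [K [Hf1 Hg1]]] := germ_common Hf Hg.
have [r0 K0 Hf'] := Hf1; have [_ _ Hg'] := Hg1.
(* The error is a sum of about [N] terms of size [(|x| / r) ^+ N]; halving the radius provides the
   factor [2 ^+ N] that absorbs their number. *)
exists (r / 2), (2 * K * K); split; first by rewrite divr_gt0.
  by rewrite !mulr_ge0.
move=> N x xr2; have xr : `|x| < r by apply: lt_trans xr2 _; lra.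
rewrite cprod_psum.
have -> : f x * g x - \sum_(i < N) b i * x ^+ i * \sum_(k < (N - i)%N) c k * x ^+ k =
  (f x - \sum_(i < N) b i * x ^+ i) * g x +
  \sum_(i < N) b i * x ^+ i * (g x - \sum_(k < (N - i)%N) c k * x ^+ k).
  rewrite mulrBl -addrA; congr (_ + _); rewrite mulr_suml -sumrN -sumrN -big_split /=.
  by apply: eq_bigr => i _; ring.
apply: (le_trans (ler_normD _ _)).
have H1 : `|(f x - \sum_(i < N) b i * x ^+ i) * g x| <= K * K * (`|x| / r) ^+ N.
  rewrite normrM mulrAC; apply: ler_pM => //; first exact: Hf'.
  exact: germ_on_bound Hg1 xr.
have H2 : `|\sum_(i < N) b i * x ^+ i * (g x - \sum_(k < (N - i)%N) c k * x ^+ k)|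
   <= \sum_(i < N) 2 * K * K * (`|x| / r) ^+ N.
  apply: (le_trans (ler_norm_sum _ _ _)); apply: ler_sum => i _.
  rewrite !normrM normrX.
  have -> : 2 * K * K * (`|x| / r) ^+ N =
    2 * K / r ^+ i * `|x| ^+ i * (K * (`|x| / r) ^+ (N - i)).
    have -> : (`|x| / r) ^+ N = (`|x| / r) ^+ i * (`|x| / r) ^+ (N - i) by rewrite -exprD subnKC // ltnW.
    by rewrite exprMn exprVn; ring.
  apply: ler_pM; rewrite ?mulr_ge0 ?exprn_ge0 //; last exact: Hg'.
  by rewrite ler_wpM2r ?exprn_ge0 //; apply: germ_on_coef Hf1.
apply: (le_trans (lerD H1 H2)).
rewrite sumr_const card_ord -[X in _ + X <= _]mulr_natr.
have -> : `|x| / (r / 2) = 2 * (`|x| / r) by field; rewrite gt_eqF.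
rewrite [(2 * _) ^+ N]exprMn.
have Y : 0 <= (`|x| / r) ^+ N by rewrite exprn_ge0 // divr_ge0 // ltW.
have Z := natr_le_expr2 N; rewrite -natr1 in Z.
have KK : 0 <= K * K * (`|x| / r) ^+ N by rewrite !mulr_ge0.
by nra.
Qed.

(** With zero coefficients and [|x| < r / 2] the remainder bounds say [|f x| <= K / 2 ^+ N] for
    every [N]. *)
Lemma germ0_eq0 f : germ f (fun=> 0) -> \forall x \near 0, f x = 0.
Proof.
move=> [r [K [r0 K0 H]]]; apply/near0P; exists (r / 2); split; first by rewrite divr_gt0.
move=> x xr; apply/eqP; rewrite -normr_eq0; apply/negPn/negP => fx0.
have fx : 0 < `|f x| by rewrite lt_def fx0 normr_ge0.
have H' N : `|f x| * 2 ^+ N <= K.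
  have xr' : `|x| < r by apply: lt_trans xr _; lra.
  have := H N x xr'; rewrite big1 ?subr0; last by move=> i _; rewrite mul0r.
  move=> /le_trans /(_ (_ : _ <= K * 2^-1 ^+ N)) H2.
  rewrite -ler_pdivlMr ?exprn_gt0 // -exprVn; apply: H2.
  rewrite ler_wpM2l //; apply: lerXn2r; rewrite ?nnegrE ?divr_ge0 ?invr_ge0 // ?(ltW r0) //.
  by rewrite ler_pdivrMr // ltW // mulrC.
have := H' (Num.truncn (K / `|f x|)).
rewrite -ler_pdivlMl // mulrC leNgt => /negP; apply.
apply: lt_le_trans (natr_le_expr2 _).
by apply: truncnS_gt.
Qed.

Lemma small_pos (s : seq R) : all (fun e => 0 < e) s -> exists x : R, 0 < x /\ all (fun e => x < e) s.
Proof.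
elim: s => [|e s IH] /=; first by exists 1.
move=> /andP[e0 /IH [x [x0 Hx]]]; exists (Num.min x (e / 2)); split.
  by rewrite lt_min x0 divr_gt0.
rewrite gt_min; apply/andP; split; first by apply/orP; right; lra.
by apply: sub_all Hx => y xy; rewrite gt_min xy.
Qed.

(** Induction on [k]: once the lower coefficients vanish, [b k * x ^+ k] is [f] minus a remainder,
    both of order [k + 1]. The bound is asked off [0] only, so that identities obtained by dividing
    by powers of [x] qualify. *)
Lemma germ_coef_bigO f b m (C : R) : germ f b ->
  (\forall x \near (0 : R), x != 0 -> `|f x| <= C * `|x| ^+ m) -> forall k, (k < m)%N -> b k = 0.
Proof.
move=> [r [K [r0 K0 H]]] /near0P [e [e0 He]] k; elim/ltn_ind: k => k IH km.
pose D : R := `|C| + K / r ^+ k.+1.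
have D0 : 0 <= D by rewrite addr_ge0 // divr_ge0 // exprn_ge0 // ltW.
have Hb x : 0 < x -> x < r -> x < e -> x < 1 -> `|b k| <= D * x.
  move=> x0 xr xe x1; have := H k.+1 x; rewrite (gtr0_norm x0) => /(_ xr).
  rewrite big_ord_recr /= big1 ?add0r; last first.
    by move=> i _; rewrite IH ?mul0r // (ltn_trans (ltn_ord i)).
  have := He x; rewrite (gtr0_norm x0) => /(_ xe (lt0r_neq0 x0)) H1 H2.
  have H3 : `|b k * x ^+ k| <= `|C| * x ^+ k.+1 + K * (x / r) ^+ k.+1.
    have -> : b k * x ^+ k = f x - (f x - b k * x ^+ k) by ring.
    apply: (le_trans (ler_normB _ _)); apply: lerD => //.
    apply: (le_trans H1); apply: (@le_trans _ _ (`|C| * x ^+ m)).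
      by rewrite ler_wpM2r ?exprn_ge0 ?(ltW x0) // ler_norm.
    rewrite ler_wpM2l // ler_wiXn2l // ltW //.
  move: H3; rewrite normrM (gtr0_norm (exprn_gt0 k x0)) exprMn exprVn.
  rewrite (mulrC (x ^+ k.+1)) mulrA -mulrDl [x ^+ k.+1]exprS.
  by rewrite mulrA ler_pM2r ?exprn_gt0.
apply/eqP; rewrite -normr_eq0; apply/negPn/negP => bk0.
have bk : 0 < `|b k| by rewrite lt_def bk0 normr_ge0.
have [|x [x0 /= /and5P[xr xe x1 xd _]]] := @small_pos [:: r; e; 1; `|b k| / (D + 1)].
  by rewrite /= r0 e0 ltr01 divr_gt0 // ltr_wpDl.
have := Hb x x0 xr xe x1; rewrite leNgt => /negP; apply.
move: xd; rewrite ltr_pdivlMr ?ltr_wpDl //; nra.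
Qed.

Lemma germ_divX f b m : germ f b -> (forall k, (k < m)%N -> b k = 0) ->
  exists2 g, germ g (fun k => b (m + k)%N) & \forall x \near 0, f x = x ^+ m * g x.
Proof.
move=> [r [K [r0 K0 H]]] bm.
(* The value at [0] is forced: it is the constant coefficient of the quotient, whereas
   [f 0 / 0 ^+ m] is [0] for [m > 0]. *)
exists (fun x => if x == 0 then b m else f x / x ^+ m); last first.
  apply/near0P; exists r; split => // x xr; case: ifPn => [/eqP ->|x0].
    have := H m.+1 0; rewrite normr0 r0 => /(_ isT).
    rewrite big_ord_recr /= big1 ?add0r; last by move=> i _; rewrite bm ?mul0r.
    rewrite mul0r exprS mul0r mulr0 normr_le0 subr_eq0 => /eqP ->; exact: mulrC.
  by rewrite mulrC divfK // expf_neq0.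
exists r, (2 * K / r ^+ m); split => //; first by rewrite divr_ge0 ?mulr_ge0 // exprn_ge0 // ltW.
move=> N x xr; case: ifPn => [/eqP ->|x0].
  case: N => [|N].
    have H1 : `|b m| <= 2 * K / r ^+ m by apply: (@germ_on_coef f).
    by rewrite big_ord0 subr0 expr0 mulr1.
  rewrite big_ord_recl /= addn0 expr0 mulr1 big1 ?addr0 ?subrr; last first.
    by move=> i _; rewrite /bump /= exprS mul0r mulr0.
  by rewrite normr0 mul0r exprS mul0r mulr0.
have xm : 0 < `|x| ^+ m by rewrite exprn_gt0 // normr_gt0.
have := H (m + N)%N x xr.
rewrite big_split_ord /= big1 ?add0r; last by move=> i _; rewrite bm ?mul0r.
have -> : f x - \sum_(i < N) b (m + i)%N * x ^+ (m + i) =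
   x ^+ m * (f x / x ^+ m - \sum_(i < N) b (m + i)%N * x ^+ i).
  rewrite mulrBr mulrCA divff ?expf_neq0 // mulr1; congr (_ - _).
  by rewrite mulr_sumr; apply: eq_bigr => i _; rewrite exprD; ring.
rewrite normrM normrX exprD exprMn exprVn.
have -> : K * (`|x| ^+ m / r ^+ m * (`|x| / r) ^+ N) = `|x| ^+ m * (K / r ^+ m * (`|x| / r) ^+ N) by ring.
rewrite ler_pM2l // => /le_trans; apply.
rewrite ler_wpM2r ?exprn_ge0 ?divr_ge0 ?(ltW r0) // ler_wpM2r ?invr_ge0 ?exprn_ge0 ?(ltW r0) //.
by rewrite mulr_natl mulr2n lerDl.
Qed.

Lemma germ_at0 f b : germ f b -> f 0 = b 0%N.
Proof.
move=> [r [K [r0 K0 H]]]; have := H 1%N 0; rewrite normr0 r0 => /(_ isT).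
by rewrite big_ord1 expr0 mulr1 mul0r expr1 mulr0 normr_le0 subr_eq0 => /eqP.
Qed.

Lemma germ_continuous0 f b : germ f b -> f x @[x --> 0] --> f 0.
Proof.
move=> Hf; rewrite (germ_at0 Hf); move: Hf => [r [K [r0 K0 H]]].
apply/cvgrPdist_lt => e e0; apply/near0P.
exists (Num.min r (e * r / (K + 1))); split.
  by rewrite lt_min r0 divr_gt0 ?mulr_gt0 // ltr_wpDl.
move=> x; rewrite lt_min => /andP[xr xe]; rewrite distrC.
have := H 1%N x xr; rewrite big_ord1 expr0 mulr1 expr1 => /le_lt_trans; apply.
move: xe; rewrite ltr_pdivlMr ?ltr_wpDl // mulrA ltr_pdivrMr // => xe.
apply: le_lt_trans xe; rewrite mulrDr mulr1 mulrC lerDl; exact: normr_ge0.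
Qed.

(** This and [germ_eval] are the bridge to the limits in the statement. On half the radius the
    majorizing geometric series has ratio at most [1 / 2], so each tail is at most twice its first
    term. *)
Lemma germ_series b : conv_series1 b -> germ (eval_series1 b) b.
Proof.
move=> [r [r0 [K HK]]].
have K0 : 0 <= K by apply: le_trans (HK 0%N); rewrite mulr_ge0 // exprn_ge0 // ltW.
pose s N x := \sum_(k < N) b k * x ^+ k.
have Hs x N n : `|x| < r / 2 -> `|s (N + n)%N x - s N x| <= 2 * K * (`|x| / r) ^+ N.
  move=> xr; rewrite /s big_split_ord /= addrAC subrr add0r.
  have q0 : 0 <= `|x| / r by rewrite divr_ge0 // ltW.
  have qh : `|x| / r <= 2^-1 by rewrite ler_pdivrMr // mulrC ltW.
  have Hi i : `|b (N + i)%N * x ^+ (N + i)| <= K * (`|x| / r) ^+ N * (`|x| / r) ^+ i.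
    rewrite -mulrA -exprD normrM normrX exprMn exprVn mulrCA [X in X <= _]mulrC ler_wpM2l ?exprn_ge0 //.
    by rewrite ler_pdivlMr ?exprn_gt0.
  have G : \sum_(i < n) (`|x| / r) ^+ i <= 2 * (1 - (`|x|/r) ^+ n).
    elim: n => [|n IH]; first by rewrite big_ord0 expr0 subrr mulr0.
    rewrite big_ord_recr /=; have : (`|x| / r) ^+ n.+1 <= 2^-1 * (`|x|/r) ^+ n.
      by rewrite exprS ler_wpM2r // exprn_ge0.
    by move: IH; lra.
  apply: (le_trans (ler_norm_sum _ _ _)).
  apply: (@le_trans _ _ (\sum_(i < n) K * (`|x| / r) ^+ N * (`|x| / r) ^+ i)).
    by apply: ler_sum => i _.
  rewrite -mulr_sumr mulrAC [2 * K]mulrC mulrAC -mulrA -[X in _ <= X]mulrA ler_wpM2l //.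
  rewrite mulrC ler_wpM2r ?exprn_ge0 // (le_trans G) //.
  by have : 0 <= (`|x| / r) ^+ n by [rewrite exprn_ge0]; lra.
have cvg x : `|x| < r / 2 -> cvgn (s^~ x).
  move=> xr.
  have -> : s^~ x = series (fun k => b k * x ^+ k).
    by apply/funext => n; rewrite /series /= big_mkord.
  apply: normed_cvg; apply: (@series_le_cvg _ _ (geometric K (`|x| / r))) => [n|n|n|].
  - exact: normr_ge0.
  - by rewrite /geometric /= mulr_ge0 // exprn_ge0 // divr_ge0 // ltW.
  - by rewrite /geometric /= normrM normrX exprMn exprVn mulrCA [X in X <= _]mulrC ler_wpM2l ?exprn_ge0 // ler_pdivlMr ?exprn_gt0.
  - apply: is_cvg_geometric_series; rewrite ger0_norm; last by rewrite divr_ge0 // ltW.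
    by rewrite ltr_pdivrMr // mul1r; lra.
exists (r / 2), (2 * K); split; rewrite ?divr_gt0 ?mulr_ge0 //.
move=> N x xr.
have -> : eval_series1 b x = lim (s^~ x @ \oo) by [].
have /cvgrPdist_lt Hc := cvg x xr.
apply: (@le_trans _ _ (2 * K * (`|x| / r) ^+ N)).
  apply/ler_addgt0Pr => e e0; have /= [n _ Hn] := Hc e e0.
  have := Hn (N + n)%N (leq_addl _ _); rewrite /= -/(s N x) => H1.
  have -> : lim (s^~ x @ \oo) - s N x = (s (N + n)%N x - s N x) + (lim (s^~ x @ \oo) - s (N + n)%N x) by ring.
  by apply: (le_trans (ler_normD _ _)); apply: lerD; [exact: Hs|exact: ltW].
rewrite ler_wpM2l ?mulr_ge0 //; apply: lerXn2r; rewrite ?nnegrE ?divr_ge0 ?(ltW r0) //.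
by rewrite ler_wpM2l // lef_pV2 ?posrE ?divr_gt0 //; lra.
Qed.

Lemma germ_conv f b : germ f b -> conv_series1 b.
Proof.
move=> [r [K H]]; have [r0 _ _] := H; exists r; split => //; exists (2 * K) => n.
by rewrite -ler_pdivlMr ?exprn_gt0 //; apply: germ_on_coef H.
Qed.

Lemma germ_eval f b : germ f b -> \forall x \near (0 : R), f x = eval_series1 b x.
Proof.
move=> Hf; have Hb := germ_series (germ_conv Hf).
have : germ (fun x => f x + -1 * eval_series1 b x) (fun=> 0).
  apply: germ_extc (germ_add Hf (germ_scale (-1) Hb)) => k.
  by rewrite mulN1r subrr.
move/germ0_eq0; apply: filterS => x; rewrite mulN1r => /eqP.
by rewrite subr_eq0 => /eqP.
Qed.

Definition analytic f := exists b, germ f b.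

Lemma an_cst a : analytic (fun=> a). Proof. by eexists; apply: germ_cst. Qed.
Lemma an_id : analytic id. Proof. by eexists; apply: germ_id. Qed.
Lemma an_add f g : analytic f -> analytic g -> analytic (fun x => f x + g x).
Proof. by move=> [b Hb] [c Hc]; eexists; apply: germ_add Hb Hc. Qed.
Lemma an_mul f g : analytic f -> analytic g -> analytic (fun x => f x * g x).
Proof. by move=> [b Hb] [c Hc]; eexists; apply: germ_mul Hb Hc. Qed.
Lemma an_opp f : analytic f -> analytic (fun x => - f x).
Proof.
move=> [b Hb]; exists (fun k => -1 * b k).
by apply: germ_ext (germ_scale (-1) Hb); apply: near0_all => x; rewrite mulN1r.
Qed.
Lemma an_exp f n : analytic f -> analytic (fun x => f x ^+ n).
Proof.
move=> Hf; elim: n => [|n IH]; first exact: an_cst.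
by have [b Hb] := an_mul Hf IH; exists b; apply: germ_ext Hb; apply: near0_all => x; rewrite exprS.
Qed.
Lemma an_ext f g : (\forall x \near (0 : R), f x = g x) -> analytic f -> analytic g.
Proof. by move=> fg [b Hb]; exists b; apply: germ_ext Hb. Qed.
Lemma an_sum n (f : 'I_n -> R -> R) : (forall i, analytic (f i)) ->
  analytic (fun x => \sum_(i < n) f i x).
Proof. by move=> /boolp.choice [b Hb]; eexists; apply: germ_sum Hb. Qed.

Lemma an_continuous0 f : analytic f -> f x @[x --> 0] --> f 0.
Proof. by move=> [b]; apply: germ_continuous0. Qed.

Lemma an_divX f m (C : R) : analytic f ->
  (\forall x \near (0 : R), x != 0 -> `|f x| <= C * `|x| ^+ m) ->
  exists2 g, analytic g & \forall x \near (0 : R), f x = x ^+ m * g x.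
Proof.
move=> [b Hb] /(germ_coef_bigO Hb) Hm; have [g Hg fg] := germ_divX Hb Hm.
by exists g => //; exists (fun k => b (m + k)%N).
Qed.

Lemma an_order f : analytic f -> (\forall x \near (0 : R), f x = 0) \/
  exists m g, [/\ analytic g, g 0 != 0 & \forall x \near (0 : R), f x = x ^+ m * g x].
Proof.
move=> [b Hb]; have [b0|] := pselect (forall k, b k = 0).
  by left; apply: germ0_eq0; apply: germ_extc Hb.
move=> /existsNP [k /eqP bk]; right.
have Hex : exists k, b k != 0 by exists k.
pose m := ex_minn Hex; have [m' bm Hmin] : exists2 m', b m' != 0 & forall i, b i != 0 -> (m' <= i)%N.
  by exists m; rewrite /m; case: ex_minnP.
have [|g Hg fg] := germ_divX (m := m') Hb.
  by move=> i im; apply/eqP/negPn/negP => /Hmin; rewrite leqNgt im.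
exists m', g; split => //; first by exists (fun k => b (m' + k)%N).
by rewrite (germ_at0 Hg) addn0.
Qed.

Lemma an_eq_at0 f g : analytic f -> analytic g ->
  (\forall x \near (0 : R), x != 0 -> f x = g x) -> \forall x \near (0 : R), f x = g x.
Proof.
move=> Hf Hg fg; have [b Hb] := an_add Hf (an_opp Hg).
have b0 k : b k = 0.
  apply: (germ_coef_bigO (m := k.+1) (C := 0) Hb) => //.
  by apply: filterS fg => x fg x0; rewrite fg // subrr normr0 mul0r.
have := germ0_eq0 (germ_extc b0 Hb); apply: filterS => x /eqP.
by rewrite subr_eq0 => /eqP.
Qed.

End Germs.

(** * Hensel's lemma for analytic families of polynomials *)

Section Hensel.
Variable R : realType.
Implicit Types (f g : R -> R) (b c : nat -> R).

(** The weighted l1 norm of a coefficient sequence is used on truncations only, with bounds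
    independent of [N], so no infinite sum is formed. The vanishing constant term makes it tend to
    [0] with [d]. *)
Lemma psum_norm_small b (eps : R) : conv_series1 b -> b 0%N = 0 -> 0 < eps ->
  \forall d \near (0 : R), 0 <= d -> forall N, \sum_(k < N) `|b k| * d ^+ k <= eps.
Proof.
move=> [r [r0 [K HK]]] b0 eps0.
have K0 : 0 <= K by apply: le_trans (HK 0%N); rewrite mulr_ge0 // exprn_ge0 // ltW.
apply/near0P; exists (Num.min (r / 2) (r * eps / (2 * K + 1))); split.
  by rewrite lt_min !divr_gt0 ?mulr_gt0 // ltr_wpDl // mulr_ge0.
move=> d; rewrite lt_min => /andP[d1 d2] d0 N; rewrite ger0_norm // in d1 d2.
pose q := d / r.
have q0 : 0 <= q by rewrite divr_ge0 // ltW.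
have qh : q <= 2^-1 by rewrite ler_pdivrMr // mulrC ltW.
have qe : 2 * K * q <= eps.
  have : q * (2 * K + 1) <= eps.
    move: d2; rewrite ltr_pdivlMr; last by rewrite ltr_wpDl // mulr_ge0.
    by rewrite /q mulrAC ler_pdivrMr // => /ltW; rewrite [eps * r]mulrC.
  by nra.
have Hk k : `|b k| * d ^+ k <= K * q ^+ k.
  have -> : d = q * r by rewrite /q divfK // gt_eqF.
  rewrite exprMn mulrCA [X in _ <= X]mulrC ler_wpM2l ?exprn_ge0 //.
case: N => [|N]; first by rewrite big_ord0 ltW.
apply: (@le_trans _ _ (2 * K * q * (1 - q ^+ N))); last first.
  have : 0 <= q ^+ N by rewrite exprn_ge0.
  have : 0 <= 2 * K * q by rewrite mulr_ge0 // mulr_ge0.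
  by nra.
elim: N => [|N IH]; first by rewrite big_ord1 b0 normr0 mul0r expr0 subrr mulr0.
rewrite big_ord_recr /=; apply: (le_trans (lerD IH (Hk N.+1))).
rewrite exprS; have : 0 <= K * q * q ^+ N by rewrite mulr_ge0 ?exprn_ge0 // mulr_ge0.
by nra.
Qed.

(** The truncated norm is submultiplicative: truncating the product discards nonnegative terms
    only. *)
Lemma cprod_psum_norm b c (d : R) N : 0 <= d ->
  \sum_(k < N) `|cprod b c k| * d ^+ k <=
  (\sum_(k < N) `|b k| * d ^+ k) * (\sum_(k < N) `|c k| * d ^+ k).
Proof.
move=> d0; apply: (@le_trans _ _
  (\sum_(k < N) cprod (fun k => `|b k|) (fun k => `|c k|) k * d ^+ k)).
  apply: ler_sum => k _; rewrite ler_wpM2r ?exprn_ge0 //.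
  by apply: (le_trans (ler_norm_sum _ _ _)); apply: ler_sum => i _; rewrite normrM.
rewrite cprod_psum mulr_suml; apply: ler_sum => i _.
rewrite ler_wpM2l ?mulr_ge0 ?exprn_ge0 //.
have Ni : (N - i <= N)%N by rewrite leq_subr.
rewrite (big_ord_widen _ (fun k => `|c k| * d ^+ k) Ni) [leRHS](bigID (fun k : 'I_N => (k < N - i)%N)) /=.
by rewrite lerDl sumr_ge0 // => k _; rewrite mulr_ge0 ?exprn_ge0.
Qed.

(** * Power series solutions of a quadratic fixed-point system *)

Section QuadraticSystem.
Variables (n : nat) (l : 'I_n -> nat -> R) (be : 'I_n -> 'I_n -> 'I_n -> R).
Hypothesis l0 : forall i, l i 0%N = 0.
Hypothesis lconv : forall i, conv_series1 (l i).

Definition qsys_step (w : 'I_n -> nat -> R) i k :=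
  l i k + \sum_j \sum_m be i j m * cprod (w j) (w m) k.
Fixpoint qsys_iter s : 'I_n -> nat -> R :=
  if s is s'.+1 then qsys_step (qsys_iter s') else fun _ _ => 0.
Local Notation T := qsys_step.
Local Notation it := qsys_iter.

(** In a product of series without constant term, coefficient [k] involves only indices strictly
    between [0] and [k]; each iteration therefore fixes one more coefficient. *)
Let T_local w w' s : (forall i, w i 0%N = 0) -> (forall i, w' i 0%N = 0) ->
  (forall i k, (k <= s)%N -> w i k = w' i k) ->
  forall i k, (k <= s.+1)%N -> T w i k = T w' i k.
Proof.
move=> w0 w'0 ww i k ks; rewrite /T; congr (_ + _).
apply: eq_bigr => j _; apply: eq_bigr => m _; congr (_ * _).
rewrite /cprod; apply: eq_bigr => a _; have ak := ltn_ord a.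
have [a0|a0] := posnP a; first by rewrite a0 w0 w'0 !mul0r.
have [ka|ka] := posnP (k - a)%N; first by rewrite ka w0 w'0 !mulr0.
by rewrite !ww //; lia.
Qed.

Let it0 s i : it s i 0%N = 0.
Proof.
elim: s i => [|s IH] i //=; rewrite /T l0 add0r big1 // => j _.
by rewrite big1 // => m _; rewrite /cprod big_ord1 IH mul0r mulr0.
Qed.

Let it_stable s : forall i k, (k <= s)%N -> it s.+1 i k = it s i k.
Proof.
elim: s => [|s IH] i k ks; first by move: ks; rewrite leqn0 => /eqP ->; rewrite !it0.
exact: (@T_local (it s.+1) (it s) s (it0 _) (it0 _) IH i k ks).
Qed.

Let it_le s s' i k : (k <= s)%N -> (s <= s')%N -> it s' i k = it s i k.
Proof.
move=> ks; elim: s' => [|s' IH]; first by rewrite leqn0 => /eqP ->.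
rewrite leq_eqVlt => /orP[/eqP -> //|]; rewrite ltnS => ss'.
by rewrite it_stable ?IH // (leq_trans ks).
Qed.

(** Coefficient [k] no longer changes after [k] iterations, which defines the solution. Its
    convergence comes from a ball of the truncated norm that contains all iterates. *)
Lemma quadratic_system_series : exists w : 'I_n -> nat -> R,
  [/\ forall i, w i 0%N = 0, forall i, conv_series1 (w i) &
  forall i k, w i k = l i k + \sum_j \sum_m be i j m * cprod (w j) (w m) k].
Proof.
exists (fun i k => it k i k); split; first by move=> i; apply: it0.
  pose B : R := \sum_i \sum_j \sum_m `|be i j m|.
  have B0 : 0 <= B by do !(apply: sumr_ge0 => ? _).
  (* On the ball of radius [kap] the quadratic part is at most [B * kap * kap <= kap / 2]; the
     weight [d] is then taken so small that [l] fills at most the other half. *)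
  pose kap : R := (2 * (B + 1))^-1.
  have kap0 : 0 < kap by rewrite invr_gt0 mulr_gt0 // ltr_wpDl.
  have kapB : B * kap <= 2^-1.
    by rewrite /kap ler_pdivrMr ?mulr_gt0 ?ltr_wpDl // ; lra.
  have : \forall d \near (0 : R), forall i, 0 <= d -> forall N,
      \sum_(k < N) `|l i k| * d ^+ k <= kap / (2 * n.+1%:R).
    apply: near0_forall => i; apply: psum_norm_small => //.
    by rewrite divr_gt0 // mulr_gt0.
  move=> /near0P [e [e0 He]]; pose d := e / 2.
  have d0 : 0 < d by rewrite divr_gt0.
  have {}He i N : \sum_(k < N) `|l i k| * d ^+ k <= kap / (2 * n.+1%:R).
    by apply: He; rewrite ?ltW // gtr0_norm // /d; lra.
  pose nrm N (u : 'I_n -> nat -> R) := \sum_i \sum_(k < N) `|u i k| * d ^+ k.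
  have nrm1 N (u : 'I_n -> nat -> R) i : \sum_(k < N) `|u i k| * d ^+ k <= nrm N u.
    rewrite /nrm (bigD1 i) //= lerDl; apply: sumr_ge0 => j _; apply: sumr_ge0 => k _.
    by rewrite mulr_ge0 // exprn_ge0 // ltW.
  have nrm0 N (u : 'I_n -> nat -> R) i : 0 <= \sum_(k < N) `|u i k| * d ^+ k.
    by apply: sumr_ge0 => k _; rewrite mulr_ge0 // exprn_ge0 // ltW.
  have nrml N : nrm N l <= kap / 2.
    apply: (@le_trans _ _ (\sum_(i < n) kap / (2 * n.+1%:R))); first by apply: ler_sum.
    rewrite sumr_const card_ord -[X in X <= _]mulr_natr invfM mulrA -mulrA ger_pMr ?divr_gt0 //.
    by rewrite mulrC ler_pdivrMr // mul1r ler_nat leqnSn.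
  have nrmT N u : nrm N u <= kap -> nrm N (T u) <= kap.
    move=> Hu.
    have : nrm N (T u) <= nrm N l + B * (kap * kap).
      rewrite /nrm /B mulr_suml -big_split /=; apply: ler_sum => i _.
      apply: (@le_trans _ _ (\sum_(k < N) (`|l i k| * d ^+ k +
         \sum_j \sum_m `|be i j m| * (`|cprod (u j) (u m) k| * d ^+ k)))).
        apply: ler_sum => k _; have dk : 0 <= d ^+ k by rewrite exprn_ge0 // ltW.
        have -> : \sum_j \sum_m `|be i j m| * (`|cprod (u j) (u m) k| * d ^+ k) =
          (\sum_j \sum_m `|be i j m| * `|cprod (u j) (u m) k|) * d ^+ k.
          rewrite mulr_suml; apply: eq_bigr => j _; rewrite mulr_suml.
          by apply: eq_bigr => m _; rewrite mulrA.
        rewrite -mulrDl ler_wpM2r //; apply: (le_trans (ler_normD _ _)); rewrite lerD2l.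
        apply: (le_trans (ler_norm_sum _ _ _)); apply: ler_sum => j _.
        apply: (le_trans (ler_norm_sum _ _ _)); apply: ler_sum => m _.
        by rewrite normrM.
      rewrite big_split /= lerD2l exchange_big /= mulr_suml; apply: ler_sum => j _.
      rewrite exchange_big /= mulr_suml; apply: ler_sum => m _.
      rewrite -mulr_sumr ler_wpM2l //.
      apply: (le_trans (cprod_psum_norm _ _ _ (ltW d0))).
      by apply: ler_pM; rewrite ?nrm0 // (le_trans (nrm1 _ _ _)).
    by move/le_trans; apply; have := nrml N; nra.
  have nrmit N s : nrm N (it s) <= kap.
    elim: s => [|s IH]; last exact: nrmT.
    rewrite /nrm big1 ?ltW // => i _; rewrite big1 // => k _.
    by rewrite normr0 mul0r.
  move=> i; exists d; split => //; exists kap => k.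
  apply: le_trans (nrmit k.+1 k); apply: le_trans (nrm1 _ _ i).
  rewrite big_ord_recr /= lerDr; apply: sumr_ge0 => a _.
  by rewrite mulr_ge0 // exprn_ge0 // ltW.
move=> i k; rewrite -(@it_stable k i k) //= {1}/T; congr (_ + _).
apply: eq_bigr => j _; apply: eq_bigr => m _; congr (_ * _).
rewrite /cprod; apply: eq_bigr => a _; have ak := ltn_ord a.
by rewrite (@it_le a k) ?(@it_le (k - a) k) ?leq_subr //.
Qed.

End QuadraticSystem.

Lemma quadratic_system n (l : 'I_n -> R -> R) (be : 'I_n -> 'I_n -> 'I_n -> R) :
  (forall i, analytic (l i)) -> (forall i, l i 0 = 0) ->
  exists w : 'I_n -> R -> R, [/\ forall i, analytic (w i), forall i, w i 0 = 0 &
  \forall x \near (0 : R), forall i,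
    w i x = l i x + \sum_j \sum_m be i j m * (w j x * w m x)].
Proof.
move=> /boolp.choice [b Hb] l0.
have b0 i : b i 0%N = 0 by rewrite -(germ_at0 (Hb i)).
have bc i : conv_series1 (b i) := germ_conv (Hb i).
have [w [w0 wc Hw]] := quadratic_system_series be b0 bc.
have Hg i := germ_series (wc i).
exists (fun i => eval_series1 (w i)); split.
- by move=> i; exists (w i).
- by move=> i; rewrite (germ_at0 (Hg i)).
apply: near0_forall => i.
have H1 : germ (fun x => l i x + \sum_j \sum_m be i j m * (eval_series1 (w j) x * eval_series1 (w m) x)) (w i).
  apply: germ_extc (germ_add (Hb i) (germ_sum (fun j => germ_sum (fun m =>
    germ_scale (be i j m) (germ_mul (Hg j) (Hg m)))))) => k.
  by rewrite [RHS]Hw.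
have := germ0_eq0 (germ_extc _ (germ_add (Hg i) (germ_scale (-1) H1))).
move=> /(_ _)/wrap []; first by move=> k; rewrite mulN1r subrr.
move=> H; apply: filterS H => x; rewrite mulN1r => /eqP.
by rewrite subr_eq0 => /eqP.
Qed.

Definition an_poly (p : R -> {poly R}) := forall i, analytic (fun x => (p x)`_i).

Lemma an_poly_ext p q : (\forall x \near (0 : R), p x = q x) -> an_poly p -> an_poly q.
Proof. by move=> pq Hp i; apply: an_ext (Hp i); apply: filterS pq => x ->. Qed.
Lemma an_poly_cst p : an_poly (fun=> p). Proof. by move=> i; apply: an_cst. Qed.
Lemma an_poly_add p q : an_poly p -> an_poly q -> an_poly (fun x => p x + q x).
Proof. by move=> Hp Hq i; apply: an_ext (an_add (Hp i) (Hq i)); apply: near0_all => x; rewrite coefD. Qed.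
Lemma an_poly_mul p q : an_poly p -> an_poly q -> an_poly (fun x => p x * q x).
Proof.
move=> Hp Hq i; apply: an_ext (an_sum (fun j : 'I_i.+1 => an_mul (Hp j) (Hq (i - j)%N))).
by apply: near0_all => x; rewrite coefM.
Qed.
Lemma an_poly_polyC f : analytic f -> an_poly (fun x => (f x)%:P).
Proof.
move=> Hf i; case: (i =P 0%N) => [->|i0].
  by apply: an_ext Hf; apply: near0_all => x; rewrite coefC.
by apply: an_ext (an_cst 0); apply: near0_all => x; rewrite coefC; case: eqP.
Qed.
Lemma an_poly_sum n (p : 'I_n -> R -> {poly R}) : (forall i, an_poly (p i)) ->
  an_poly (fun x => \sum_(i < n) p i x).
Proof.
move=> Hp k; apply: an_ext (an_sum (fun i => Hp i k)).
by apply: near0_all => x; rewrite coef_sum.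
Qed.
Lemma an_poly_exp p n : an_poly p -> an_poly (fun x => p x ^+ n).
Proof.
move=> Hp; elim: n => [|n IH]; first exact: an_poly_cst.
by apply: an_poly_ext (an_poly_mul Hp IH); apply: near0_all => x; rewrite exprS.
Qed.

(** This inverts the map [(a, c) -> a v + c u], given by the Sylvester matrix, on the monomial
    basis, with the degree bounds that corrections to monic [u] and [v] must satisfy. *)
Lemma bezout_basis (u v : {poly R}) du dv : size u = du.+1 -> size v = dv.+1 ->
  coprimep u v -> forall j, (j < du + dv)%N -> exists a c : {poly R},
  [/\ (size a <= du)%N, (size c <= dv)%N & a * v + c * u = 'X^j].
Proof.
move=> su sv /Bezout_eq1_coprimepP [[s1 s2] /= E] j jn.
have u0 : u != 0 by rewrite -size_poly_eq0 su.
have v0 : v != 0 by rewrite -size_poly_eq0 sv.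
(* Reducing one Bezout coefficient modulo [u] bounds [a]; the bound on [c] then follows from the
   degree of ['X^j - a * v]. *)
pose a := ('X^j * s2) %% u; pose c := 'X^j * s1 + (('X^j * s2) %/ u) * v.
have E' : a * v + c * u = 'X^j.
  have D := divp_eq ('X^j * s2) u; rewrite -/a in D.
  have -> : a = 'X^j * s2 - ('X^j * s2) %/ u * u by rewrite {1}D addrC addKr.
  rewrite /c; transitivity ('X^j * (s1 * u + s2 * v)); first by ring.
  by rewrite E mulr1.
have sa : (size a <= du)%N by rewrite -ltnS -su ltn_modp.
exists a, c; split => //.
have : (size (c * u)%R <= du + dv)%N.
  have -> : c * u = 'X^j - a * v by rewrite -E' addrC addKr.
  apply: (leq_trans (size_polyD _ _)); rewrite size_polyXn size_polyN geq_max jn /=.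
  by apply: (leq_trans (size_polyMleq _ _)); rewrite sv addnS /=; rewrite leq_add2r.
have [->|c0] := eqVneq c 0; first by rewrite size_poly0.
by rewrite size_mul // su addnS /= addnC leq_add2l.
Qed.

Lemma size_monic_sub (f g : {poly R}) d : f \is monic -> g \is monic ->
  size f = d.+1 -> size g = d.+1 -> (size (f - g)%R <= d)%N.
Proof.
move=> mf mg sf sg; apply/leq_sizeP => j; rewrite leq_eqVlt => /orP[/eqP <-|dj].
  move: mf mg; rewrite !monicE !lead_coefE sf sg /= coefB => /eqP -> /eqP ->.
  exact: subrr.
by rewrite coefB !nth_default ?sf ?sg // subrr.
Qed.

(** With [u = u0 + U] and [v = v0 + V], the equation [p = u v] reads [U v0 + V u0 = E - U V].
    Inverting the left-hand side by Bezout gives a quadratic system for the [du + dv] coefficients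
    of [U] and [V], whose inhomogeneous term vanishes at [x = 0]. *)
Lemma hensel (p : R -> {poly R}) (u0 v0 : {poly R}) du dv : an_poly p ->
  (\forall x \near (0 : R), p x \is monic /\ size (p x) = (du + dv).+1) ->
  u0 \is monic -> v0 \is monic -> size u0 = du.+1 -> size v0 = dv.+1 ->
  coprimep u0 v0 -> p 0 = u0 * v0 ->
  exists u v : R -> {poly R}, [/\ an_poly u, an_poly v &
   \forall x \near (0 : R), [/\ p x = u x * v x,
     u x \is monic /\ size (u x) = du.+1 & v x \is monic /\ size (v x) = dv.+1]].
Proof.
move=> Hp Hm mu mv su sv cop p0; pose n := (du + dv)%N.
have := bezout_basis su sv cop; rewrite -/n => Hb.
have /boolp.choice [ac Hac] : forall j : 'I_n, exists ac : {poly R} * {poly R},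
   [/\ (size ac.1 <= du)%N, (size ac.2 <= dv)%N & ac.1 * v0 + ac.2 * u0 = 'X^j].
  by move=> j; have [a [c H]] := Hb j (ltn_ord j); exists (a, c).
(* Unknowns of index below [du] are the coefficients of [U], the others those of [V]; [tt] is the
   matrix of the inverse Bezout map in these coordinates. *)
pose tt (k j : 'I_n) := if (k < du)%N then ((ac j).1)`_k else ((ac j).2)`_(k - du).
(* The monomial by which unknown [a] of [U] and unknown [b] of [V] enter the product [U V]; every
   other pair contributes [0]. *)
pose mon (a b : 'I_n) : {poly R} := if (a < du)%N && (du <= b)%N then 'X^(a + (b - du)) else 0.
pose E x := p x - u0 * v0.
have HE : an_poly E by apply: an_poly_add Hp (an_poly_cst _).
pose l (k : 'I_n) x := \sum_(j < n) (E x)`_j * tt k j.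
pose be (k a b : 'I_n) := - \sum_(j < n) (mon a b)`_j * tt k j.
have [||w [wan w0 Hw]] := @quadratic_system n l be.
- by move=> k; apply: an_sum => j; apply: an_mul (HE j) (an_cst _).
- by move=> k; rewrite /l big1 // => j _; rewrite /E p0 subrr coef0 mul0r.
pose U x := \sum_(a < n) (if (a < du)%N then w a x *: 'X^a else 0).
pose V x := \sum_(a < n) (if (du <= a)%N then w a x *: 'X^(a - du) else 0).
have anZX f k : analytic f -> an_poly (fun x => f x *: 'X^k).
  move=> Hf; apply: an_poly_ext (an_poly_mul (an_poly_polyC Hf) (an_poly_cst 'X^k)).
  by apply: near0_all => x; rewrite mul_polyC.
have anU : an_poly U.
  by apply: an_poly_sum => a; case: (a < du)%N; [apply: anZX|apply: an_poly_cst].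
have anV : an_poly V.
  by apply: an_poly_sum => a; case: (du <= a)%N; [apply: anZX|apply: an_poly_cst].
have sU x : (size (U x) <= du)%N.
  apply: (leq_trans (size_sum _ _ _)); apply/bigmax_leqP => a _.
  case: ifP => ad; last by rewrite size_poly0.
  by apply: (leq_trans (size_scale_leq _ _)); rewrite size_polyXn.
have sV x : (size (V x) <= dv)%N.
  apply: (leq_trans (size_sum _ _ _)); apply/bigmax_leqP => a _.
  case: ifP => ad; last by rewrite size_poly0.
  apply: (leq_trans (size_scale_leq _ _)); rewrite size_polyXn.
  by have an : (a < du + dv)%N := ltn_ord a; rewrite ltn_subLR.
exists (fun x => u0 + U x), (fun x => v0 + V x).
split; [exact: an_poly_add (an_poly_cst _) anU|exact: an_poly_add (an_poly_cst _) anV|].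
apply: filterS2 Hm Hw => x [mp sp] Hx.
have monic_add (f h : {poly R}) d : f \is monic -> size f = d.+1 -> (size h <= d)%N ->
   f + h \is monic /\ size (f + h) = d.+1.
  move=> mf sf sh; have sfh : (size h < size f)%N by rewrite sf ltnS.
  by rewrite monicE lead_coefDl // size_polyDl // -monicE.
split; [|exact: monic_add|exact: monic_add].
pose D := E x - U x * V x.
have UV : U x * V x = \sum_(a < n) \sum_(b < n) (w a x * w b x) *: mon a b.
  rewrite /U mulr_suml; apply: eq_bigr => a _; rewrite /V mulr_sumr; apply: eq_bigr => b _.
  rewrite /mon; case: ifP => ad; case: ifP => bd; rewrite ?mul0r ?mulr0 ?scaler0 //=.
  by rewrite -scalerAl -scalerAr scalerA exprD.
have Hw' k : w k x = \sum_(j < n) D`_j * tt k j.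
  rewrite Hx /l /D /be.
  under [RHS]eq_bigr do rewrite coefB mulrBl.
  rewrite big_split /=; congr (_ + _); rewrite sumrN UV.
  transitivity (- \sum_(a < n) \sum_(b < n) (w a x * w b x) * \sum_(j < n) (mon a b)`_j * tt k j).
    rewrite -sumrN; apply: eq_bigr => a _; rewrite -sumrN; apply: eq_bigr => b _.
    by rewrite mulNr mulrC.
  congr (- _); under [RHS]eq_bigr => j _.
    rewrite coef_sum mulr_suml; under eq_bigr => a _ do
      (rewrite coef_sum mulr_suml; under eq_bigr => b _ do rewrite coefZ).
    over.
  rewrite [RHS]exchange_big /=; apply: eq_bigr => a _; rewrite [RHS]exchange_big /=.
  by apply: eq_bigr => b _; rewrite mulr_sumr; apply: eq_bigr => j _; rewrite mulrA.
have EU : U x = \sum_(j < n) D`_j *: (ac j).1.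
  rewrite /U; transitivity (\sum_(a < n) \sum_(j < n) D`_j *: (if (a < du)%N then ((ac j).1)`_a *: 'X^a else 0)).
    apply: eq_bigr => a _; case: ifP => ad; last by rewrite big1 // => j _; rewrite scaler0.
    rewrite Hw' scaler_suml; apply: eq_bigr => j _; rewrite /tt ad scalerA //.
  rewrite exchange_big /=; apply: eq_bigr => j _; rewrite -scaler_sumr; congr (_ *: _).
  have [sa _ _] := Hac j; apply/polyP => k; rewrite coef_sum.
  have [kd|kd] := ltnP k du; last first.
    rewrite [RHS]nth_default ?(leq_trans sa) // big1 // => a _; case: ifP => ad; last by rewrite coef0.
    by rewrite coefZ coefXn; case: eqP => [ka|]; [move: ad kd; rewrite ka; lia|rewrite mulr0].
  have kn : (k < n)%N by rewrite /n; lia.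
  rewrite (bigD1 (Ordinal kn)) //= kd coefZ coefXn eqxx mulr1 big1 ?addr0 // => a ak.
  case: ifP => ad; last by rewrite coef0.
  rewrite coefZ coefXn; case: eqP => [ka|]; rewrite ?mulr0 //.
  by case/eqP: ak; apply/val_inj; rewrite /= ka.
have EV : V x = \sum_(j < n) D`_j *: (ac j).2.
  rewrite /V; transitivity (\sum_(a < n) \sum_(j < n) D`_j *: (if (du <= a)%N then ((ac j).2)`_(a - du) *: 'X^(a - du) else 0)).
    apply: eq_bigr => a _; case: ifP => ad; last by rewrite big1 // => j _; rewrite scaler0.
    rewrite Hw' scaler_suml; apply: eq_bigr => j _; rewrite /tt ltnNge ad scalerA //.
  rewrite exchange_big /=; apply: eq_bigr => j _; rewrite -scaler_sumr; congr (_ *: _).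
  have [_ sa _] := Hac j; apply/polyP => k; rewrite coef_sum.
  have [kd|kd] := ltnP k dv; last first.
    rewrite [RHS]nth_default ?(leq_trans sa) // big1 // => a _; case: ifP => ad; last by rewrite coef0.
    rewrite coefZ coefXn; case: eqP => [ka|]; last by rewrite mulr0.
    by rewrite nth_default ?mul0r // -ka (leq_trans sa).
  have kn : (du + k < n)%N by rewrite /n; lia.
  rewrite (bigD1 (Ordinal kn)) //= leq_addr addKn coefZ coefXn eqxx mulr1 big1 ?addr0 // => a ak.
  case: ifP => ad; last by rewrite coef0.
  rewrite coefZ coefXn; case: eqP => [ka|]; rewrite ?mulr0 //.
  by case/eqP: ak; apply/val_inj => /=; lia.
(* Both [p x] and [u0 * v0] are monic of degree [n], so their difference lies in the span of the
   monomials ['X^j], [j < n], on which the Bezout map was inverted. *)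
have sD : (size D <= n)%N.
  apply: (leq_trans (size_polyD _ _)); rewrite size_polyN geq_max; apply/andP; split.
    apply: size_monic_sub => //; first by rewrite monicMl.
    by rewrite size_mul ?monic_neq0 // su sv addSn addnS.
  apply: (leq_trans (size_polyMleq _ _)); apply: (leq_trans (leq_pred _)).
  by rewrite leq_add.
have H : U x * v0 + V x * u0 = D.
  rewrite EU EV !mulr_suml -big_split /=.
  transitivity (\sum_(j < n) D`_j *: 'X^j).
    apply: eq_bigr => j _; have [_ _ <-] := Hac j.
    by rewrite -!scalerAl scalerDr.
  apply/polyP => k; rewrite coef_sum.
  have [kn|kn] := ltnP k n; last first.
    rewrite [RHS]nth_default ?(leq_trans sD) // big1 // => j _.
    by rewrite coefZ coefXn; case: eqP => [kj|]; [move: kn (ltn_ord j); rewrite kj; lia|rewrite mulr0].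
  rewrite (bigD1 (Ordinal kn)) //= coefZ coefXn eqxx mulr1 big1 ?addr0 // => j jk.
  rewrite coefZ coefXn; case: eqP => [ka|]; rewrite ?mulr0 //.
  by case/eqP: jk; apply/val_inj; rewrite /= ka.
have -> : (u0 + U x) * (v0 + V x) = u0 * v0 + (U x * v0 + V x * u0) + U x * V x by ring.
by rewrite H /D /E; ring.
Qed.

End Hensel.

(** * Analytic splitting of families of hyperbolic polynomials *)

Section Rellich.
Variable R : realType.
Local Notation C := R[i].
Local Notation toC := (real_complex R).

Lemma sqnormCM (z w : C) : sqnormC (z * w) = sqnormC z * sqnormC w.
Proof. by case: z => a b; case: w => c d; rewrite /sqnormC /=; ring. Qed.

Lemma sqnormC_prod (I : Type) (s : seq I) (f : I -> C) :
  sqnormC (\prod_(i <- s) f i) = \prod_(i <- s) sqnormC (f i).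
Proof.
apply: (big_morph _ sqnormCM); rewrite /sqnormC /=; ring.
Qed.

Lemma sqnormC_eq0 (z : C) : (sqnormC z == 0) = (z == 0).
Proof.
case: z => a b; rewrite /sqnormC /= paddr_eq0 ?sqr_ge0 // !sqrf_eq0.
by rewrite eq_complex /=.
Qed.

Definition hyperbolic (p : {poly R}) :=
  forall z : C, root (map_poly toC p) z -> complex.Im z = 0.

Lemma hyperbolic_split (p : {poly R}) : p \is monic -> hyperbolic p ->
  exists s : seq R, p = \prod_(a <- s) ('X - a%:P) /\ size p = (size s).+1.
Proof.
move=> mp hp; have [s Hs] := closed_field_poly_normal (map_poly toC p).
have ml : lead_coef (map_poly toC p) = 1.
  by rewrite lead_coef_map (monicP mp) rmorph1.
rewrite ml scale1r in Hs.
have rs z : z \in s -> z = toC (complex.Re z).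
  move=> zs; have := hp z; rewrite Hs root_prod_XsubC => /(_ zs).
  by case: z {zs} => a b /= ->.
exists (map (@complex.Re R) s); have E : p = \prod_(a <- map (@complex.Re R) s) ('X - a%:P).
  apply: (map_poly_inj toC); rewrite Hs rmorph_prod big_map.
  apply: eq_big_seq => z zs; rewrite {1}(rs z zs) rmorphB /= map_polyX map_polyC //.
by split=> //; rewrite {1}E size_prod_XsubC size_map.
Qed.

(** Each factor satisfies [|z - a| >= |Im z|]. The bound does not depend on the roots, which lets it
    pass to a limit. *)
Lemma sqnormC_hyperbolic (s : seq R) (z : C) :
  complex.Im z ^+ 2 ^+ size s <= sqnormC (map_poly toC (\prod_(a <- s) ('X - a%:P))).[z].
Proof.
rewrite rmorph_prod horner_prod sqnormC_prod; elim: s => [|a s IH]; first by rewrite big_nil.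
rewrite big_cons /= [X in X <= _]exprS; apply: ler_pM; rewrite ?sqr_ge0 //; first by rewrite exprn_ge0 // sqr_ge0.
rewrite rmorphB /= map_polyX map_polyC hornerXsubC.
by case: z {IH} => u v; rewrite /sqnormC /= oppr0 addr0 lerDr sqr_ge0.
Qed.

Lemma an_ge_at0 (g : R -> R) c : analytic g ->
  (\forall x \near (0 : R), x != 0 -> c <= g x) -> c <= g 0.
Proof.
move=> /an_continuous0 /cvgrPdist_lt Hg Hc; rewrite leNgt; apply/negP => g0.
have /Hg Hg' : 0 < c - g 0 by rewrite subr_gt0.
have /near0P [e [e0 He]] : \forall x \near (0 : R), `|g 0 - g x| < c - g 0 /\ (x != 0 -> c <= g x).
  by apply: filterS2 Hg' Hc => x; split.
have e2 : 0 < e / 2 by rewrite divr_gt0.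
have [|H1 H2] := He (e / 2); first by rewrite gtr0_norm //; lra.
have := H2 (lt0r_neq0 e2) => H3.
by move: H1; rewrite ltr_norml => /andP[]; lra.
Qed.

(** At a nonreal [z] the lower bound for [|p x (z)|], valid for [x != 0], persists at [x = 0], so
    [z] is not a root of [p 0]. This is what the blown-up family requires, whose roots are related
    to the old ones only off [0]. *)
Lemma hyperbolic_at0 n (p : R -> {poly R}) : an_poly p ->
  (\forall x \near (0 : R), x != 0 -> [/\ p x \is monic, size (p x) = n.+1 & hyperbolic (p x)]) ->
  size (p 0) = n.+1 -> hyperbolic (p 0).
Proof.
move=> Hp H s0 z rz; apply/eqP/negPn/negP => Iz.
pose g x := sqnormC (\sum_(k < n.+1) toC (p x)`_k * z ^+ k).
have an_g : analytic g.
  have E x : g x = (\sum_(k < n.+1) (p x)`_k * complex.Re (z ^+ k)) ^+ 2 +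
                   (\sum_(k < n.+1) (p x)`_k * complex.Im (z ^+ k)) ^+ 2.
    rewrite /g /sqnormC; congr (_ ^+ 2 + _ ^+ 2).
      rewrite raddf_sum; apply: eq_bigr => k _; case: (z ^+ k) => u v /=; ring.
    rewrite raddf_sum; apply: eq_bigr => k _; case: (z ^+ k) => u v /=; ring.
  apply: (an_ext (near0_all (fun x => esym (E x)))).
  by apply: an_add; apply: an_exp; apply: an_sum => k; apply: an_mul (Hp k) (an_cst _).
have gE x : size (p x) = n.+1 -> g x = sqnormC (map_poly toC (p x)).[z].
  move=> sx; rewrite /g horner_coef size_map_poly sx; congr sqnormC.
  by apply: eq_bigr => k _; rewrite coef_map.
have : complex.Im z ^+ 2 ^+ n <= g 0.
  apply: an_ge_at0 => //; apply: filterS H => x Hx x0.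
  have [mx sx /(hyperbolic_split mx) [s [E ss]]] := Hx x0.
  rewrite gE // E; have -> : n = size s by apply: succn_inj; rewrite -ss.
  exact: sqnormC_hyperbolic.
rewrite gE // (rootP rz) /sqnormC /= expr0n /= addr0 leNgt.
by rewrite exprn_gt0 // exprn_even_gt0.
Qed.

Lemma coefM_XsubC (q : {poly R}) a k :
  (('X - a%:P) * q)`_k = (if k is k'.+1 then q`_k' else 0) - a * q`_k.
Proof. by rewrite mulrBl coefB coefCM coefXM; case: k. Qed.

(** Up to sign the coefficient is an elementary symmetric function of degree [size s - k], with at
    most [2 ^+ size s] terms. *)
Lemma coef_prod_XsubC_bound (s : seq R) (rho : R) k :
  (forall a, a \in s -> `|a| <= rho) ->
  `|(\prod_(a <- s) ('X - a%:P))`_k| <= 2 ^+ size s * rho ^+ (size s - k).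
Proof.
elim: s k => [|a s IH] k Hs.
  rewrite big_nil coef1; case: k => [|k] /=; first by rewrite normr1 expr0 mulr1.
  by rewrite normr0 expr0 mulr1.
have rho0 : 0 <= rho by apply: le_trans (Hs a (mem_head _ _)).
have {}IH j := IH j (fun b bs => Hs b (mem_behead (s := a :: s) bs)).
set q := \prod_(a <- s) _ in IH.
rewrite big_cons coefM_XsubC -/q; apply: (le_trans (ler_normB _ _)).
have -> : 2 ^+ size (a :: s) = (2 : R) ^+ size s + 2 ^+ size s by rewrite /= exprS; ring.
rewrite mulrDl; apply: lerD.
  case: k => [|k]; last by rewrite /= subSS.
  by rewrite normr0 mulr_ge0 ?exprn_ge0.
rewrite normrM; have [ks|ks] := leqP k (size s).
  rewrite /= subSn // exprS mulrCA; apply: ler_pM => //; apply: Hs; exact: mem_head.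
rewrite nth_default ?normr0 ?mulr0 ?mulr_ge0 ?exprn_ge0 //.
by rewrite size_prod_XsubC.
Qed.

Lemma coef_prod_XsubC_scale (s : seq R) (lam : R) k : (k <= size s)%N ->
  (\prod_(a <- s) ('X - (lam * a)%:P))`_k = lam ^+ (size s - k) * (\prod_(a <- s) ('X - a%:P))`_k.
Proof.
elim: s k => [|a s IH] k ks.
  by rewrite !big_nil /= sub0n expr0 mul1r.
rewrite !big_cons !coefM_XsubC.
set q := \prod_(a <- s) _ in IH *; set q' := \prod_(a <- s) _ in IH *.
have [ks'|ks'] := leqP k (size s).
  rewrite IH // /= subSn // exprS; case: k ks ks' => [|k] ks ks'; first by ring.
  rewrite IH; last exact: ltnW.
  have -> : (size s - k = (size s - k.+1).+1)%N by rewrite subnSK.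
  by rewrite exprS; ring.
have {ks ks'} -> : k = (size s).+1 by apply/eqP; rewrite eqn_leq ks ks'.
rewrite /= subnn IH // subnn !mul1r.
rewrite [q`_ _]nth_default ?[q'`_ _.+1]nth_default ?mulr0 //.
  by rewrite size_prod_XsubC.
by rewrite size_prod_XsubC.
Qed.

(* Newton's identity for the second power sum; multiplying by 'X^2 gives all
   three leading coefficients a meaning whatever the degree. *)
Lemma sum_sqr_roots (s : seq R) : let q := 'X^2 * \prod_(a <- s) ('X - a%:P) in
  \sum_(a <- s) a ^+ 2 = (q`_(size s).+1) ^+ 2 - 2 * q`_(size s) /\
  \sum_(a <- s) a = - q`_(size s).+1.
Proof.
have lc (s' : seq R) : ('X^2 * \prod_(a <- s') ('X - a%:P))`_(size s').+2 = 1.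
  rewrite coefXnM /= subSS subSS subn0.
  have := monic_prod_XsubC s' predT id; rewrite monicE lead_coefE size_prod_XsubC /=.
  by move/eqP.
elim: s => [|a s [IH1 IH2]] /=; first by rewrite !big_nil mulr1 !coefXn /=; split; ring.
rewrite !big_cons mulrCA IH1 IH2 !coefM_XsubC lc /=.
by split; ring.
Qed.

Definition split_analytic n (p : R -> {poly R}) := exists s : seq (R -> R),
  [/\ size s = n, (forall i, analytic (nth (fun=> 0) s i)) &
  \forall x \near (0 : R), p x = \prod_(a <- s) ('X - (a x)%:P)].

Definition hyp_family n (p : R -> {poly R}) := an_poly p /\
  \forall x \near (0 : R), [/\ p x \is monic, size (p x) = n.+1 & hyperbolic (p x)].

Lemma split_shift n (p : R -> {poly R}) (c : R -> R) : analytic c ->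
  split_analytic n (fun x => p x \Po ('X + (c x)%:P)) -> split_analytic n p.
Proof.
move=> Hc [s [ss As Hs]]; exists (map (fun a x => a x + c x) s); split.
- by rewrite size_map.
- move=> i; have [is_|is_] := ltnP i (size s); last first.
    by rewrite nth_default ?size_map //; apply: an_cst.
  by rewrite (nth_map (fun=> 0)) //; apply: an_add (As i) Hc.
apply: filterS Hs => x E; rewrite big_map.
have -> : p x = (p x \Po ('X + (c x)%:P)) \Po ('X - (c x)%:P).
  by rewrite -comp_polyA comp_polyD comp_polyX comp_polyC subrK comp_polyXr.
rewrite E rmorph_prod /=; apply: eq_bigr => a _.
by rewrite comp_polyB comp_polyX comp_polyC polyCD opprD addrA addrAC.
Qed.

Lemma hyp_shift n (p : R -> {poly R}) (c : R -> R) : analytic c ->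
  hyp_family n p -> hyp_family n (fun x => p x \Po ('X + (c x)%:P)).
Proof.
move=> Hc [Hp Hx]; split.
  apply: (an_poly_ext (p := fun x => \sum_(i < n.+1) ((p x)`_i)%:P * ('X + (c x)%:P) ^+ i)).
    apply: filterS Hx => x [_ sx _]; rewrite comp_polyE sx; apply: eq_bigr => i _.
    by rewrite mul_polyC.
  apply: an_poly_sum => i; apply: an_poly_mul; first exact: an_poly_polyC.
  by apply: an_poly_exp; apply: an_poly_add (an_poly_cst _) (an_poly_polyC Hc).
apply: filterS Hx => x [mx sx hx]; split.
- by rewrite monicE lead_coef_comp ?size_XaddC // lead_coefXaddC expr1n mulr1 -monicE.
- by rewrite size_comp_poly2 ?size_XaddC.
move=> z; rewrite map_comp_poly /= rmorphD /= map_polyX map_polyC /= => /rootP.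
rewrite horner_comp hornerD hornerX hornerC => /rootP /hx.
by case: z => u v /=; rewrite addr0.
Qed.

(** Tschirnhaus shift: [c x] is the mean of the roots of [p x], so the translated roots have sum
    [0]. Entry [n.+1] after multiplication by ['X^2] is the original entry [n.-1]. *)
Lemma centered_coef n (p : R -> {poly R}) : (0 < n)%N -> hyp_family n p ->
  let c x := - (p x)`_n.-1 / n%:R in
  \forall x \near (0 : R), ('X^2 * (p x \Po ('X + (c x)%:P)))`_n.+1 = 0.
Proof.
move=> n0 [_ Hx] c; apply: filterS Hx => x [mx sx hx].
have [s [E ss]] := hyperbolic_split mx hx.
have sn : size s = n by apply: succn_inj; rewrite -ss.
pose s' := map (fun a => a - c x) s.
have E' : p x \Po ('X + (c x)%:P) = \prod_(a <- s') ('X - a%:P).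
  rewrite E rmorph_prod big_map; apply: eq_bigr => a _ /=.
  by rewrite comp_polyB comp_polyX comp_polyC polyCB opprB addrA.
have ss' : size s' = n by rewrite size_map.
have [_] := sum_sqr_roots s'; rewrite -E' ss' => H1.
have [_] := sum_sqr_roots s; rewrite -E sn coefXnM ltnS ltnNge n0 /= subSS subn1 => H2.
have nn : n%:R != 0 :> R by rewrite pnatr_eq0 -lt0n.
apply/eqP; rewrite -oppr_eq0 -H1 big_map sumrB big_const_seq count_predT sn iter_addr_0.
by rewrite H2 -mulr_natr /c divfK // subrr.
Qed.

Lemma split_all0 n (p : R -> {poly R}) (f : R -> R) :
  (\forall x \near (0 : R), exists s : seq R,
     [/\ size s = n, p x = \prod_(a <- s) ('X - a%:P) & \sum_(a <- s) a ^+ 2 = -2 * f x]) ->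
  (\forall x \near (0 : R), f x = 0) -> split_analytic n p.
Proof.
move=> HS f0; exists (nseq n (fun=> 0)); split; first by rewrite size_nseq.
  by move=> i; rewrite nth_nseq if_same; apply: an_cst.
apply: filterS2 HS f0 => x [s [sn -> Ss]] fx.
move/eqP: Ss; rewrite fx mulr0 psumr_eq0; last by move=> i _; apply: sqr_ge0.
move=> /allP as0; rewrite big_nseq -sn; transitivity (\prod_(a <- s) ('X - 0%:P : {poly R})).
  by apply: eq_big_seq => a /as0; rewrite /= sqrf_eq0 => /eqP ->.
by rewrite big_const_seq count_predT.
Qed.

(** Since [-2 * f] is a sum of squares, [f] keeps a constant sign, which an odd [m] would
    contradict. The square of each root is at most that sum, hence at most [4 * |g 0| * |x| ^+ m];
    the constant [4 * |g 0| + 1] avoids taking a square root. *)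
Lemma even_order n (p : R -> {poly R}) (f g : R -> R) m :
  (\forall x \near (0 : R), exists s : seq R,
     [/\ size s = n, p x = \prod_(a <- s) ('X - a%:P) & \sum_(a <- s) a ^+ 2 = -2 * f x]) ->
  analytic g -> g 0 != 0 -> (\forall x \near (0 : R), f x = x ^+ m * g x) ->
  ~~ odd m /\ \forall x \near (0 : R), exists s : seq R,
     [/\ size s = n, p x = \prod_(a <- s) ('X - a%:P) &
       forall a, a \in s -> `|a| <= (4 * `|g 0| + 1) * `|x| ^+ m./2].
Proof.
move=> HS Hg g0 fg.
have Hgn : \forall x \near (0 : R), `|g 0 - g x| < `|g 0| / 2.
  by move/cvgrPdist_lt: (an_continuous0 Hg); apply; rewrite divr_gt0 // normr_gt0.
have HF : \forall x \near (0 : R), x ^+ m * g x <= 0.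
  apply: filterS2 HS fg => x [s [_ _ Ss]] fx; rewrite -fx.
  have : 0 <= -2 * f x by rewrite -Ss; apply: sumr_ge0 => a _; apply: sqr_ge0.
  by lra.
have em : ~~ odd m.
  apply/negP => om.
  have /near0P [e [e0 He]] : \forall x \near (0 : R), `|g 0 - g x| < `|g 0| / 2 /\ x ^+ m * g x <= 0.
    by apply: filterS2 Hgn HF => x; split.
  pose d := e / 2; have d0 : 0 < d by rewrite divr_gt0.
  have de : `|d| < e by rewrite gtr0_norm // /d; lra.
  have [H1 H2] := He d de; have [|H3 H4] := He (- d); first by rewrite normrN.
  move: H2 H4; rewrite exprNn -signr_odd om expr1 !mulN1r mulNr oppr_le0.
  have dm : 0 < d ^+ m by rewrite exprn_gt0.
  rewrite (pmulr_rle0 _ dm) (pmulr_rge0 _ dm) => H2 H4.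
  move: H1 H3; rewrite !ltr_norml; case: (ltrgt0P (g 0)) => [h|h|h].
  - by move=> /andP[? ?] _; lra.
  - by move=> _ /andP[? ?]; lra.
  - by move: g0; rewrite h eqxx.
split=> //; apply: filterS3 HS fg Hgn => x [s [sn ps Ss]] fx gx; exists s; split=> // a as_.
have a2 : a ^+ 2 <= -2 * f x.
  rewrite -Ss (big_rem a) //= lerDl; apply: sumr_ge0 => b _; exact: sqr_ge0.
have xm : x ^+ m = (`|x| ^+ m./2) ^+ 2.
  by rewrite -exprM muln2 -{1}(odd_double_half m) (negbTE em) add0n -!muln2 mulnC !exprM real_normK ?num_real.
rewrite -ler_sqr ?nnegrE ?mulr_ge0 ?exprn_ge0 ?addr_ge0 ?mulr_ge0 //.
rewrite real_normK ?num_real //; apply: (le_trans a2); rewrite fx xm exprMn.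
set y := (`|x| ^+ _) ^+ 2; have y0 : 0 <= y by apply: sqr_ge0.
have : - g x <= 2 * `|g 0|.
  have := ler_norm (- g 0); rewrite normrN; move: gx; rewrite ltr_norml => /andP[? ?] ?; lra.
have : 0 <= `|g 0| by [].
move: (`|g 0|) => G G0 Hg'.
have : -2 * (y * g x) <= y * (4 * G) by nra.
move/le_trans; apply; rewrite mulrC ler_wpM2r //; nra.
Qed.

(** * Blow-up: dividing all roots by a power of x *)

Section Blowup.
Variables (n r : nat) (p : R -> {poly R}) (d : nat -> R -> R).
Hypothesis d_an : forall k, analytic (d k).
Hypothesis pd : \forall x \near (0 : R), forall k : 'I_n.+1, (p x)`_k = x ^+ (r * (n - k)) * d k x.
Hypothesis Hp : hyp_family n p.
Let pt x := \poly_(k < n.+1) d k x.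

Let dn1 : \forall x \near (0 : R), d n x = 1.
Proof.
have [_ Hx] := Hp; apply: filterS2 Hx pd => x [mx sx _] /(_ ord_max) /=.
rewrite subnn muln0 mul1r => <-; move: mx; rewrite monicE lead_coefE sx /=.
by move/eqP.
Qed.

(** For [x != 0] the real scaling [z -> x ^+ r * z] carries the roots of [pt x] to roots of [p x],
    so they are real; at [x = 0] reality is inherited as a limit. *)
Lemma blowup_hyp : hyp_family n pt.
Proof.
have an_pt : an_poly pt.
  move=> k; apply: (an_ext (f := fun x => if (k < n.+1)%N then d k x else 0)).
    by apply: near0_all => x; rewrite coef_poly.
  by case: (k < n.+1)%N; [apply: d_an|apply: an_cst].
split=> //.
have ms : \forall x \near (0 : R), pt x \is monic /\ size (pt x) = n.+1.
  apply: filterS dn1 => x dx; have d0 : d n x != 0 by rewrite dx oner_neq0.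
  by rewrite monicE lead_coef_poly //= dx size_poly_eq.
have Hne : \forall x \near (0 : R), x != 0 -> [/\ pt x \is monic, size (pt x) = n.+1 & hyperbolic (pt x)].
  have [_ Hx] := Hp; apply: filterS3 Hx pd ms => x [mx sx hx] pdx [mpt spt] x0; split=> // z rz.
  have E : (map_poly toC (p x)).[toC (x ^+ r) * z] = toC (x ^+ (r * n)) * (map_poly toC (pt x)).[z].
    rewrite !horner_coef !size_map_poly sx spt mulr_sumr; apply: eq_bigr => k _.
    rewrite !coef_map /= pdx coef_poly ltn_ord exprMn -rmorphXn /=.
    have -> : (r * n = r * (n - k) + r * k)%N by rewrite -mulnDr subnK // -ltnS.
    rewrite exprD -exprM !rmorphM /=; ring.
  have : root (map_poly toC (p x)) (toC (x ^+ r) * z) by apply/rootP; rewrite E (rootP rz) mulr0.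
  move/hx; case: (z) => u v /=; rewrite mul0r addr0 => /eqP.
  by rewrite mulf_eq0 expf_eq0 (negbTE x0) andbF /= => /eqP.
have h0 : hyperbolic (pt 0).
  by apply: (@hyperbolic_at0 n) => //; have [] := nbhs_singleton ms.
apply: filterS2 ms Hne => x [? ?] H; split=> //.
by have [->|/H []] := eqVneq x 0.
Qed.

Lemma blowup_split : split_analytic n pt -> split_analytic n p.
Proof.
move=> [s [ss As Hs]]; exists (map (fun a x => x ^+ r * a x) s); split.
- by rewrite size_map.
- move=> i; have [is_|is_] := ltnP i (size s); last first.
    by rewrite nth_default ?size_map //; apply: an_cst.
  by rewrite (nth_map (fun=> 0)) //; apply: an_mul (As i); apply: an_exp; apply: an_id.
have [_ Hx] := Hp; apply: filterS3 Hx pd Hs => x [mx sx hx] pdx E.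
rewrite big_map; apply/polyP => k.
rewrite -(big_map (fun a => a x) predT (fun b => 'X - (x ^+ r * b)%:P)).
rewrite -(big_map (fun a => a x) predT (fun b => 'X - b%:P)) in E.
have [kn|kn] := ltnP k n.+1; last first.
  rewrite !nth_default ?sx //.
  by rewrite -(big_map (fun b => x ^+ r * b) predT (fun b => 'X - b%:P)) size_prod_XsubC !size_map ss.
rewrite coef_prod_XsubC_scale ?size_map ?ss // -E coef_poly kn.
by rewrite (pdx (Ordinal kn)) /= exprM.
Qed.

End Blowup.

Lemma coprimep_filter (s : seq R) (c : R) :
  coprimep (\prod_(a <- s | a == c) ('X - a%:P)) (\prod_(a <- s | a != c) ('X - a%:P)).
Proof.
set v := \prod_(a <- s | a != c) _.
apply: (big_ind (fun u => coprimep u v)); first exact: coprime1p.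
  by move=> u w; rewrite coprimepMl => -> ->.
move=> a /eqP ->; rewrite coprimep_sym coprimep_XsubC /v -big_filter root_prod_XsubC.
by rewrite mem_filter eqxx.
Qed.

(** The roots of [p 0] equal to [c] and the remaining ones give coprime factors of smaller degree;
    Hensel's lemma extends this factorization to nearby [x], and both factors inherit real roots. *)
Lemma split_two_roots n (p : R -> {poly R}) (s : seq R) c :
  (forall m q, (m < n)%N -> hyp_family m q -> split_analytic m q) ->
  hyp_family n p -> p 0 = \prod_(a <- s) ('X - a%:P) -> size s = n ->
  c \in s -> ~~ all (pred1 c) s -> split_analytic n p.
Proof.
move=> IH [Hp Hx] p0 sn cs nall.
pose s1 := [seq a <- s | a == c]; pose s2 := [seq a <- s | a != c].
have s12 : (size s1 + size s2 = n)%N by rewrite -sn !size_filter count_predC.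
have s1_gt : (0 < size s1)%N by rewrite size_filter -has_count; apply/hasP; exists c; rewrite /=.
have s2_gt : (0 < size s2)%N by rewrite size_filter -has_count -has_predC in nall *.
have p0' : p 0 = \prod_(a <- s1) ('X - a%:P) * \prod_(a <- s2) ('X - a%:P).
  by rewrite p0 !big_filter (bigID (fun a => a == c)).
have [||||||u [v [Hu Hv Huv]]] := @hensel R p (\prod_(a <- s1) ('X - a%:P)) (\prod_(a <- s2) ('X - a%:P)) (size s1) (size s2) Hp _ _ _ _ _ _ p0'.
- by apply: filterS Hx => x [mx sx _]; rewrite s12.
- exact: monic_prod_XsubC.
- exact: monic_prod_XsubC.
- exact: size_prod_XsubC.
- exact: size_prod_XsubC.
- by rewrite !big_filter; apply: coprimep_filter.
have hypd (f g : {poly R}) : hyperbolic (f * g) -> hyperbolic f /\ hyperbolic g.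
  by move=> h; split=> z rz; apply: h; rewrite rmorphM rootM rz ?orbT.
have [t1 [st1 At1 Ht1]] : split_analytic (size s1) u.
  apply: IH; first by rewrite -s12 -addn1 leq_add2l.
  split=> //; apply: filterS2 Hx Huv => x [_ _ hx] [E [mu su] _]; split=> //.
  by rewrite E in hx; case: (hypd _ _ hx).
have [t2 [st2 At2 Ht2]] : split_analytic (size s2) v.
  apply: IH; first by rewrite -s12 -add1n leq_add2r.
  split=> //; apply: filterS2 Hx Huv => x [_ _ hx] [E _ [mv sv]]; split=> //.
  by rewrite E in hx; case: (hypd _ _ hx).
exists (t1 ++ t2); split; first by rewrite size_cat st1 st2.
  by move=> i; rewrite nth_cat; case: ifP.
by apply: filterS3 Huv Ht1 Ht2 => x [-> _ _] -> ->; rewrite big_cat.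
Qed.

(** Induction on the degree. After centering, the roots are [O(|x| ^+ r)], where [2 * r] is the
    order of the sum of their squares. Divided by [x ^+ r] they become, at [x = 0], roots with sum
    [0] and sum of squares [-2 * g 0 != 0], hence not all equal, and the family splits. *)
Lemma split_hyperbolic n (p : R -> {poly R}) : hyp_family n p -> split_analytic n p.
Proof.
elim/ltn_ind: n p => n IH p0 Hp0.
have [n0|n0] := posnP n.
  exists [::]; split => //; first by move=> i; rewrite nth_nil; apply: an_cst.
  have [_ Hx] := Hp0; apply: filterS Hx => x [mx sx _].
  rewrite big_nil; have := size1_polyC (eq_leq (etrans sx (congr1 S n0))).
  move: mx; rewrite monicE lead_coefE sx n0 /= => /eqP -> ->; exact: polyC1.
pose c x := - (p0 x)`_n.-1 / n%:R.
have Hc : analytic c.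
  have [Hp _] := Hp0; apply: an_ext (an_mul (Hp n.-1) (an_cst (- n%:R^-1))).
  by apply: near0_all => x; rewrite /c; ring.
apply: (split_shift Hc); move: (hyp_shift Hc Hp0) (centered_coef n0 Hp0); rewrite /= -/c.
set p := fun x => p0 x \Po _ => Hfam.
change (fun x => p0 x \Po _) with p.
move=> Hc1; have [Hp Hx] := Hfam.
pose f2 x := ('X^2 * p x)`_n.
have HS : \forall x \near (0 : R), exists s : seq R,
     [/\ size s = n, p x = \prod_(a <- s) ('X - a%:P) & \sum_(a <- s) a ^+ 2 = -2 * f2 x].
  apply: filterS2 Hx Hc1 => x [mx sx hx] c1; have [s [E ss]] := hyperbolic_split mx hx.
  have sn : size s = n by apply: succn_inj; rewrite -ss.
  exists s; split=> //; have [-> _] := sum_sqr_roots s.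
  by rewrite -E sn c1 /f2; ring.
have [f20|[m [g [Hg g0 fg]]]] := an_order (an_poly_mul (an_poly_cst 'X^2) Hp n).
  exact: split_all0 HS f20.
have [em HB] := even_order HS Hg g0 fg.
pose r := m./2; have mr : m = (r * 2)%N by rewrite muln2 -{1}(odd_double_half m) (negbTE em).
have /boolp.choice [d Hd] : forall k : nat, exists d, analytic d /\
    \forall x \near (0 : R), (p x)`_k = x ^+ (r * (n - k)) * d x.
  move=> k; have [|d d_an Hd] := @an_divX R (fun x => (p x)`_k) (r * (n - k))
      (2 ^+ n * (4 * `|g 0| + 1) ^+ (n - k)) (Hp k); last by exists d.
  apply: filterS HB => x [s [sn -> Hs]] _.
  have := coef_prod_XsubC_bound k Hs; rewrite sn => /le_trans; apply.
  by rewrite exprMn -exprM mulrA.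
have d_an k : analytic (d k) by have [] := Hd k.
have pd : \forall x \near (0 : R), forall k : 'I_n.+1, (p x)`_k = x ^+ (r * (n - k)) * d k x.
  by apply: near0_forall => k; have [] := Hd k.
apply: (blowup_split pd Hfam).
have Hpt := blowup_hyp d_an pd Hfam; set pt := fun x => _ in Hpt *.
(* The relations between [p], [f2] and their quotients by powers of [x] say nothing at [x = 0]
   itself; the values there are recovered by analyticity. *)
have x_neq0 k (a b : R -> R) : analytic a -> analytic b ->
   (\forall x \near (0 : R), x ^+ k * a x = x ^+ k * b x) -> a 0 = b 0.
  move=> Ha Hb Hab; apply: (nbhs_singleton (an_eq_at0 Ha Hb _)).
  apply: filterS Hab => x E x0; apply: (mulfI _ E); exact: expf_neq0.
(* In degree one, entry [n] of ['X^2 * p x] lies below the shift and is [0], against [g 0 != 0]. *)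
have n1 : (1 < n)%N.
  rewrite ltnNge; apply/negP => n1; have n1' : n = 1%N by apply/eqP; rewrite eqn_leq n1.
  move: g0; rewrite (x_neq0 m g (fun=> 0)) ?eqxx //; first exact: an_cst.
  by apply: filterS fg => x <-; rewrite coefXnM n1' /= mulr0.
have c1 : ('X^2 * pt 0)`_n.+1 = 0.
  rewrite coefXnM ltnS ltnNge n0 /= subSS subn1 coef_poly.
  have nn : (n.-1 < n.+1)%N by rewrite ltnS leq_pred.
  rewrite nn; apply: (x_neq0 (r * (n - n.-1))%N (d n.-1) (fun=> 0)) => //; first exact: an_cst.
  apply: filterS2 pd Hc1 => x /(_ (Ordinal nn)) /= <-.
  by rewrite mulr0 coefXnM ltnS ltnNge n0 /= subSS subn1.
have c2 : ('X^2 * pt 0)`_n = g 0.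
  rewrite coefXnM ltnNge n1 /= coef_poly.
  have nn : (n - 2 < n.+1)%N by rewrite ltnS leq_subr.
  rewrite nn; apply: (x_neq0 m) => //.
  apply: filterS2 pd fg => x /(_ (Ordinal nn)) /=.
  by rewrite subKn // -mr => <- <-; rewrite coefXnM ltnNge n1.
have [_ /nbhs_singleton [m0 s0 h0]] := Hpt.
have [s [E ss]] := hyperbolic_split m0 h0.
have sn : size s = n by apply: succn_inj; rewrite -ss.
have [Hs2 Hs1] := sum_sqr_roots s.
rewrite -E sn c1 c2 oppr0 in Hs1 Hs2.
case: s => [|a s] in E ss sn Hs1 Hs2 *; first by rewrite -sn in n0.
apply: (split_two_roots (s := a :: s) (c := a) (fun m q mn => IH m mn q) Hpt E sn (mem_head _ _)).
(* If all roots were equal to [a], the vanishing sum would give [a = 0], and then the sum of squares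
   would give [g 0 = 0]. *)
apply/negP => /allP Ha.
have Hb (F : R -> R) : \sum_(b <- a :: s) F b = F a *+ n.
  transitivity (\sum_(b <- a :: s) F a); first by apply: eq_big_seq => b /Ha /= /eqP ->.
  by rewrite big_const_seq count_predT sn iter_addr_0.
move: Hs1 Hs2; rewrite (Hb id) (Hb (fun b => b ^+ 2)) => /eqP.
rewrite mulrn_eq0 -leqn0 leqNgt n0 /= => /eqP ->.
rewrite expr2 mul0r mul0rn => E0; move: g0; have -> : g 0 = 0 by lra.
by rewrite eqxx.
Qed.

End Rellich.

(** * The fiber over a fixed x *)

Section Fiber.
Variable R : realType.
Local Notation C := R[i].
Local Notation toC := (real_complex R).
Variables (M : nat) (q eta : 'I_M -> R) (t : R).

(** The roots of [fibP] are the points [- node k], below the real line when [eta k] is positive. *)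
Definition node k : C := Complex (q k) (eta k).
Definition fibP : {poly C} := \prod_k ('X + (node k)%:P).
Definition fibPb : {poly C} := \prod_k ('X + (conjc (node k))%:P).
Definition fibA : {poly C} := (fibP + fibPb) * (2%:R^-1)%:P.
Definition fibB : {poly C} := (fibP - fibPb) * ((2%:R * iC R)^-1)%:P.
Definition fibF : {poly C} := fibA + (toC t)%:P * fibB.
(** The Wronskian on the real line: the sum of [eta k / |y + node k|^2], multiplied by [|P|^2] to
    clear denominators. *)
Definition fibK (y : R) : R := \sum_k eta k * \prod_(i | i != k) ((y + q i) ^+ 2 + eta i ^+ 2).
(** The number [(1 - i t) / 2], for which [A + t B] equals [alpha P] plus its conjugate
    polynomial. *)
Definition alpha : C := Complex 2^-1 (- t / 2).

Lemma complex2_neq0 : 2%:R != 0 :> C. Proof. by rewrite pnatr_eq0. Qed.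
Lemma iC_neq0 : iC R != 0. Proof. by rewrite eq_complex /= oner_eq0 andbF. Qed.
Lemma sqr_iC : iC R * iC R = -1.
Proof. by apply/eqP; rewrite eq_complex /=; apply/andP; split; apply/eqP; ring. Qed.

Lemma inv2i : (2%:R * iC R)^-1 = - (iC R / 2%:R).
Proof.
have := sqr_iC; have := iC_neq0; have := complex2_neq0 => h2 hi ii.
apply: (mulfI (x := 2%:R * iC R)); first by rewrite mulf_neq0.
rewrite divff ?mulf_neq0 //; transitivity (- (iC R * iC R)); first by rewrite ii opprK.
by field.
Qed.

Lemma alphaE : alpha = (1 - iC R * toC t) / 2%:R.
Proof.
apply: (mulfI complex2_neq0); rewrite mulrC [RHS]mulrC divfK ?complex2_neq0 //.
have -> : 2%:R = toC 2 :> C by rewrite rmorphMn rmorph1.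
by apply/eqP; rewrite eq_complex /=; apply/andP; split; apply/eqP; field.
Qed.

Lemma conj_alphaE : conjc alpha = (1 + iC R * toC t) / 2%:R.
Proof.
apply: (mulfI complex2_neq0); rewrite mulrC [RHS]mulrC divfK ?complex2_neq0 //.
have -> : 2%:R = toC 2 :> C by rewrite rmorphMn rmorph1.
by apply/eqP; rewrite eq_complex /=; apply/andP; split; apply/eqP; field.
Qed.

Lemma fibFE : fibF = alpha%:P * fibP + (conjc alpha)%:P * fibPb.
Proof.
rewrite /fibF /fibA /fibB inv2i conj_alphaE alphaE !(polyCM, polyCB, polyCD, polyCN, polyC1).
by ring.
Qed.

Lemma alpha_neq0 : alpha != 0.
Proof. by rewrite eq_complex /= negb_and invr_eq0 pnatr_eq0. Qed.

Lemma alpha_add : alpha + conjc alpha = 1.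
Proof. by apply/eqP; rewrite eq_complex /=; apply/andP; split; apply/eqP; field. Qed.

Lemma monic_fibP : fibP \is monic.
Proof.
by apply: monic_prod => k _; have := monicXsubC (- node k); rewrite polyCN opprK.
Qed.
Lemma monic_fibPb : fibPb \is monic.
Proof.
by apply: monic_prod => k _; have := monicXsubC (- conjc (node k)); rewrite polyCN opprK.
Qed.
Lemma size_prod_XaddC (z : 'I_M -> C) : size (\prod_k ('X + (z k)%:P)) = M.+1.
Proof.
have := size_prod_XsubC (enum 'I_M) (fun k => - z k); rewrite size_enum_ord big_enum /= => <-.
by congr (size (polyseq _)); apply: eq_big => // k _; rewrite polyCN opprK.
Qed.
Lemma size_fibP : size fibP = M.+1. Proof. exact: size_prod_XaddC. Qed.
Lemma size_fibPb : size fibPb = M.+1. Proof. exact: size_prod_XaddC. Qed.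

Lemma size_fibB : (size fibB <= M)%N.
Proof.
apply: (@leq_trans (size (fibP - fibPb))).
  rewrite /fibB mulrC mul_polyC; exact: size_scale_leq.
apply/leq_sizeP => j; rewrite leq_eqVlt => /orP[/eqP <-|dj].
  have := monic_fibP; have := monic_fibPb; rewrite !monicE !lead_coefE size_fibP size_fibPb /= coefB.
  by move=> /eqP -> /eqP ->; rewrite subrr.
by rewrite coefB !nth_default ?size_fibP ?size_fibPb // subrr.
Qed.

Lemma fibF_coefM : fibF`_M = 1.
Proof.
rewrite fibFE coefD !coefCM.
have := monic_fibP; have := monic_fibPb; rewrite !monicE !lead_coefE size_fibP size_fibPb /=.
by move=> /eqP -> /eqP ->; rewrite !mulr1 alpha_add.
Qed.

Lemma size_fibF : size fibF = M.+1.
Proof.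
apply/eqP; rewrite eqn_leq; apply/andP; split.
  rewrite fibFE (leq_trans (size_polyD _ _)) // geq_max !mul_polyC.
  by rewrite !(leq_trans (size_scale_leq _ _)) ?size_fibP ?size_fibPb.
rewrite ltnNge; apply/negP => /leq_sizeP /(_ M (leqnn _)) /eqP.
by rewrite fibF_coefM oner_eq0.
Qed.

Lemma monic_fibF : fibF \is monic.
Proof. by rewrite monicE lead_coefE size_fibF /= fibF_coefM. Qed.

Lemma conj_fibP : map_poly conjc fibP = fibPb.
Proof.
rewrite rmorph_prod; apply: eq_bigr => k _.
by rewrite rmorphD /= map_polyX map_polyC.
Qed.
Lemma conj_fibPb : map_poly conjc fibPb = fibP.
Proof.
rewrite rmorph_prod; apply: eq_bigr => k _.
rewrite rmorphD /= map_polyX map_polyC; congr ('X + _%:P).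
by rewrite /node /= opprK.
Qed.

Lemma conj_fibF : map_poly conjc fibF = fibF.
Proof.
rewrite fibFE rmorphD !rmorphM /= !map_polyC conj_fibP conj_fibPb [RHS]addrC.
by congr (_ + _%:P * _); rewrite /alpha /= opprK.
Qed.

Lemma fibF_real k : fibF`_k = toC (complex.Re fibF`_k).
Proof.
have := congr1 (fun p : {poly C} => p`_k) conj_fibF; rewrite coef_map /=.
case: (fibF`_k) => u v [] /eqP; rewrite eq_sym -subr_eq0 opprK -mulr2n mulrn_eq0 /= => /eqP -> //.
Qed.

Lemma fibP_eval (y : C) : fibP.[y] = \prod_k (y + node k).
Proof. by rewrite horner_prod; apply: eq_bigr => k _; rewrite hornerD hornerX hornerC. Qed.
Lemma fibPb_eval (y : C) : fibPb.[y] = \prod_k (y + conjc (node k)).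
Proof. by rewrite horner_prod; apply: eq_bigr => k _; rewrite hornerD hornerX hornerC. Qed.

Lemma conj_fibP_real (y : R) : conjc fibP.[toC y] = fibPb.[toC y].
Proof.
rewrite fibP_eval fibPb_eval rmorph_prod; apply: eq_bigr => k _.
by rewrite rmorphD; congr (_ + _); apply: conjc_real.
Qed.

Definition reA (y : R) : R := complex.Re fibP.[toC y].
Definition reB (y : R) : R := complex.Im fibP.[toC y].

Lemma fibB_real (y : R) : fibB.[toC y] = toC (reB y).
Proof.
rewrite /fibB hornerM hornerC hornerD hornerN -conj_fibP_real inv2i /reB.
case: fibP.[toC y] => u v /=.
apply: (mulfI complex2_neq0).
have -> : 2%:R * ((Complex u v - Complex u (- v)) * - (iC R / 2%:R)) = (Complex u v - Complex u (- v)) * - iC R.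
  by have := complex2_neq0 => h; field.
have -> : 2%:R = toC 2 :> C by rewrite rmorphMn rmorph1.
by apply/eqP; rewrite eq_complex /=; apply/andP; split; apply/eqP; ring.
Qed.

Lemma fibF_eval_real (y : R) : fibF.[toC y] = toC (reA y + t * reB y).
Proof.
rewrite fibFE hornerD !hornerM !hornerC -conj_fibP_real /reA /reB.
by case: fibP.[toC y] => u v /=; apply/eqP; rewrite eq_complex /=; apply/andP; split; apply/eqP; field.
Qed.

Lemma sqnorm_fibP (y : R) : sqnormC fibP.[toC y] = \prod_k ((y + q k) ^+ 2 + eta k ^+ 2).
Proof.
rewrite fibP_eval sqnormC_prod; apply: eq_bigr => k _; rewrite /sqnormC /=; ring.
Qed.

Lemma sqnorm_fibPE (y : R) : sqnormC fibP.[toC y] = reA y ^+ 2 + reB y ^+ 2.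
Proof. by []. Qed.

(** Cauchy-Schwarz for the vectors [(1, t)] and [(A, B)]; it bounds [|F / P|] on the line by a
    constant depending on [t] alone. *)
Lemma sqnorm_fibF_le (y : R) : (reA y + t * reB y) ^+ 2 <= (1 + t ^+ 2) * sqnormC fibP.[toC y].
Proof.
rewrite sqnorm_fibPE; have := sqr_ge0 (t * reA y - reB y); nra.
Qed.

Lemma deriv_prod_XaddC (z : 'I_M -> C) :
  (\prod_k ('X + (z k)%:P))^`() = \sum_k \prod_(i | i != k) ('X + (z i)%:P).
Proof.
have : uniq (index_enum 'I_M) by apply: index_enum_uniq.
elim: (index_enum _) => [|k s IH] /=; first by rewrite !big_nil -polyC1 derivC.
move=> /andP[ks us]; rewrite !big_cons derivM IH // derivD derivX derivC addr0 mul1r eqxx /=.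
congr (_ + _).
  rewrite big_seq [RHS]big_seq_cond; apply: eq_bigl => i; case is_ : (i \in s) => //=.
  by case: eqP => // ik; rewrite -ik is_ in ks.
rewrite mulr_sumr !big_seq; apply: eq_bigr => i is_; rewrite big_cons.
by case: eqP => // ik; rewrite ik is_ in ks.
Qed.

(** The part [t B] of [F] contributes nothing, which leaves [(P Pbar' - P' Pbar) / (2 i)]. In the
    summand of index [k] all factors but one agree, and that one leaves
    [node k - conj(node k) = 2 i eta k]. *)
Lemma wronskian : fibB * fibF^`() - fibF * fibB^`() =
  \sum_k (toC (eta k))%:P * \prod_(i | i != k) (('X + (node i)%:P) * ('X + (conjc (node i))%:P)).
Proof.
transitivity ((fibP * fibPb^`() - fibP^`() * fibPb) * ((2%:R * iC R)^-1)%:P).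
  have EB : fibB^`() = (fibP^`() - fibPb^`()) * ((2%:R * iC R)^-1)%:P.
    by rewrite /fibB derivM derivC mulr0 addr0 derivB.
  have EF : fibF^`() = (fibP^`() + fibPb^`()) * (2%:R^-1)%:P + (toC t)%:P * fibB^`().
    by rewrite /fibF derivD [X in _ + X]derivM derivC mul0r add0r derivM derivC mulr0 addr0 derivD.
  rewrite EF EB /fibF /fibA /fibB; set c := (_^-1)%:P; set h : {poly C} := (2%:R^-1)%:P.
  have hh : h + h = 1.
    rewrite /h -polyCD -polyC1; congr (_%:P).
    by have := complex2_neq0 => h2; field.
  transitivity ((fibP * fibPb^`() - fibP^`() * fibPb) * c * (h + h)); last by rewrite hh mulr1.
  ring.
rewrite /fibP /fibPb !deriv_prod_XaddC mulr_sumr mulr_suml -sumrB mulr_suml.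
apply: eq_bigr => k _.
rewrite (bigD1 k) //= [X in _ - _ * X](bigD1 k) //= big_split /=.
set X1 := \prod_(i | i != k) _; set X2 := \prod_(i | i != k) _.
have -> : ('X + (node k)%:P) * X1 * X2 - X1 * (('X + (conjc (node k))%:P) * X2) =
  (node k - conjc (node k))%:P * (X1 * X2) by rewrite polyCB; ring.
rewrite mulrAC -polyCM; congr (_%:P * _).
rewrite inv2i; apply: (mulfI complex2_neq0).
have -> : 2%:R * ((node k - conjc (node k)) * - (iC R / 2%:R)) = (node k - conjc (node k)) * - iC R.
  by have := complex2_neq0 => h; field.
have -> : 2%:R = toC 2 :> C by rewrite rmorphMn rmorph1.
by apply/eqP; rewrite eq_complex /=; apply/andP; split; apply/eqP; ring.
Qed.

Lemma wronskian_real (y : R) :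
  (fibB * fibF^`() - fibF * fibB^`()).[toC y] = toC (fibK y).
Proof.
rewrite wronskian horner_sum rmorph_sum; apply: eq_bigr => k _.
rewrite hornerM hornerC rmorphM; congr (_ * _).
rewrite horner_prod rmorph_prod; apply: eq_bigr => i _.
rewrite hornerM !hornerD !hornerX !hornerC.
by apply/eqP; rewrite eq_complex /=; apply/andP; split; apply/eqP; ring.
Qed.

(** At a root the two terms of [fibFE] cancel, so [|P| = |Pbar|]. Off the real line every factor of
    one product is strictly smaller in modulus than the matching factor of the other. *)
Lemma fibF_hyperbolic (y : C) : (forall k, 0 < eta k) -> root fibF y -> complex.Im y = 0.
Proof.
move=> eta0 rF; have M0 : (0 < M)%N.
  by rewrite -ltnS -size_fibF; apply: root_size_gt1 rF; apply: monic_neq0 monic_fibF.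
move: rF => /rootP; rewrite fibFE hornerD !hornerM !hornerC => /eqP; rewrite addr_eq0 => /eqP E.
have sq_alpha : sqnormC (conjc alpha) = sqnormC alpha by rewrite /sqnormC /= sqrrN.
have : sqnormC fibP.[y] = sqnormC fibPb.[y].
  have := congr1 (@sqnormC R) E.
  rewrite -mulNr !sqnormCM; have -> : sqnormC (- conjc alpha) = sqnormC alpha.
    by rewrite /sqnormC /=; ring.
  by apply: mulfI; rewrite sqnormC_eq0 alpha_neq0.
rewrite fibP_eval fibPb_eval !sqnormC_prod.
move=> EP; apply/eqP/negPn/negP => Iy.
(* [b] records the half plane of [y]: above the line the factors [y + node k] are the larger ones,
   below it their conjugate counterparts. *)
have key (b : bool) : (0 < (if b then complex.Im y else - complex.Im y)) ->
   \prod_k sqnormC (y + (if b then conjc (node k) else node k)) <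
   \prod_k sqnormC (y + (if b then node k else conjc (node k))).
  move=> I0; apply: ltr_prod; first by apply/hasP; exists (Ordinal M0) => //; apply: mem_index_enum.
  move=> k _; apply/andP; split; first by rewrite /sqnormC addr_ge0 // sqr_ge0.
  by have := eta0 k; case: b I0 => I0 e0; case: (y) I0 => u v /= I0; rewrite /sqnormC /=; nra.
have [I0|I0|I0] := ltrgt0P (complex.Im y); last by rewrite I0 eqxx in Iy.
  by have := key true I0; rewrite EP ltxx.
by have := key false; rewrite oppr_gt0 => /(_ I0); rewrite EP ltxx.
Qed.

(** * Identities at the real roots of F *)

Section Roots.
Hypothesis eta0 : forall k, 0 < eta k.
Variable a : 'I_M -> R.
Hypothesis aF : fibF = \prod_j ('X - (toC (a j))%:P).

Definition Fj j : {poly C} := \prod_(i | i != j) ('X - (toC (a i))%:P).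
Definition rFj j (y : R) : R := \prod_(i | i != j) (y - a i).

Lemma Fj_real j y : (Fj j).[toC y] = toC (rFj j y).
Proof.
rewrite /Fj /rFj horner_prod rmorph_prod; apply: eq_bigr => i _.
by rewrite hornerXsubC rmorphB.
Qed.

Lemma fibF_factor j : fibF = ('X - (toC (a j))%:P) * Fj j.
Proof. by rewrite aF (bigD1 j). Qed.

Lemma root_fibF j : fibF.[toC (a j)] = 0.
Proof. by rewrite (fibF_factor j) hornerM hornerXsubC subrr mul0r. Qed.

Lemma deriv_fibF j : (fibF^`()).[toC (a j)] = toC (rFj j (a j)).
Proof.
rewrite (fibF_factor j) derivM derivXsubC mul1r hornerD hornerM hornerXsubC subrr mul0r addr0.
exact: Fj_real.
Qed.

Lemma fibK_gt0 y : (0 < M)%N -> 0 < fibK y.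
Proof.
move=> M0; rewrite /fibK (bigD1 (Ordinal M0)) //=.
have pos k : 0 < eta k * \prod_(i | i != k) ((y + q i) ^+ 2 + eta i ^+ 2).
  rewrite mulr_gt0 ?eta0 //; apply: prodr_gt0 => i _.
  by rewrite ltr_wpDl ?sqr_ge0 // exprn_gt0.
by rewrite ltr_pwDl ?pos //; apply: sumr_ge0 => k _; rewrite ltW.
Qed.

Lemma fibK_root j : fibK (a j) = reB (a j) * rFj j (a j).
Proof.
apply: (@complexI R); rewrite -wronskian_real hornerD hornerN (hornerM fibB) (hornerM fibF) root_fibF mul0r subr0.
by rewrite fibB_real deriv_fibF rmorphM.
Qed.

Lemma fibK_root_gt0 j : 0 < fibK (a j).
Proof. by apply: fibK_gt0; apply: leq_ltn_trans (ltn_ord j). Qed.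

(** Simplicity of the roots: [K] is positive and, at [a j], has the derivative of [F] as a
    factor. *)
Lemma rFj_neq0 j : rFj j (a j) != 0.
Proof.
have := fibK_root_gt0 j; rewrite fibK_root; apply: contraTneq => ->.
by rewrite mulr0 ltxx.
Qed.

Lemma roots_inj : injective a.
Proof.
move=> i j ij; apply/eqP; apply/negPn/negP => nij.
have := rFj_neq0 j; rewrite /rFj (bigD1 i) //= ij subrr mul0r.
by rewrite eqxx.
Qed.

(** The residue of [B / F] at its simple pole [a j]. *)
Definition beta j : R := reB (a j) / rFj j (a j).

Lemma beta_gt0 j : 0 < beta j.
Proof.
have := fibK_root_gt0 j; have := rFj_neq0 j; rewrite fibK_root /beta => h0.
have -> : reB (a j) / rFj j (a j) = (reB (a j) * rFj j (a j)) / (rFj j (a j) ^+ 2) by field.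
by move=> h; rewrite divr_gt0 // exprn_even_gt0.
Qed.

Lemma betaK j : fibK (a j) = beta j * rFj j (a j) ^+ 2.
Proof. by rewrite fibK_root /beta; have := rFj_neq0 j => h; field. Qed.

Lemma sqnorm_fibP_root j : sqnormC fibP.[toC (a j)] = (1 + t ^+ 2) * (beta j * fibK (a j)).
Proof.
have : reA (a j) + t * reB (a j) = 0.
  by apply: (@complexI R); rewrite -fibF_eval_real root_fibF.
move=> /eqP; rewrite addr_eq0 => /eqP E; rewrite sqnorm_fibPE E fibK_root /beta.
by have := rFj_neq0 j => h; field.
Qed.

Definition lagr (v : 'I_M -> C) : {poly C} :=
  \sum_j (v j / toC (rFj j (a j))) *: Fj j.

Lemma size_Fj j : size (Fj j) = M.
Proof.
have := size_fibF; rewrite (fibF_factor j) size_Mmonic ?polyXsubC_eq0 ?size_XsubC //.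
- by case.
- by apply: monic_prod => i _; apply: monicXsubC.
Qed.

Lemma lagr_eval v j : (lagr v).[toC (a j)] = v j.
Proof.
rewrite /lagr horner_sum (bigD1 j) //= hornerZ Fj_real divfK; last first.
  by rewrite fmorph_eq0 rFj_neq0.
rewrite big1 ?addr0 // => i ij; rewrite hornerZ Fj_real [X in _ * toC X]/rFj (bigD1 j) 1?eq_sym //=.
by rewrite subrr mul0r rmorph0 mulr0.
Qed.

Lemma size_lagr v : (size (lagr v) <= M)%N.
Proof.
apply: (leq_trans (size_sum _ _ _)); apply/bigmax_leqP => j _.
by rewrite (leq_trans (size_scale_leq _ _)) ?size_Fj.
Qed.

Lemma lagr_unique (N : {poly C}) v : (size N <= M)%N ->
  (forall j, N.[toC (a j)] = v j) -> N = lagr v.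
Proof.
move=> sN Nv; apply/eqP; rewrite -subr_eq0; apply/eqP.
apply: (@roots_geq_poly_eq0 _ _ [seq toC (a j) | j <- enum 'I_M]).
- apply/allP => z /mapP [j _ ->]; apply/rootP.
  by rewrite hornerD hornerN lagr_eval Nv subrr.
- by rewrite map_inj_uniq ?enum_uniq // => i j /complexI /roots_inj.
rewrite size_map size_enum_ord (leq_trans (size_polyD _ _)) // geq_max sN size_polyN.
exact: size_lagr.
Qed.

(** As [B] has degree below [M], interpolation writes it as the sum of the [beta j * F_j]. From
    [F = (y - a_j) F_j] one gets [F_j F' - F F_j' = F_j ^ 2]. *)
Lemma fibK_sum_sqr y : fibK y = \sum_j beta j * rFj j y ^+ 2.
Proof.
have EB : fibB = \sum_j (toC (beta j)) *: Fj j.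
  rewrite (lagr_unique (v := fun j => toC (reB (a j))) size_fibB); last by move=> j; rewrite fibB_real.
  by apply: eq_bigr => j _; rewrite /beta rmorphM fmorphV.
apply: (@complexI R); rewrite -wronskian_real.
have -> : fibB * fibF^`() - fibF * fibB^`() = \sum_j (toC (beta j)) *: (Fj j) ^+ 2.
  rewrite {1}EB EB raddf_sum mulr_suml mulr_sumr -sumrB; apply: eq_bigr => j _ /=.
  rewrite derivZ -scalerAl -scalerAr -scalerBr; congr (_ *: _).
  by rewrite !(fibF_factor j) derivM derivXsubC; ring.
rewrite horner_sum rmorph_sum; apply: eq_bigr => j _.
by rewrite hornerZ expr2 hornerM !Fj_real -!rmorphM -expr2.
Qed.

End Roots.
End Fiber.

(** * Existence of the branches *)

Section Existence.
Variable R : realType.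
Local Notation C := R[i].
Local Notation toC := (real_complex R).

(** Specializing [x] first turns the polynomials of the statement into the fiber polynomials studied
    above. *)
Lemma eval2E (p : {poly {poly C}}) (x y : C) :
  eval2 p x y = (map_poly (horner_eval x) p).[y].
Proof.
rewrite /eval2 (horner_coef p) (horner_coef_wide _ (size_poly _ _)) horner_sum.
apply: eq_bigr => i _; rewrite hornerM horner_exp hornerC; congr (_ * _).
by rewrite coef_map.
Qed.

Variables (M : nat) (L : 'I_M -> nat) (q : 'I_M -> {poly R}) (t : R).
Definition qx (x : R) k := (q k).[x].
Definition ex (x : R) k := x ^+ (2 * L k).
Local Notation ev x := (map_poly (horner_eval (toC x))).
Local Notation P := (Ppoly q L).

Lemma factor_eval x k :
  (polyRC (q k) + iC R *: 'X^(2 * L k)).[toC x] = node (qx x) (ex x) k.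
Proof.
rewrite hornerD hornerZ hornerXn [X in X + _](horner_map (toC)) /= -rmorphXn /=.
by apply/eqP; rewrite eq_complex /=; apply/andP; split; apply/eqP; rewrite /qx /ex; ring.
Qed.

Lemma ev_P x : ev x P = fibP (qx x) (ex x).
Proof.
rewrite rmorph_prod; apply: eq_bigr => k _.
by rewrite rmorphD /= map_polyX map_polyC /= /horner_eval factor_eval.
Qed.

Lemma ev_conjP x : ev x (conj2 P) = fibPb (qx x) (ex x).
Proof.
rewrite /conj2 !rmorph_prod; apply: eq_bigr => k _.
rewrite rmorphD /= map_polyX map_polyC /= rmorphD /= map_polyX map_polyC /= /horner_eval.
have {1}-> : toC x = Num.conj (toC x) by rewrite /=; apply/eqP; rewrite eq_complex /= oppr0 !eqxx.
by rewrite horner_map factor_eval.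
Qed.

Lemma ev_A x : ev x (Apoly P) = fibA (qx x) (ex x).
Proof. by rewrite /Apoly rmorphM rmorphD /= ev_P ev_conjP map_polyC /= /horner_eval hornerC. Qed.
Lemma ev_B x : ev x (Bpoly P) = fibB (qx x) (ex x).
Proof. by rewrite /Bpoly rmorphM rmorphB /= ev_P ev_conjP map_polyC /= /horner_eval hornerC. Qed.
Lemma ev_F x : ev x (Apoly P + (rC t)%:P%:P * Bpoly P) = fibF (qx x) (ex x) t.
Proof. by rewrite rmorphD rmorphM /= ev_A ev_B map_polyC /= /horner_eval hornerC. Qed.
Lemma ev_G x : ev x ((Apoly P)^`() + (rC t)%:P%:P * (Bpoly P)^`()) = (fibF (qx x) (ex x) t)^`().
Proof.
have -> : (Apoly P)^`() + (rC t)%:P%:P * (Bpoly P)^`() = (Apoly P + (rC t)%:P%:P * Bpoly P)^`().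
  by move: (Apoly P) (Bpoly P) => A B; rewrite derivD [X in _ = _ + X]derivM derivC mul0r add0r.
by rewrite -ev_F deriv_map.
Qed.

Hypothesis hL : forall j, (0 < L j)%N.
Hypothesis hq0 : forall j, (q j).[0] = 0.

Lemma ex_gt0 x k : x != 0 -> 0 < ex x k.
Proof. by move=> x0; rewrite exprn_even_gt0 ?x0 ?orbT // oddM. Qed.

(** Over [x = 0] the roots of [P] lie on the line and the Hermite-Biehler argument does not apply;
    reality of the roots, and the fact that all branches pass through the origin, are read off
    [F = y ^ M]. *)
Lemma fibF_at0 : fibF (qx 0) (ex 0) t = 'X^M.
Proof.
have n0 k : node (qx 0) (ex 0) k = 0.
  by rewrite /node /qx /ex hq0 expr0n muln_eq0 /= eqn0Ngt hL.
have EP : fibP (qx 0) (ex 0) = 'X^M.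
  rewrite /fibP; under eq_bigr do rewrite n0 addr0.
  by rewrite big_const card_ord; elim: M => //= m ->; rewrite exprS.
have EPb : fibPb (qx 0) (ex 0) = 'X^M.
  rewrite /fibPb; under eq_bigr do rewrite n0 conjc0 addr0.
  by rewrite big_const card_ord; elim: M => //= m ->; rewrite exprS.
by rewrite fibFE EP EPb -mulrDl -polyCD alpha_add mul1r.
Qed.

Let p x : {poly R} := map_poly (@complex.Re R) (fibF (qx x) (ex x) t).

Let p_map x : map_poly toC (p x) = fibF (qx x) (ex x) t.
Proof.
by apply/polyP => k; rewrite coef_map /= coef_map_id0 // -fibF_real.
Qed.

Let p_family : hyp_family M p.
Proof.
split.
  move=> i; pose c : {poly C} := (Apoly P + (rC t)%:P%:P * Bpoly P)`_i.
  apply: (an_ext (f := fun x => \sum_(k < size c) complex.Re c`_k * x ^+ k)).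
    apply: near0_all => x; rewrite coef_map_id0 // -ev_F coef_map /= /horner_eval.
    rewrite horner_coef raddf_sum; apply: eq_bigr => k _.
    by rewrite -rmorphXn /=; case: (_`_k) => u v /=; ring.
  by apply: an_sum => k; apply: an_mul (an_cst _) (an_exp _ (an_id _)).
apply: near0_all => x; split.
- by have := monic_fibF (qx x) (ex x) t; rewrite -p_map map_monic.
- by have := size_fibF (qx x) (ex x) t; rewrite -p_map size_map_poly.
move=> z; rewrite p_map; have [->|x0] := eqVneq x 0.
  rewrite fibF_at0 => /rootP; rewrite hornerXn => /eqP.
  by rewrite expf_eq0 => /andP[_ /eqP ->].
by apply: fibF_hyperbolic => k; apply: ex_gt0.
Qed.

Lemma branches_exist : exists b : 'I_M -> nat -> R,
  [/\ forall j, conv_series1 (b j), forall j, eval_series1 (b j) 0 = 0 &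
  exists e : R, 0 < e /\ forall x : R, `|x| < e -> forall y : R[i],
       eval2 (Apoly P + (rC t)%:P%:P * Bpoly P) (rC x) y =
       \prod_(j < M) (y - rC (eval_series1 (b j) x))].
Proof.
have [s [ss As Hs]] := split_hyperbolic p_family.
have /boolp.choice [b Hb] : forall j : 'I_M, exists b, germ (nth (fun=> 0) s j) b by move=> j; apply: As.
have Hev : \forall x \near (0 : R), forall j : 'I_M, nth (fun=> 0) s j x = eval_series1 (b j) x.
  by apply: near0_forall => j; apply: germ_eval.
have Hp : \forall x \near (0 : R), fibF (qx x) (ex x) t = \prod_(j < M) ('X - (toC (eval_series1 (b j) x))%:P).
  apply: filterS2 Hs Hev => x E Ex; rewrite -p_map E rmorph_prod (big_nth (fun=> 0)) big_mkord ss.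
  by apply: eq_bigr => j _; rewrite rmorphB /= map_polyX map_polyC /= Ex.
exists b; split.
- by move=> j; apply: germ_conv (Hb j).
- move=> j; have := nbhs_singleton Hp; rewrite fibF_at0 => E.
  have : ('X^M).[toC (eval_series1 (b j) 0)] = 0 :> C.
    by rewrite E horner_prod (bigD1 j) //= hornerXsubC subrr mul0r.
  rewrite hornerXn -rmorphXn => /eqP; rewrite fmorph_eq0 expf_eq0 => /andP[_ /eqP //].
have /near0P [e [e0 He]] := Hp; exists e; split=> // x xe y.
rewrite eval2E -[rC x]/(toC x) ev_F He // horner_prod; apply: eq_bigr => j _.
by rewrite hornerXsubC.
Qed.

End Existence.

(** * Double power series and interpolation at the roots *)

Import Normc.

Section ComplexNorm.
Variable R : realType.
Local Notation C := R[i].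
Local Notation toC := (real_complex R).
Implicit Types z w : C.

Lemma normc_ge0 z : 0 <= normc z. Proof. by case: z => a b; apply: sqrtr_ge0. Qed.
Lemma normc_sqr z : normc z ^+ 2 = sqnormC z.
Proof. by case: z => a b; rewrite /normc /sqnormC /= sqr_sqrtr // addr_ge0 ?sqr_ge0. Qed.
Lemma ncD z w : normc (z + w) <= normc z + normc w. Proof. exact: le_normcD. Qed.
Lemma ncN z : normc (- z) = normc z. Proof. exact: normcN. Qed.
Lemma ncB z w : normc (z - w) <= normc z + normc w.
Proof. by apply: (le_trans (ncD _ _)); rewrite ncN. Qed.
Lemma ncM z w : normc (z * w) = normc z * normc w. Proof. exact: normcM. Qed.
Lemma nc0 : normc (0 : C) = 0. Proof. exact: normc0. Qed.
Lemma ncX z n : normc (z ^+ n) = normc z ^+ n.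
Proof. by elim: n => [|n IH]; [exact: normc1|rewrite !exprS ncM IH]. Qed.
Lemma nc_sum (I : Type) (s : seq I) (P : pred I) (f : I -> C) :
  normc (\sum_(i <- s | P i) f i) <= \sum_(i <- s | P i) normc (f i).
Proof.
elim/big_rec2: _ => [|i y1 y2 _ H]; first by rewrite nc0.
by apply: (le_trans (ncD _ _)); rewrite lerD2l.
Qed.
Lemma nc_prod (I : Type) (s : seq I) (P : pred I) (f : I -> C) :
  normc (\prod_(i <- s | P i) f i) = \prod_(i <- s | P i) normc (f i).
Proof. by apply: (big_morph _ ncM); exact: normc1. Qed.
Lemma nc_real (x : R) : normc (toC x) = `|x|.
Proof. by rewrite /normc /= expr0n addr0 sqrtr_sqr. Qed.
Lemma norm_eq_nc z : `|z| = toC (normc z). Proof. by []. Qed.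
Lemma Re_le_nc z : `|complex.Re z| <= normc z.
Proof. by case: z => a b /=; rewrite -sqrtr_sqr ler_sqrt ?addr_ge0 ?sqr_ge0 // lerDl sqr_ge0. Qed.
Lemma Im_le_nc z : `|complex.Im z| <= normc z.
Proof. by case: z => a b /=; rewrite -sqrtr_sqr ler_sqrt ?addr_ge0 ?sqr_ge0 // lerDr sqr_ge0. Qed.
Lemma nc_le_ReIm z : normc z <= `|complex.Re z| + `|complex.Im z|.
Proof.
rewrite -ler_sqr ?nnegrE ?addr_ge0 ?normc_ge0 // normc_sqr /sqnormC.
have := normr_ge0 (complex.Re z); have := normr_ge0 (complex.Im z).
rewrite -(real_normK (num_real (complex.Re z))) -(real_normK (num_real (complex.Im z))).
by nra.
Qed.
Lemma nc_gt0 z : (0 < normc z) = (z != 0).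
Proof.
rewrite lt_def normc_ge0 andbT; congr negb; apply/eqP/eqP => [/eq0_normc //|->].
exact: nc0.
Qed.
Lemma nc_conj z : normc (conjc z) = normc z.
Proof. by case: z => a b /=; rewrite sqrrN. Qed.

Lemma geo_half (r : R) n : 0 <= r -> r <= 2^-1 -> \sum_(i < n) r ^+ i <= 2.
Proof.
move=> r0 rh; apply: (@le_trans _ _ (2 * (1 - r ^+ n))); last first.
  by have : 0 <= r ^+ n by [rewrite exprn_ge0]; lra.
elim: n => [|n IH]; first by rewrite big_ord0 expr0 subrr mulr0.
rewrite big_ord_recr /=; have : r ^+ n.+1 <= 2^-1 * r ^+ n by rewrite exprS ler_wpM2r // exprn_ge0.
by move: IH; lra.
Qed.

(** Removes an exponentially small error from an inequality; it serves to let a truncation order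
    tend to infinity at a fixed point. *)
Lemma half_exp_small (X Y Z : R) : (forall n : nat, X <= Y + Z * 2^-1 ^+ n) -> X <= Y.
Proof.
move=> H; rewrite leNgt; apply/negP => YX.
have d0 : 0 < X - Y by rewrite subr_gt0.
have Z0 : 0 < Z by have := H 0%N; rewrite expr0; lra.
have := H (Num.truncn (Z / (X - Y))); rewrite exprVn => H1.
have p0 : 0 < (2 : R) ^+ Num.truncn (Z / (X - Y)) by rewrite exprn_gt0.
have : (X - Y) * 2 ^+ Num.truncn (Z / (X - Y)) <= Z.
  by rewrite -ler_pdivlMr //; lra.
rewrite mulrC -ler_pdivlMr // leNgt => /negP; apply.
apply: lt_le_trans (natr_le_expr2 _ _); exact: truncnS_gt.
Qed.

Lemma geo_cvg (u : nat -> R) (A r : R) : 0 <= A -> 0 <= r -> r <= 2^-1 ->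
  (forall n, `|u n.+1 - u n| <= A * r ^+ n) ->
  u @ \oo --> limR u /\ forall N, `|limR u - u N| <= 2 * A * r ^+ N.
Proof.
move=> A0 r0 rh Hu.
have cv : cvgn u.
  have -> : u = (fun n => u 0%N + series (telescope u) n) by apply/funext => n; apply: eq_sum_telescope.
  apply: is_cvgD; first exact: is_cvg_cst.
  apply: normed_cvg; apply: (@series_le_cvg _ _ (geometric A r)) => [n|n|n|].
  - exact: normr_ge0.
  - by rewrite /geometric /= mulr_ge0 // exprn_ge0.
  - exact: Hu.
  - by apply: is_cvg_geometric_series; rewrite ger0_norm //; lra.
split=> // N; have Hn n : `|u (N + n)%N - u N| <= 2 * A * r ^+ N.
  have -> : u (N + n)%N - u N = \sum_(i < n) (u (N + i).+1 - u (N + i)%N).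
    elim: n => [|n IH]; first by rewrite big_ord0 addn0 subrr.
    by rewrite big_ord_recr /= -IH addnS; ring.
  apply: (le_trans (ler_norm_sum _ _ _)).
  apply: (@le_trans _ _ (\sum_(i < n) A * r ^+ N * r ^+ i)).
    by apply: ler_sum => i _; rewrite -mulrA -exprD.
  rewrite -mulr_sumr mulrC [2 * A * _]mulrC [2 * A]mulrC mulrA [r ^+ N * A]mulrC mulrC ler_wpM2l ?mulr_ge0 ?exprn_ge0 //.
  exact: geo_half.
have /cvgrPdist_lt Hc := cv.
apply/ler_addgt0Pr => e e0; have /= [n _ Hn'] := Hc e e0.
have := Hn' (N + n)%N (leq_addl _ _) => /= H1.
have -> : limR u - u N = (u (N + n)%N - u N) + (limR u - u (N + n)%N) by ring.
by apply: (le_trans (ler_normD _ _)); apply: lerD; [exact: Hn|exact: ltW].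
Qed.

(** Cauchy estimates on the disc of radius [rho], kept as a condition on coefficients because it
    controls values on half the disc and is stable under division by ['X - a%:P]. *)
Definition coef_bound (rho K : R) (p : {poly C}) := forall n, normc p`_n * rho ^+ n <= K.

Lemma coef_bound_eval rho K (p : {poly C}) y : 0 < rho -> 0 <= K -> coef_bound rho K p ->
  normc y <= rho / 2 -> normc p.[y] <= 2 * K.
Proof.
move=> r0 K0 Hp yr; rewrite horner_coef; apply: (le_trans (nc_sum _ _ _)).
pose s := normc y / rho.
have s0 : 0 <= s by rewrite divr_ge0 ?normc_ge0 // ltW.
have sh : s <= 2^-1 by rewrite ler_pdivrMr // mulrC.
apply: (@le_trans _ _ (\sum_(i < size p) K * s ^+ i)).
  apply: ler_sum => i _; rewrite ncM ncX.
  have -> : normc y = rho * s by rewrite /s mulrC divfK // gt_eqF.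
  by rewrite exprMn mulrA ler_wpM2r ?exprn_ge0.
by rewrite -mulr_sumr mulrC ler_wpM2r // geo_half.
Qed.

(** Synthetic division gives [h_k = p_(k+1) + a h_(k+1)]. As [|a| <= rho / 2], the bound [2 K] for
    [|h_k| rho ^ (k+1)] reproduces itself downwards, as [K] plus half of [2 K]. *)
Lemma coef_bound_div rho K (p : {poly C}) a : 0 < rho -> 0 <= K -> coef_bound rho K p ->
  normc a <= rho / 2 -> exists2 h, p = h * ('X - a%:P) + (p.[a])%:P & coef_bound rho (2 * K / rho) h.
Proof.
move=> r0 K0 Hp ar; pose h := p %/ ('X - a%:P).
have E : p = h * ('X - a%:P) + (p.[a])%:P by rewrite {1}(divp_eq p ('X - a%:P)) modp_XsubC.
exists h => // n; clear - r0 K0 Hp ar E.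
have Hc k : h`_k = p`_k.+1 + a * h`_k.+1.
  by rewrite {1}E coefD coefC /= addr0 mulrBr coefB coefMX coefMC /=; ring.
have base k : (size h <= k)%N -> normc h`_k * rho ^+ k.+1 <= 2 * K.
  by move=> hk; rewrite nth_default // nc0 mul0r mulr_ge0.
rewrite ler_pdivlMr // -mulrA -exprSr.
have : forall m k, (size h - k <= m)%N -> normc h`_k * rho ^+ k.+1 <= 2 * K; last by move/(_ (size h) n); apply; apply: leq_subr.
elim=> [|m IH] k hk; first by apply: base; rewrite -subn_eq0 -leqn0.
have {}IH := IH k.+1; rewrite subnS -ltnS in IH.
have IH' : normc h`_k.+1 * rho ^+ k.+2 <= 2 * K.
  apply: IH; rewrite ltnS; move: hk; case: (size h - k)%N => //.
rewrite Hc; apply: (@le_trans _ _ ((normc p`_k.+1 + rho / 2 * normc h`_k.+1) * rho ^+ k.+1)).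
  rewrite ler_wpM2r ?exprn_ge0 ?(ltW r0) //; apply: (le_trans (ncD _ _)); rewrite lerD2l ncM.
  by rewrite ler_wpM2r ?normc_ge0.
rewrite mulrDl; have := Hp k.+1 => H1.
have -> : rho / 2 * normc h`_k.+1 * rho ^+ k.+1 = 2^-1 * (normc h`_k.+1 * rho ^+ k.+2).
  by rewrite [rho ^+ k.+2]exprS; ring.
by move: H1 IH'; lra.
Qed.

(** The bound on the quotient involves neither the degree of [p] nor the distances between the roots
    in [s]: it is uniform over truncations and over coalescing roots. *)
Lemma coef_bound_div_prod rho K (p : {poly C}) (s : seq C) : 0 < rho -> 0 <= K ->
  coef_bound rho K p -> (forall a, a \in s -> normc a <= rho / 2) ->
  exists h N, [/\ p = h * \prod_(a <- s) ('X - a%:P) + N, (size N <= size s)%N &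
    coef_bound rho (K * (2 / rho) ^+ size s) h].
Proof.
move=> r0 K0 Hp; elim: s => [|a s IH] Hs.
  by exists p, 0; rewrite big_nil mulr1 addr0 size_poly0 mulr1.
have [|h1 [N1 [E sN Hh]]] := IH; first by move=> b bs; apply: Hs; rewrite inE bs orbT.
have K1 : 0 <= K * (2 / rho) ^+ size s by rewrite mulr_ge0 // exprn_ge0 // divr_ge0 // ltW.
have [h Eh Hh'] := coef_bound_div r0 K1 Hh (Hs a (mem_head _ _)).
exists h, ((h1.[a])%:P * \prod_(a <- s) ('X - a%:P) + N1); split.
- by rewrite {1}E {1}Eh big_cons; ring.
- rewrite (leq_trans (size_polyD _ _)) // geq_max (leq_trans sN) //= andbT mul_polyC.
  by rewrite (leq_trans (size_scale_leq _ _)) // size_prod_XsubC.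
- move=> n; apply: (le_trans (Hh' n)); rewrite /= exprS.
  by rewrite [X in X <= _](_ : _ = K * (2 / rho * (2 / rho) ^+ size s)) //; ring.
Qed.

End ComplexNorm.

(** * Double power series and their truncations on a fiber *)

Section DoubleSeries.
Variable R : realType.
Local Notation C := R[i].
Local Notation toC := (real_complex R).
Variables (c : nat -> nat -> C) (r K : R).
Hypothesis r0 : 0 < r.
Hypothesis K0 : 0 <= K.
Hypothesis cK : forall m n, normc (c m n) * r ^+ (m + n) <= K.

Lemma term_bound x y s m n : normc x <= s * r -> normc y <= s * r -> 0 <= s ->
  normc (c m n * x ^+ m * y ^+ n) <= K * s ^+ m * s ^+ n.
Proof.
move=> xs ys s0; rewrite !ncM !ncX.
apply: (@le_trans _ _ (normc (c m n) * (s * r) ^+ m * (s * r) ^+ n)).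
  have sr : 0 <= s * r by rewrite mulr_ge0 // ltW.
  apply: ler_pM; rewrite ?mulr_ge0 ?exprn_ge0 ?normc_ge0 //; last by apply: lerXn2r; rewrite ?nnegrE ?normc_ge0.
  by rewrite ler_wpM2l ?normc_ge0 //; apply: lerXn2r; rewrite ?nnegrE ?normc_ge0.
have -> : normc (c m n) * (s * r) ^+ m * (s * r) ^+ n = (normc (c m n) * r ^+ (m + n)) * s ^+ m * s ^+ n.
  by rewrite !exprMn exprD; ring.
by rewrite ler_wpM2r ?exprn_ge0 // ler_wpM2r ?exprn_ge0.
Qed.

Lemma psum2S x y N : psum2 c x y N.+1 - psum2 c x y N =
  \sum_(m < N) c m N * x ^+ m * y ^+ N + \sum_(n < N.+1) c N n * x ^+ N * y ^+ n.
Proof.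
rewrite /psum2 big_ord_recr /=.
under eq_bigr do rewrite big_ord_recr /=.
by rewrite big_split /=; ring.
Qed.

Lemma psum2_step x y s N : normc x <= s * r -> normc y <= s * r -> 0 <= s -> s <= 2^-1 ->
  normc (psum2 c x y N.+1 - psum2 c x y N) <= 4 * K * s ^+ N.
Proof.
move=> xs ys s0 sh; rewrite psum2S; apply: (le_trans (ncD _ _)).
have H1 : normc (\sum_(m < N) c m N * x ^+ m * y ^+ N) <= 2 * K * s ^+ N.
  apply: (le_trans (nc_sum _ _ _)); apply: (@le_trans _ _ (\sum_(m < N) s ^+ m * (K * s ^+ N))).
    apply: ler_sum => m _; apply: (le_trans (term_bound _ _ xs ys s0)).
    by rewrite [leRHS](_ : _ = K * s ^+ m * s ^+ N) //; ring.
  by rewrite -mulr_suml -mulrA ler_wpM2r ?mulr_ge0 ?exprn_ge0 // geo_half.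
have H2 : normc (\sum_(n < N.+1) c N n * x ^+ N * y ^+ n) <= 2 * K * s ^+ N.
  apply: (le_trans (nc_sum _ _ _)); apply: (@le_trans _ _ (\sum_(m < N.+1) s ^+ m * (K * s ^+ N))).
    apply: ler_sum => m _; apply: (le_trans (term_bound _ _ xs ys s0)).
    by rewrite [leRHS](_ : _ = K * s ^+ N * s ^+ m) //; ring.
  by rewrite -mulr_suml -mulrA ler_wpM2r ?mulr_ge0 ?exprn_ge0 // geo_half.
by apply: (le_trans (lerD H1 H2)); rewrite -mulrDl -mulrDl; rewrite [2 + 2](_ : _ = 4) //; ring.
Qed.

Lemma eval_series2_approx x y s : normc x <= s * r -> normc y <= s * r -> 0 <= s -> s <= 2^-1 ->
  [/\ (fun N => complex.Re (psum2 c x y N)) @ \oo --> complex.Re (eval_series2 c x y),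
   (fun N => complex.Im (psum2 c x y N)) @ \oo --> complex.Im (eval_series2 c x y) &
   forall N, normc (eval_series2 c x y - psum2 c x y N) <= 16 * K * s ^+ N].
Proof.
move=> xs ys s0 sh; have A0 : 0 <= 4 * K by rewrite mulr_ge0.
have [|c1 b1] := @geo_cvg R (fun N => complex.Re (psum2 c x y N)) (4 * K) s A0 s0 sh.
  move=> n; rewrite -raddfB; apply: (le_trans (Re_le_nc _)); exact: psum2_step.
have [|c2 b2] := @geo_cvg R (fun N => complex.Im (psum2 c x y N)) (4 * K) s A0 s0 sh.
  move=> n; rewrite -raddfB; apply: (le_trans (Im_le_nc _)); exact: psum2_step.
split=> // N; apply: (le_trans (nc_le_ReIm _)); rewrite !raddfB /=.
by apply: (le_trans (lerD (b1 N) (b2 N))); rewrite -mulrDl; rewrite [2 * _ + _](_ : _ = 16 * K) //; ring.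
Qed.

Lemma eval_series2_bound x y : normc x <= r / 2 -> normc y <= r / 2 ->
  normc (eval_series2 c x y) <= 16 * K.
Proof.
move=> xs ys; have [||||_ _ /(_ 0%N)] := @eval_series2_approx x y 2^-1; rewrite ?[2^-1 * r]mulrC //.
by rewrite /psum2 big_ord0 subr0 expr0 mulr1.
Qed.

Definition slice x N : {poly C} := \poly_(n < N) (\sum_(m < N) c m n * x ^+ m).

Lemma slice_eval x y N : (slice x N).[y] = psum2 c x y N.
Proof.
rewrite horner_poly /psum2 exchange_big /=; apply: eq_bigr => n _.
by rewrite mulr_suml.
Qed.

Lemma slice_bound x N : normc x <= r / 2 -> coef_bound r (2 * K) (slice x N).
Proof.
move=> xr n; rewrite coef_poly; case: ifP => _; last by rewrite nc0 mul0r mulr_ge0.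
pose s := normc x / r; have s0 : 0 <= s by rewrite divr_ge0 ?normc_ge0 // ltW.
have sh : s <= 2^-1 by rewrite ler_pdivrMr // mulrC.
apply: (@le_trans _ _ ((\sum_(m < N) normc (c m n * x ^+ m)) * r ^+ n)).
  by rewrite ler_wpM2r ?exprn_ge0 ?(ltW r0) // nc_sum.
rewrite mulr_suml; apply: (@le_trans _ _ (\sum_(m < N) s ^+ m * K)).
  apply: ler_sum => m _; rewrite ncM ncX.
  have -> : normc x = s * r by rewrite /s divfK // gt_eqF.
  have -> : normc (c m n) * (s * r) ^+ m * r ^+ n = s ^+ m * (normc (c m n) * r ^+ (m + n)).
    by rewrite exprMn exprD; ring.
  by rewrite ler_wpM2l ?exprn_ge0.
by rewrite -mulr_suml ler_wpM2r // geo_half.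
Qed.

Variables (M : nat) (q eta : 'I_M -> R) (t : R) (a : 'I_M -> R) (x : C).
Hypothesis eta0 : forall k, 0 < eta k.
Hypothesis aF : fibF q eta t = \prod_j ('X - (toC (a j))%:P).
Hypothesis ar : forall j, `|a j| <= r / 2.
Hypothesis xr : normc x <= r / 2.

(** A truncation is a polynomial in [y]; dividing it by [F] leaves its interpolant as remainder,
    with a quotient bounded independently of the truncation order. The truncation is then
    removed. *)
Lemma lagrange_approx y : normc y <= r / 2 ->
  normc (eval_series2 c x y - (lagr a (fun j => eval_series2 c x (toC (a j)))).[y]) <=
  4 * K * (2 / r) ^+ M * normc (fibF q eta t).[y].
Proof.
move=> yr; pose v N j := (slice x N).[toC (a j)].
have K2 : 0 <= 2 * K by rewrite mulr_ge0.
have step N : normc ((slice x N).[y] - (lagr a (v N)).[y]) <= 4 * K * (2 / r) ^+ M * normc (fibF q eta t).[y].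
  have [h [N1 [E sN Hh]]] := coef_bound_div_prod (s := [seq toC (a j) | j <- enum 'I_M]) r0 K2 (slice_bound N xr) (fun b bs => let: ex_intro2 j _ E := mapP bs in eq_ind_r (fun z => normc z <= _) (eq_ind_r (fun z => z <= _) (ar j) (nc_real (a j))) E).
  have EF : \prod_(b <- [seq toC (a j) | j <- enum 'I_M]) ('X - b%:P) = fibF q eta t.
    by rewrite big_map big_enum aF.
  rewrite size_map size_enum_ord EF in E sN Hh.
  have N1E : N1 = lagr a (v N).
    apply: (lagr_unique eta0 aF) => // j; rewrite /v E hornerD hornerM (root_fibF aF) mulr0 add0r.
    by [].
  have -> : (slice x N).[y] - (lagr a (v N)).[y] = h.[y] * (fibF q eta t).[y].
    by rewrite -N1E {1}E hornerD hornerM addrK.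
  rewrite ncM ler_wpM2r ?normc_ge0 //.
  have := coef_bound_eval r0 _ Hh yr; rewrite mulr_ge0 ?exprn_ge0 ?divr_ge0 ?(ltW r0) // => /(_ isT).
  by move=> /le_trans; apply; rewrite !mulrA; rewrite [2 * 2](_ : _ = 4) //; ring.
(* [D] has no bound when the nodes coalesce, but it only occurs multiplied by [2 ^- N] at a fixed
   [x], so it is absent from the result. *)
pose D := \sum_j normc ((toC (rFj a j (a j)))^-1 * (Fj a j).[y]).
apply: (half_exp_small (Z := 16 * K * (1 + D))) => N.
have appr z : normc z <= r / 2 -> normc (eval_series2 c x z - (slice x N).[z]) <= 16 * K * 2^-1 ^+ N.
  by move=> zr; rewrite slice_eval; have [||||_ _ /(_ N)] := @eval_series2_approx x z 2^-1; rewrite ?[2^-1 * r]mulrC.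
have L : normc ((lagr a (v N)).[y] - (lagr a (fun j => eval_series2 c x (toC (a j)))).[y]) <= 16 * K * 2^-1 ^+ N * D.
  rewrite /lagr !horner_sum -sumrB; apply: (le_trans (nc_sum _ _ _)).
  rewrite /D mulr_sumr; apply: ler_sum => j _; rewrite !hornerZ.
  rewrite [X in normc X](_ : _ = (v N j - eval_series2 c x (toC (a j))) * ((toC (rFj a j (a j)))^-1 * (Fj a j).[y])); last by ring.
  rewrite ncM ler_wpM2r ?normc_ge0 // -ncN opprB; apply: appr.
  by rewrite nc_real.
have H0 := appr y yr; have H1 := step N.
rewrite [X in normc X](_ : _ = (eval_series2 c x y - (slice x N).[y]) + (((slice x N).[y] - (lagr a (v N)).[y]) + ((lagr a (v N)).[y] - (lagr a (fun j => eval_series2 c x (toC (a j)))).[y]))); last by ring.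
apply: (le_trans (ncD _ _)); have := ncD ((slice x N).[y] - (lagr a (v N)).[y]) ((lagr a (v N)).[y] - (lagr a (fun j => eval_series2 c x (toC (a j)))).[y]).
move: H0 H1 L; set A1 := normc _; set A2 := normc _; set A3 := normc _; set A4 := normc _; set B1 := 4 * K * _ * _ => H0 H1 L H3.
have -> : B1 + 16 * K * (1 + D) * 2^-1 ^+ N = 16 * K * 2^-1 ^+ N + (B1 + 16 * K * 2^-1 ^+ N * D) by ring.
by lra.
Qed.

End DoubleSeries.

(** * Complex-valued functions of a real variable *)

Section ComplexCurves.
Variable R : realType.
Local Notation C := R[i].
Local Notation toC := (real_complex R).
Local Notation Re := (@complex.Re R).
Local Notation Im := (@complex.Im R).

Lemma is_derive_extf (f g : R -> R) (x d : R) : f =1 g -> is_derive x 1 f d -> is_derive x 1 g d.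
Proof. by move=> /funext ->. Qed.

Definition cderiv (g : R -> C) (x : R) (d : C) :=
  is_derive x (1 : R) (fun s => Re (g s)) (Re d) /\ is_derive x (1 : R) (fun s => Im (g s)) (Im d).

Lemma cderiv_ext (g h : R -> C) x d : g =1 h -> cderiv g x d -> cderiv h x d.
Proof. by move=> /funext ->. Qed.

Lemma cderiv_eq (g : R -> C) x d e : cderiv g x d -> d = e -> cderiv g x e.
Proof. by move=> H <-. Qed.

Lemma cderiv_cst (z : C) x : cderiv (fun=> z) x 0.
Proof. by split; apply: is_derive_cst. Qed.

Lemma rderiv_eq (f : R -> R) (x d e : R) : is_derive x (1 : R) f d -> d = e -> is_derive x (1 : R) f e.
Proof. by move=> H <-. Qed.
Lemma rderivD (f g : R -> R) (x df dg : R) : is_derive x (1 : R) f df -> is_derive x (1 : R) g dg ->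
  is_derive x (1 : R) (fun s => f s + g s) (df + dg).
Proof. by move=> Hf Hg; exact: is_deriveD. Qed.
Lemma rderivB (f g : R -> R) (x df dg : R) : is_derive x (1 : R) f df -> is_derive x (1 : R) g dg ->
  is_derive x (1 : R) (fun s => f s - g s) (df - dg).
Proof. by move=> Hf Hg; exact: is_deriveB. Qed.
Lemma rderivN (f : R -> R) (x df : R) : is_derive x (1 : R) f df ->
  is_derive x (1 : R) (fun s => - f s) (- df).
Proof. by move=> Hf; exact: is_deriveN. Qed.
Lemma rderivM (f g : R -> R) (x df dg : R) : is_derive x (1 : R) f df -> is_derive x (1 : R) g dg ->
  is_derive x (1 : R) (fun s => f s * g s) (f x * dg + g x * df).
Proof. by move=> Hf Hg; exact: is_deriveM. Qed.
Lemma rderivV (f : R -> R) (x df : R) : f x != 0 -> is_derive x (1 : R) f df ->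
  is_derive x (1 : R) (fun s => (f s)^-1) (- (f x ^- 2) * df).
Proof. by move=> f0 Hf; exact: is_deriveV. Qed.

Lemma cderivD (g h : R -> C) x d e : cderiv g x d -> cderiv h x e ->
  cderiv (fun s => g s + h s) x (d + e).
Proof.
move=> [gr gi] [hr hi]; split.
  by apply: is_derive_extf (rderiv_eq (rderivD gr hr) _) => [s|]; rewrite raddfD.
by apply: is_derive_extf (rderiv_eq (rderivD gi hi) _) => [s|]; rewrite raddfD.
Qed.

Lemma cderivM (g h : R -> C) x d e : cderiv g x d -> cderiv h x e ->
  cderiv (fun s => g s * h s) x (d * h x + g x * e).
Proof.
move=> [gr gi] [hr hi]; split.
  apply: is_derive_extf (rderiv_eq (rderivB (rderivM gr hr) (rderivM gi hi)) _) => [s|].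
    by case: (g s) => a b; case: (h s) => u v.
  by case: (g x) => a b; case: (h x) => u v; case: d {gr gi} => d1 d2; case: e {hr hi} => e1 e2 /=; ring.
apply: is_derive_extf (rderiv_eq (rderivD (rderivM gr hi) (rderivM gi hr)) _) => [s|].
  by case: (g s) => a b; case: (h s) => u v.
by case: (g x) => a b; case: (h x) => u v; case: d {gr gi} => d1 d2; case: e {hr hi} => e1 e2 /=; ring.
Qed.

Lemma cderivV (g : R -> C) x d : g x != 0 -> cderiv g x d ->
  cderiv (fun s => (g s)^-1) x (- (d * ((g x)^-1 * (g x)^-1))).
Proof.
move=> g0 [gr gi].
pose n s := Re (g s) * Re (g s) + Im (g s) * Im (g s).
have n0 : n x != 0.
  by move: g0; rewrite -sqnormC_eq0 /sqnormC /n !expr2.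
have dV := rderivV n0 (rderivD (rderivM gr gr) (rderivM gi gi)).
split.
  apply: is_derive_extf (rderiv_eq (rderivM gr dV) _) => [s|].
    by rewrite /n; case: (g s) => a b /=; rewrite !expr2.
  move: n0; rewrite /n; case: (g x) => a b /=; case: d {gr gi dV} => d1 d2 /=.
  by rewrite !expr2 => n0; field.
apply: is_derive_extf (rderiv_eq (rderivN (rderivM gi dV)) _) => [s|].
  by rewrite /n; case: (g s) => a b /=; rewrite !expr2.
move: n0; rewrite /n; case: (g x) => a b /=; case: d {gr gi dV} => d1 d2 /=.
by rewrite !expr2 => n0; field.
Qed.

Lemma cderiv_poly (p : {poly C}) (g : R -> C) x d : cderiv g x d ->
  cderiv (fun s => p.[g s]) x ((p^`()).[g x] * d).
Proof.
move=> Hg; elim/poly_ind: p => [|p c IH].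
  apply: cderiv_eq (cderiv_ext _ (cderiv_cst 0 x)) _; first by move=> s; rewrite horner0.
  by rewrite deriv0 horner0 mul0r.
apply: cderiv_eq (cderiv_ext _ (cderivD (cderivM IH Hg) (cderiv_cst c x))) _.
  by move=> s; rewrite hornerMXaddC.
by rewrite derivMXaddC hornerD hornerMX; ring.
Qed.

Lemma cderiv_cont (g : R -> C) x d : cderiv g x d ->
  {for x, continuous (fun s => Re (g s))} /\ {for x, continuous (fun s => Im (g s))}.
Proof.
move=> [[gr _] [gi _]]; split.
  exact: (differentiable_continuous (proj1 (derivable1_diffP _ _) gr)).
exact: (differentiable_continuous (proj1 (derivable1_diffP _ _) gi)).
Qed.

Lemma ftc_closed (F f : R -> R) (a b : R) : a < b ->
  (forall x : R, x \in `[a, b] -> is_derive x (1 : R) F (f x)) ->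
  (forall x : R, x \in `[a, b] -> {for x, continuous f}) ->
  (\int[@lebesgue_measure R]_(x in `[a, b]) (f x)%:E = (F b - F a)%:E)%E.
Proof.
move=> ab dF cf.
have cF x : x \in `[a, b] -> {for x, continuous F}.
  by move=> /dF [dx _]; apply: differentiable_continuous; apply/derivable1_diffP.
rewrite (continuous_FTC2 (F := F) ab) //.
- by apply: continuous_in_subspaceT => x; rewrite inE => xab; apply: cf.
- split.
  + by move=> x /subset_itv_oo_cc xab; have [] := dF _ xab.
  + by apply: cvg_at_right_filter; apply: cF; rewrite bound_itvE ltW.
  + by apply: cvg_at_left_filter; apply: cF; rewrite bound_itvE ltW.
- by move=> x /subset_itv_oo_cc xab; rewrite derive1E; have [_] := dF _ xab.
Qed.

End ComplexCurves.

(** * Measurability of complex-valued functions *)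

Section ComplexMeasurable.
Context d (T : measurableType d) (R : realType).
Local Notation C := R[i].
Local Notation toC := (real_complex R).
Variable D : set T.
Hypothesis mD : measurable D.

Lemma measurable_inv : measurable_fun [set: R] (fun x : R => x^-1).
Proof.
(* The inverse is discontinuous at [0], where its value is [0] by convention; that point is split
   off. *)
have -> : [set: R] = [set~ 0] `|` [set 0] by rewrite setUC setUv.
apply/measurable_funU; first exact: measurableC.
  exact: measurable_set1.
split; last exact: measurable_fun_set1.
apply: open_continuous_measurable_fun.
  by apply: closed_openC; apply: closed_eq.
move=> x; rewrite inE /= => /eqP x0; exact: inv_continuous.
Qed.

Definition cmeas (g : T -> C) :=
  measurable_fun D (fun s => complex.Re (g s)) /\ measurable_fun D (fun s => complex.Im (g s)).

Lemma cmeas_ext g h : g =1 h -> cmeas g -> cmeas h.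
Proof. by move=> /funext ->. Qed.

Lemma cmeas_cst z : cmeas (fun=> z).
Proof. by split; apply: measurable_cst. Qed.

Lemma cmeas_real f : measurable_fun D f -> cmeas (fun s => toC (f s)).
Proof. by move=> mf; split=> //; apply: measurable_cst. Qed.

Lemma cmeasD g h : cmeas g -> cmeas h -> cmeas (fun s => g s + h s).
Proof.
move=> [gr gi] [hr hi]; split.
  rewrite (_ : (fun s => _) = (fun s => complex.Re (g s)) \+ (fun s => complex.Re (h s))).
    exact: measurable_funD.
  by apply/funext => s /=; rewrite raddfD.
rewrite (_ : (fun s => _) = (fun s => complex.Im (g s)) \+ (fun s => complex.Im (h s))).
  exact: measurable_funD.
by apply/funext => s /=; rewrite raddfD.
Qed.

Lemma cmeasM g h : cmeas g -> cmeas h -> cmeas (fun s => g s * h s).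
Proof.
move=> [gr gi] [hr hi]; split.
  rewrite (_ : (fun s => _) = ((fun s => complex.Re (g s)) \* (fun s => complex.Re (h s))) \- ((fun s => complex.Im (g s)) \* (fun s => complex.Im (h s)))).
    by apply: measurable_funB; apply: measurable_funM.
  by apply/funext => s /=; case: (g s) => a b; case: (h s).
rewrite (_ : (fun s => _) = ((fun s => complex.Re (g s)) \* (fun s => complex.Im (h s))) \+ ((fun s => complex.Im (g s)) \* (fun s => complex.Re (h s)))).
  by apply: measurable_funD; apply: measurable_funM.
by apply/funext => s /=; case: (g s) => a b; case: (h s).
Qed.

Lemma meas_sqnorm g : cmeas g -> measurable_fun D (fun s => sqnormC (g s)).
Proof.
move=> [gr gi]; rewrite /sqnormC.
by apply: measurable_funD; apply: measurable_funX.
Qed.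

Lemma cmeasV g : cmeas g -> cmeas (fun s => (g s)^-1).
Proof.
move=> mg; have mn := meas_sqnorm mg.
have mi : measurable_fun D (fun s => (sqnormC (g s))^-1).
  exact: (measurableT_comp measurable_inv mn).
have [gr gi] := mg.
split.
  rewrite (_ : (fun s => _) = (fun s => complex.Re (g s)) \* (fun s => (sqnormC (g s))^-1)).
    exact: measurable_funM.
  by apply/funext => s /=; rewrite /sqnormC; case: (g s) => a b.
rewrite (_ : (fun s => _) = (fun s => - complex.Im (g s)) \* (fun s => (sqnormC (g s))^-1)).
  by apply: measurable_funM => //; apply: measurable_funN.
by apply/funext => s /=; rewrite /sqnormC; case: (g s) => a b /=; rewrite mulNr.
Qed.

Lemma cmeas_poly (p : {poly C}) g : cmeas g -> cmeas (fun s => p.[g s]).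
Proof.
move=> mg; elim/poly_ind: p => [|p c IH].
  by apply: cmeas_ext (cmeas_cst 0) => s; rewrite horner0.
by apply: cmeas_ext (cmeasD (cmeasM IH mg) (cmeas_cst c)) => s; rewrite hornerMXaddC.
Qed.

Lemma cmeasX g n : cmeas g -> cmeas (fun s => g s ^+ n).
Proof. by move=> /(cmeas_poly 'X^n); apply: cmeas_ext => s; rewrite hornerXn. Qed.

Lemma cmeas_sum (I : Type) (s : seq I) (F : I -> T -> C) : (forall i, cmeas (F i)) ->
  cmeas (fun p => \sum_(i <- s) F i p).
Proof.
move=> HF; elim: s => [|i s IH].
  by apply: cmeas_ext (cmeas_cst 0) => p; rewrite big_nil.
by apply: cmeas_ext (cmeasD (HF i) IH) => p; rewrite big_cons.
Qed.

Lemma cmeas_prod (I : Type) (s : seq I) (F : I -> T -> C) : (forall i, cmeas (F i)) ->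
  cmeas (fun p => \prod_(i <- s) F i p).
Proof.
move=> HF; elim: s => [|i s IH].
  by apply: cmeas_ext (cmeas_cst 1) => p; rewrite big_nil.
by apply: cmeas_ext (cmeasM (HF i) IH) => p; rewrite big_cons.
Qed.

End ComplexMeasurable.

(** * The half-disc estimate *)

Section FubiniRectangle.
Context d1 d2 (T1 : measurableType d1) (T2 : measurableType d2) (R : realType).
Variables (m1 : {sigma_finite_measure set T1 -> \bar R}) (m2 : {sigma_finite_measure set T2 -> \bar R}).
Variables (A1 : set T1) (A2 : set T2) (f : T1 -> T2 -> R) (B : R).
Hypotheses (mA1 : measurable A1) (mA2 : measurable A2).
Hypotheses (fA1 : (m1 A1 < +oo)%E) (fA2 : (m2 A2 < +oo)%E).
Hypothesis mf : measurable_fun [set: T1 * T2] (fun p => f p.1 p.2).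
Hypothesis Bf : forall x y, A1 x -> A2 y -> `|f x y| <= B.

Lemma fubini_rect :
  (\int[m1]_(x in A1) \int[m2]_(y in A2) (f x y)%:E = \int[m2]_(y in A2) \int[m1]_(x in A1) (f x y)%:E)%E.
Proof.
have mA : measurable (A1 `*` A2) by apply: measurableX.
have iA : (m1 \x m2)%E.-integrable (A1 `*` A2) (EFin \o (fun p => f p.1 p.2)).
  apply: measurable_bounded_integrable => //.
  - have E : (m1 \x m2)%E (A1 `*` A2) = (m1 A1 * m2 A2)%E by exact: product_measure1E.
    apply: (@le_lt_trans _ _ (m1 A1 * m2 A2)%E); first by rewrite -E.
    by apply: lte_mul_pinfty; rewrite ?ge0_fin_numE.
  - exact: measurable_funTS.
  - exists B; split; first exact: num_real.
    move=> B' BB' [x y] [/= xA yA]; apply: (le_trans _ (ltW BB')); exact: Bf.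
have iT := proj1 (integrable_mkcond _ mA) iA.
have Fub := Fubini iT.
pose g := (EFin \o (fun p : T1 * T2 => f p.1 p.2)) \_ (A1 `*` A2).
have gE x y : g (x, y) = if (x \in A1) && (y \in A2) then (f x y)%:E else 0%E.
  by rewrite /g patchE in_setX.
rewrite -/g in Fub.
transitivity (\int[m1]_x \int[m2]_y g (x, y))%E.
  rewrite [LHS]integral_mkcond; apply: eq_integral => x _; rewrite patchE.
  case: ifPn => xA; last by apply/esym; apply: integral0_eq => y _; rewrite gE (negbTE xA).
  by rewrite [LHS]integral_mkcond; apply: eq_integral => y _; rewrite gE xA patchE.
rewrite Fub [RHS]integral_mkcond; apply: eq_integral => y _; rewrite patchE.
case: ifPn => yA; last by apply: integral0_eq => x _; rewrite gE (negbTE yA) andbF.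
by rewrite [RHS]integral_mkcond; apply: eq_integral => x _; rewrite gE yA andbT patchE.
Qed.

End FubiniRectangle.

Lemma le_integral_EFin d (T : measurableType d) (R : realType) (m : {measure set T -> \bar R})
  (D : set T) (f g : T -> R) : measurable D -> measurable_fun D f -> measurable_fun D g ->
  (forall x, D x -> 0 <= f x) -> (forall x, D x -> f x <= g x) ->
  (\int[m]_(x in D) (f x)%:E <= \int[m]_(x in D) (g x)%:E)%E.
Proof.
move=> mD mf mg f0 fg; apply: ge0_le_integral => //.
- by apply/measurable_EFinP.
- by apply/measurable_EFinP.
Qed.

Lemma le_abs_integral_EFin d (T : measurableType d) (R : realType) (m : {measure set T -> \bar R})
  (D : set T) (f g : T -> R) : measurable D -> measurable_fun D f -> measurable_fun D g ->
  (forall x, D x -> `|f x| <= g x) ->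
  (\int[m]_(x in D) (f x)%:E <= \int[m]_(x in D) (g x)%:E)%E.
Proof.
move=> mD mf mg fg; apply: (le_trans (lee_abs _)); apply: (le_trans (le_abse_integral _ mD _)).
  by apply/measurable_EFinP.
by apply: le_integral_EFin => //; apply: measurableT_comp.
Qed.

Lemma measurable_quotB d (T : measurableType d) (R : realType) (D : set T) (f g h : T -> R) :
  measurable_fun D f -> measurable_fun D g -> measurable_fun D h ->
  measurable_fun D (fun x => (f x - g x) * h x).
Proof. by move=> mf mg mh; apply: measurable_funM => //; apply: measurable_funB. Qed.

Lemma measurable_quotD d (T : measurableType d) (R : realType) (D : set T) (f g h : T -> R) :
  measurable_fun D f -> measurable_fun D g -> measurable_fun D h ->
  measurable_fun D (fun x => (`|f x| + `|g x|) * h x).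
Proof. by move=> mf mg mh; apply: measurable_funM => //; apply: measurable_funD; exact: measurableT_comp. Qed.

Lemma norm_quotB_le (R : realType) (u v r : R) : 0 < r -> `|(u - v) / r| <= (`|v| + `|u|) / r.
Proof.
move=> r0; rewrite normrM normfV (gtr0_norm r0) ler_wpM2r ?invr_ge0 ?(ltW r0) //.
by rewrite addrC (le_trans (ler_normD _ _)) ?normrN.
Qed.

(** * Integration of a rational function over a half disc *)

Section Polar.
Variable R : realType.
Local Notation C := R[i].
Local Notation toC := (real_complex R).
Local Notation Re := (@complex.Re R).
Local Notation Im := (@complex.Im R).
Local Notation mu := (@lebesgue_measure R).
Variables (N P : {poly C}) (gam : C) (a Ro V del : R).
Hypothesis Ro0 : 0 < Ro.
Hypothesis del0 : 0 < del.
Hypothesis Pdel : forall z : C, 0 <= Im z -> del <= normc P.[z].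

Definition ratH (z : C) : C := gam * (N.[z] * (P.[z])^-1).
Definition dratH (z : C) : C :=
  gam * ((N^`()).[z] * (P.[z])^-1 - N.[z] * ((P^`()).[z] * ((P.[z])^-1 * (P.[z])^-1))).
Definition unitC (th : R) : C := Complex (cos th) (sin th).
Definition polarC (r th : R) : C := Complex (a + r * cos th) (r * sin th).

Lemma polarCE r th : polarC r th = toC a + toC r * unitC th.
Proof. by apply/eqP; rewrite eq_complex /=; apply/andP; split; apply/eqP; ring. Qed.

Lemma cderiv_ratH (g : R -> C) x d : P.[g x] != 0 -> cderiv g x d ->
  cderiv (fun s => ratH (g s)) x (dratH (g x) * d).
Proof.
move=> P0 Hg; have HV := cderivV P0 (cderiv_poly P Hg).
apply: cderiv_eq (cderivM (cderiv_cst gam x) (cderivM (cderiv_poly N Hg) HV)) _.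
by rewrite /dratH; ring.
Qed.

Lemma ex_cderiv_dratH (g : R -> C) x d : P.[g x] != 0 -> cderiv g x d ->
  exists e, cderiv (fun s => dratH (g s)) x e.
Proof.
move=> P0 Hg; have HV := cderivV P0 (cderiv_poly P Hg).
eexists; apply: cderiv_ext (cderivM (cderiv_cst gam x)
  (cderivD (cderivM (cderiv_poly N^`() Hg) HV)
    (cderivM (cderiv_cst (-1) x) (cderivM (cderiv_poly N Hg) (cderivM (cderiv_poly P^`() Hg) (cderivM HV HV)))))).
by move=> s; rewrite /dratH mulN1r.
Qed.

Lemma cderiv_unitC th : cderiv unitC th (Complex (- sin th) (cos th)).
Proof. by split; [apply: is_derive_cos|apply: is_derive_sin]. Qed.

Lemma cderiv_real x : cderiv toC x 1.
Proof. by split; [apply: is_derive_id|apply: is_derive_cst]. Qed.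

Lemma cderiv_polar_r r th : cderiv (polarC^~ th) r (unitC th).
Proof.
apply: cderiv_ext (cderiv_eq (cderivD (cderiv_cst (toC a) r) (cderivM (cderiv_real r) (cderiv_cst (unitC th) r))) _).
  by move=> s; rewrite polarCE.
by ring.
Qed.

Lemma cderiv_polar_th r th : cderiv (polarC r) th (toC r * Complex (- sin th) (cos th)).
Proof.
apply: cderiv_ext (cderiv_eq (cderivD (cderiv_cst (toC a) th) (cderivM (cderiv_cst (toC r) th) (cderiv_unitC th))) _).
  by move=> s; rewrite polarCE.
by ring.
Qed.

Lemma Im_polar_ge0 r th : 0 <= r -> 0 <= th <= pi -> 0 <= Im (polarC r th).
Proof. by move=> r0 th0; rewrite /= mulr_ge0 // sin_ge0_pi. Qed.

Lemma P_neq0 z : 0 <= Im z -> P.[z] != 0.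
Proof. by move=> /Pdel h; rewrite -nc_gt0; apply: lt_le_trans h. Qed.

(** By the Cauchy-Riemann equations this is both [- d/dr] of [Im H] and [1/r] times [d/dth] of
    [Re H], so its integral is explicit in either variable. *)
Definition polarD (r th : R) : R := - Im (dratH (polarC r th) * unitC th).

Lemma int_polar_r th : 0 <= th <= pi ->
  (\int[mu]_(r in `[0%R, Ro]) (polarD r th)%:E = (Im (ratH (toC a)) - Im (ratH (polarC Ro th)))%:E)%E.
Proof.
move=> th0; pose F r := - Im (ratH (polarC r th)).
have nz (r : R) : r \in `[0%R, Ro] -> P.[polarC r th] != 0.
  by rewrite in_itv /= => /andP[r0 _]; apply: P_neq0; apply: Im_polar_ge0.
transitivity ((F Ro - F 0)%:E); last first.
  congr (_%:E); rewrite /F; have -> : polarC 0 th = toC a by rewrite polarCE mul0r addr0.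
  by ring.
apply: (ftc_closed Ro0).
- move=> r /nz P0; have [_ di] := cderiv_ratH (g := polarC^~ th) P0 (cderiv_polar_r r th).
  exact: rderivN di.
- move=> r /nz P0; have [e He] := ex_cderiv_dratH (g := polarC^~ th) P0 (cderiv_polar_r r th).
  have [_ ci] := cderiv_cont (cderivM He (cderiv_cst (unitC th) r)).
  exact: (continuousN ci).
Qed.

Lemma int_polar_th r : 0 < r ->
  (\int[mu]_(th in `[0%R, pi]) (polarD r th)%:E = ((Re (ratH (toC (a - r))) - Re (ratH (toC (a + r)))) / r)%:E)%E.
Proof.
move=> r0; pose F th := r^-1 * Re (ratH (polarC r th)).
have nz (th : R) : th \in `[0%R, pi] -> P.[polarC r th] != 0.
  by rewrite in_itv /= => th0; apply: P_neq0; apply: Im_polar_ge0 => //; apply: ltW.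
transitivity ((F pi - F 0)%:E); last first.
  congr (_%:E); rewrite /F.
  have -> : polarC r 0 = toC (a + r) by rewrite /polarC cos0 sin0 mulr1 mulr0.
  have -> : polarC r pi = toC (a - r) by rewrite /polarC cospi sinpi mulrN1 mulr0.
  by ring.
apply: (ftc_closed (pi_gt0 R)).
- move=> th /nz P0; have [dr _] := cderiv_ratH P0 (cderiv_polar_th r th).
  apply: rderiv_eq (rderivM (is_derive_cst (r^-1) th 1) dr) _.
  rewrite /polarD /unitC mulr0 addr0; case: (dratH _) => u v /=; field.
  by rewrite gt_eqF.
- move=> th /nz P0; have [e He] := ex_cderiv_dratH P0 (cderiv_polar_th r th).
  have [_ ci] := cderiv_cont (cderivM He (cderiv_unitC th)).
  exact: (continuousN ci).
Qed.

Lemma cmeas_unitC d (T : measurableType d) (D : set T) (f : T -> R) :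
  measurable_fun D f -> cmeas D (fun p => unitC (f p)).
Proof.
move=> mf; split.
  apply: (measurableT_comp (f := @cos R)) => //; apply: continuous_measurable_fun; exact: continuous_cos.
apply: (measurableT_comp (f := @sin R)) => //; apply: continuous_measurable_fun; exact: continuous_sin.
Qed.

Lemma cmeas_ratH d (T : measurableType d) (D : set T) (g : T -> C) :
  cmeas D g -> cmeas D (fun p => ratH (g p)).
Proof.
move=> mg; apply: cmeasM; first exact: cmeas_cst.
by apply: cmeasM; [|apply: cmeasV]; apply: cmeas_poly.
Qed.

Lemma measurable_polarD : measurable_fun [set: R * R] (fun p => polarD p.1 p.2).
Proof.
have m1 : measurable_fun [set: R * R] (@fst R R) by exact: measurable_fst.
have m2 : measurable_fun [set: R * R] (@snd R R) by exact: measurable_snd.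
have mu2 := cmeas_unitC m2.
have mz : cmeas [set: R * R] (fun p => polarC p.1 p.2).
  apply: (cmeas_ext (g := fun p => toC a + toC p.1 * unitC p.2)); first by move=> p; rewrite polarCE.
  by apply: cmeasD; [apply: cmeas_cst|apply: cmeasM => //; apply: cmeas_real].
have mV := cmeasV (cmeas_poly P mz).
have mdr : cmeas [set: R * R] (fun p => dratH (polarC p.1 p.2)).
  apply: cmeas_ext (cmeasM (cmeas_cst _ gam) (cmeasD (cmeasM (cmeas_poly N^`() mz) mV)
   (cmeasM (cmeas_cst _ (-1)) (cmeasM (cmeas_poly N mz) (cmeasM (cmeas_poly P^`() mz) (cmeasM mV mV)))))).
  by move=> p; rewrite /dratH mulN1r.
have [_ mi] := cmeasM mdr mu2.
exact: measurable_funN.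
Qed.

Lemma nc_poly_bound (p : {poly C}) (rho : R) z : normc z <= rho ->
  normc p.[z] <= \sum_(i < size p) normc p`_i * rho ^+ i.
Proof.
move=> zr; rewrite horner_coef; apply: (le_trans (nc_sum _ _ _)); apply: ler_sum => i _.
rewrite ncM ncX ler_wpM2l ?normc_ge0 //; apply: lerXn2r; rewrite ?nnegrE ?normc_ge0 //.
exact: le_trans (normc_ge0 _) zr.
Qed.

Lemma nc_unitC th : normc (unitC th) = 1.
Proof. by rewrite /normc /= cos2Dsin2 sqrtr1. Qed.

(** Justifies the exchange of integrals. The bound may deteriorate with [del], which does not enter
    the final estimate. *)
Lemma polarD_bounded : exists B, forall r th, 0 <= r <= Ro -> 0 <= th <= pi -> `|polarD r th| <= B.
Proof.
pose rho := `|a| + Ro.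
pose b (p : {poly C}) := \sum_(i < size p) normc p`_i * rho ^+ i.
have rho0 : 0 <= rho by rewrite addr_ge0 // ltW.
have b0 p : 0 <= b p by apply: sumr_ge0 => i _; rewrite mulr_ge0 ?normc_ge0 ?exprn_ge0.
exists (normc gam * (b N^`() * del^-1 + b N * (b P^`() * (del^-1 * del^-1)))) => r th /andP[r0 rR] th0.
rewrite normrN; apply: (le_trans (Im_le_nc _)); rewrite ncM nc_unitC mulr1 /dratH ncM.
have zr : normc (polarC r th) <= rho.
  rewrite polarCE; apply: (le_trans (ncD _ _)); rewrite ncM nc_unitC mulr1 !nc_real.
  by rewrite lerD2l ger0_norm.
have HV : normc (P.[polarC r th])^-1 <= del^-1.
  have h := Pdel (Im_polar_ge0 r0 th0).
  by rewrite normcV lef_pV2 ?posrE // (lt_le_trans del0).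
rewrite ler_wpM2l ?normc_ge0 //; apply: (le_trans (ncB _ _)); apply: lerD.
  by rewrite ncM; apply: ler_pM; rewrite ?normc_ge0 // nc_poly_bound.
rewrite !ncM; apply: ler_pM; rewrite ?mulr_ge0 ?normc_ge0 ?nc_poly_bound //.
apply: ler_pM; rewrite ?mulr_ge0 ?normc_ge0 ?nc_poly_bound //.
by apply: ler_pM; rewrite ?normc_ge0.
Qed.

Hypothesis HV : forall th, 0 <= th <= pi -> normc (ratH (polarC Ro th)) <= V.

(** [polarD] is integrated over the half disc in both orders. Radially it gives the value at the
    center minus the value on the arc; along the arcs it gives differences of [Re H] at [a - r] and
    [a + r], divided by [r]. *)
Lemma polar_estimate : ((pi * (Im (ratH (toC a)) - V))%:E <=
  \int[mu]_(r in `]0%R, Ro]) ((`|Re (ratH (toC (a + r)))| + `|Re (ratH (toC (a - r)))|) / r)%:E)%E.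
Proof.
set g := fun r : R => EFin _.
have g0 r : r \in `]0%R, Ro] -> (0 <= g r)%E.
  rewrite in_itv /= => /andP[r0 _].
  by rewrite /g lee_fin divr_ge0 // ?addr_ge0 // ltW.
have V0 : 0 <= V.
  apply: le_trans (HV (th := 0) _); first exact: normc_ge0.
  by rewrite lexx pi_ge0.
set c := Im (ratH (toC a)).
(* If [c <= V] the left-hand side is not positive. Otherwise [c - V] is a positive minorant, which
   the comparison of integrals below requires. *)
have [cV|Vc] := leP c V.
  apply: (@le_trans _ _ 0%E); first by rewrite lee_fin mulr_ge0_le0 ?pi_ge0 // subr_le0.
  by apply: integral_ge0 => r /= rI; apply: g0.
have Fub := @fubini_rect _ _ _ _ R mu mu `]0%R, Ro]%classic `[0%R, pi]%classic polarD.
have [B HB] := polarD_bounded.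
have mI (i : interval R) : measurable [set` i] by exact: measurable_itv.
have Fub' : (\int[mu]_(r in `]0%R, Ro]) \int[mu]_(th in `[0%R, pi]) (polarD r th)%:E =
             \int[mu]_(th in `[0%R, pi]) \int[mu]_(r in `]0%R, Ro]) (polarD r th)%:E)%E.
  apply: (Fub B (mI _) (mI _)).
  - by rewrite /= lebesgue_measure_itv /= lte_fin Ro0 -EFinB ltry.
  - by rewrite /= lebesgue_measure_itv /= lte_fin pi_gt0 -EFinB ltry.
  - exact measurable_polarD.
  - move=> r th /=; rewrite !in_itv /= => /andP[r0 rR] th0; apply: HB => //.
    by rewrite (ltW r0).
have E2 : (\int[mu]_(th in `[0%R, pi]) \int[mu]_(r in `]0%R, Ro]) (polarD r th)%:E =
   \int[mu]_(th in `[0%R, pi]) (c - Im (ratH (polarC Ro th)))%:E)%E.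
  apply: eq_integral => th; rewrite inE /= => thI.
  have th0 : 0 <= th <= pi by move: thI; rewrite in_itv.
  transitivity (\int[mu]_(r in `[0%R, Ro]) (polarD r th)%:E)%E; last exact: int_polar_r.
  apply: integral_itv_obnd_cbnd.
  apply/measurable_EFinP; apply: measurable_funTS.
  exact: (measurableT_comp measurable_polarD (measurable_pair2 th)).
have E1 : (\int[mu]_(r in `]0%R, Ro]) \int[mu]_(th in `[0%R, pi]) (polarD r th)%:E =
   \int[mu]_(r in `]0%R, Ro]) ((Re (ratH (toC (a - r))) - Re (ratH (toC (a + r)))) / r)%:E)%E.
  apply: eq_integral => r; rewrite inE /= => rI; apply: int_polar_th.
  by move: rI; rewrite in_itv => /andP[].
have H1 : ((pi * (c - V))%:E <= \int[mu]_(th in `[0%R, pi]) (c - Im (ratH (polarC Ro th)))%:E)%E.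
  apply: (@le_trans _ _ (\int[mu]_(th in `[0%R, pi]) (c - V)%:E)%E).
    rewrite integral_cst; last exact: measurable_itv.
    by rewrite /= lebesgue_measure_itv /= lte_fin pi_gt0 -EFinB -EFinM subr0 mulrC.
  apply: le_integral_EFin.
  - exact: measurable_itv.
  - exact: measurable_cst.
  - apply: measurable_funB; first exact: measurable_cst.
    have mpo : cmeas `[0%R, pi] (polarC Ro).
      apply: (cmeas_ext (g := fun th => toC a + toC Ro * unitC th)); first by move=> p; rewrite polarCE.
      apply: cmeasD; first exact: cmeas_cst.
      by apply: cmeasM; [apply: cmeas_cst|apply: cmeas_unitC; apply: measurable_id].
    exact (proj2 (cmeas_ratH mpo)).
  - by move=> th _; rewrite subr_ge0 ltW.
  - move=> th thI; rewrite lerD2l lerN2; apply: (le_trans (ler_norm _)).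
    by apply: (le_trans (Im_le_nc _)); apply: HV; move: thI; rewrite /= in_itv.
apply: (le_trans H1); rewrite -E2 -Fub' E1.
have mreal (s : R -> R) : measurable_fun `]0%R, Ro] s -> measurable_fun `]0%R, Ro] (fun r => Re (ratH (toC (s r)))).
  move=> ms; exact (proj1 (cmeas_ratH (cmeas_real ms))).
have mp : measurable_fun `]0%R, Ro] (fun r => Re (ratH (toC (a + r)))).
  by apply: (mreal (fun r => a + r)); apply: measurable_funD; [exact: measurable_cst|exact: measurable_id].
have mm : measurable_fun `]0%R, Ro] (fun r => Re (ratH (toC (a - r)))).
  by apply: (mreal (fun r => a - r)); apply: measurable_funB; [exact: measurable_cst|exact: measurable_id].
have minv : measurable_fun `]0%R, Ro] (fun r : R => r^-1).
  by apply: measurable_funTS; exact: measurable_inv.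
apply: le_abs_integral_EFin.
- exact: measurable_itv.
- exact (measurable_quotB mm mp minv).
- exact (measurable_quotD mp mm minv).
move=> r; rewrite /= in_itv /= => /andP[r0 _]; exact (norm_quotB_le _ _ r0).
Qed.

End Polar.

(** * Lower bound for the fiber integral *)

Section IntegralEFin.
Context d (T : measurableType d) (R : realType).
Variables (m : {measure set T -> \bar R}) (D : set T).
Hypothesis mD : measurable D.
Implicit Types f g : T -> R.

Lemma ge0_integralD_real f g : measurable_fun D f -> measurable_fun D g ->
  (forall x, D x -> 0 <= f x) -> (forall x, D x -> 0 <= g x) ->
  (\int[m]_(x in D) (f x + g x)%:E = \int[m]_(x in D) (f x)%:E + \int[m]_(x in D) (g x)%:E)%E.
Proof.
move=> mf mg f0 g0; rewrite -ge0_integralD //.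
- by apply/measurable_EFinP.
- by apply/measurable_EFinP.
Qed.

Lemma ge0_integralZ_real f k : measurable_fun D f -> (forall x, D x -> 0 <= f x) -> 0 <= k ->
  (\int[m]_(x in D) (k * f x)%:E = k%:E * \int[m]_(x in D) (f x)%:E)%E.
Proof.
move=> mf f0 k0; rewrite -ge0_integralZl_EFin //.
by apply/measurable_EFinP.
Qed.

Lemma integral_sum_EFin (M : nat) (F : 'I_M -> T -> R) : (forall k, measurable_fun D (F k)) ->
  (forall k x, D x -> 0 <= F k x) ->
  (\int[m]_(x in D) (\sum_k F k x)%:E = \sum_k \int[m]_(x in D) (F k x)%:E)%E.
Proof.
move=> mF F0; rewrite -ge0_integral_sum //.
- by apply: eq_integral => x _; rewrite -sumEFin.
- by move=> k; apply/measurable_EFinP.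
Qed.

Lemma subset_integral_EFin (A : set T) f : measurable A -> A `<=` D -> measurable_fun D f ->
  (forall x, D x -> 0 <= f x) ->
  (\int[m]_(x in A) (f x)%:E <= \int[m]_(x in D) (f x)%:E)%E.
Proof.
move=> mA AD mf f0; apply: ge0_subset_integral => //.
by apply/measurable_EFinP.
Qed.

End IntegralEFin.

(** * Translated and reflected integrals *)

Section Shift.
Variable R : realType.
Local Notation mu := (@lebesgue_measure R).

Lemma subset_itv_ccoo (u v c d : R) : c < u -> v < d -> `[u, v]%classic `<=` `]c, d[%classic.
Proof.
move=> cu vd y /=; rewrite !in_itv /= => /andP[y1 y2].
by rewrite (lt_le_trans cu y1) (le_lt_trans y2 vd).
Qed.

Lemma continuous_measurable (G : R -> R) (D : set R) : continuous G -> measurable_fun D G.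
Proof. by move=> cG; apply: measurable_funTS; apply: continuous_measurable_fun. Qed.

Lemma integral_shift_le (G : R -> R) (a Ro e : R) : 0 < Ro -> Ro < e - `|a| ->
  continuous G -> (forall y, 0 <= G y) ->
  (\int[mu]_(r in `]0%R, Ro]) (G (a + r))%:E <= \int[mu]_(y in `](- e)%R, e[) (G y)%:E)%E.
Proof.
move=> R0 Re cG G0.
have := ler_norm a; have := ler_norm (- a); rewrite normrN => h1 h2.
have D1 : (fun r : R => a + r : R)^`()%classic = cst 1.
  apply/funext => z; rewrite derive1E; have := rderivD (is_derive_cst a z 1) (is_derive_id z (1 : R)).
  by move=> [_ ->]; rewrite add0r.
have cS : continuous (fun r : R => a + r).
  by move=> r; apply: continuousD; [exact: cst_continuous|exact: cvg_id].
apply: (@le_trans _ _ (\int[mu]_(r in `[0%R, Ro]) (G (a + r))%:E)%E).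
  apply: subset_integral_EFin.
  - exact: measurable_itv.
  - exact: measurable_itv.
  - exact: subset_itv_oc_cc.
  - apply: continuous_measurable.
    by move=> r; apply: continuous_comp; [exact: cS|exact: cG].
  - by move=> y _; apply: G0.
have -> : (\int[mu]_(r in `[0%R, Ro]) (G (a + r))%:E = \int[mu]_(y in `[(a + 0)%R, (a + Ro)%R]) (G y)%:E)%E.
  rewrite (@integration_by_substitution_increasing _ (fun r => a + r) G).
  - by apply: eq_integral => r _; rewrite D1 /= mulr1.
  - exact: ltW.
  - by move=> x y _ _ xy; rewrite ltrD2l.
  - by rewrite D1 => x _; apply: cst_continuous.
  - by rewrite D1; apply: is_cvg_cst.
  - by rewrite D1; apply: is_cvg_cst.
  - split.
    + by move=> x _; apply: derivableD; [exact: derivable_cst|exact: derivable_id].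
    + by apply: cvg_at_right_filter; apply: cS.
    + by apply: cvg_at_left_filter; apply: cS.
  - exact: continuous_subspaceT.
apply: subset_integral_EFin.
- exact: measurable_itv.
- exact: measurable_itv.
- by apply: subset_itv_ccoo; lra.
- exact (continuous_measurable cG).
- by move=> y _; exact (G0 y).
Qed.

Lemma integral_reflect_le (G : R -> R) (a Ro e : R) : 0 < Ro -> Ro < e - `|a| ->
  continuous G -> (forall y, 0 <= G y) ->
  (\int[mu]_(r in `]0%R, Ro]) (G (a - r))%:E <= \int[mu]_(y in `](- e)%R, e[) (G y)%:E)%E.
Proof.
move=> R0 Re cG G0.
have := ler_norm a; have := ler_norm (- a); rewrite normrN => h1 h2.
have D1 : (fun r : R => a - r : R)^`()%classic = cst (-1).
  apply/funext => z; rewrite derive1E; have := rderivB (is_derive_cst a z 1) (is_derive_id z (1 : R)).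
  by move=> [_ ->]; rewrite sub0r.
have cS : continuous (fun r : R => a - r).
  by move=> r; apply: continuousB; [exact: cst_continuous|exact: cvg_id].
apply: (@le_trans _ _ (\int[mu]_(r in `[0%R, Ro]) (G (a - r))%:E)%E).
  apply: subset_integral_EFin.
  - exact: measurable_itv.
  - exact: measurable_itv.
  - exact: subset_itv_oc_cc.
  - apply: continuous_measurable.
    by move=> r; apply: continuous_comp; [exact: cS|exact: cG].
  - by move=> y _; apply: G0.
have -> : (\int[mu]_(r in `[0%R, Ro]) (G (a - r))%:E = \int[mu]_(y in `[(a - Ro)%R, (a - 0)%R]) (G y)%:E)%E.
  rewrite (@integration_by_substitution_decreasing _ (fun r => a - r) G).
  - by apply: eq_integral => r _; rewrite D1 /= opprK mulr1.
  - exact: ltW.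
  - by move=> x y _ _ xy; rewrite ltrD2l ltrN2.
  - by rewrite D1 => x _; apply: cst_continuous.
  - by rewrite D1; apply: is_cvg_cst.
  - by rewrite D1; apply: is_cvg_cst.
  - split.
    + by move=> x _; apply: derivableB; [exact: derivable_cst|exact: derivable_id].
    + by apply: cvg_at_right_filter; apply: cS.
    + by apply: cvg_at_left_filter; apply: cS.
  - exact: continuous_subspaceT.
apply: subset_integral_EFin.
- exact: measurable_itv.
- exact: measurable_itv.
- by apply: subset_itv_ccoo; lra.
- exact (continuous_measurable cG).
- by move=> y _; exact (G0 y).
Qed.

End Shift.

(** * The sum of Poisson kernels *)

Section Phi.
Variable R : realType.
Local Notation C := R[i].
Local Notation toC := (real_complex R).
Local Notation Re := (@complex.Re R).
Local Notation Im := (@complex.Im R).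
Local Notation mu := (@lebesgue_measure R).
Variables (M : nat) (q eta : 'I_M -> R).
Hypothesis eta0 : forall k, 0 < eta k.

Definition phi1 k (y : R) : R := eta k / ((y + q k) ^+ 2 + eta k ^+ 2).
Definition phi (y : R) : R := \sum_k phi1 k y.

Lemma phi1_den k y : 0 < (y + q k) ^+ 2 + eta k ^+ 2.
Proof. by rewrite ltr_wpDl ?sqr_ge0 ?exprn_gt0. Qed.

Lemma phi1_ge0 k y : 0 <= phi1 k y.
Proof. by rewrite divr_ge0 ?(ltW (eta0 k)) // ltW // phi1_den. Qed.

Lemma phi_ge0 y : 0 <= phi y.
Proof. by apply: sumr_ge0 => k _; apply: phi1_ge0. Qed.

Lemma sqnorm_fibP_gt0 y : 0 < sqnormC (fibP q eta).[toC y].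
Proof. by rewrite sqnorm_fibP; apply: prodr_gt0 => k _; apply: phi1_den. Qed.

Lemma fibK_phi y : fibK q eta y = phi y * sqnormC (fibP q eta).[toC y].
Proof.
rewrite /fibK /phi mulr_suml sqnorm_fibP; apply: eq_bigr => k _.
rewrite [in RHS](bigD1 k) //= /phi1 mulrA divfK //.
by rewrite gt_eqF // phi1_den.
Qed.

Lemma continuous_sqnormC (g : R -> C) : (forall y, exists d, cderiv g y d) ->
  continuous (fun y => sqnormC (g y)).
Proof.
move=> Hg y; have [d Hd] := Hg y; have [cr ci] := cderiv_cont Hd.
exact: (continuousD (continuousM cr cr) (continuousM ci ci)).
Qed.

Lemma derive_phi1 k (y : R) : is_derive y (1 : R) (fun y => atan ((y + q k) / eta k)) (phi1 k y).
Proof.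
have d1 : is_derive y (1 : R) (fun y => (y + q k) / eta k) (eta k)^-1.
  apply: is_derive_eq.
  by rewrite scaler0 add0r addr0 /GRing.scale /= mulr1.
have d2 := is_derive1_comp (f := @atan R) (g := fun y => (y + q k) / eta k) _ d1.
apply: is_derive_eq; rewrite /phi1.
have := phi1_den k y; have := eta0 k => h1 h2.
have n1 : eta k != 0 by rewrite gt_eqF.
field; rewrite n1 /= andbT.
by rewrite gt_eqF // addrC.
Qed.

Lemma continuous_phi1 k : continuous (phi1 k).
Proof.
move=> y.
have d1 : derivable (phi1 k) y 1.
  have d2 : is_derive y (1 : R) (fun y => (y + q k) ^+ 2 + eta k ^+ 2) _ := is_deriveD _ _.
  apply: derivableM; first exact: derivable_cst.
  apply: derivableV; first by rewrite gt_eqF // phi1_den.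
  by have [] := d2.
by apply: differentiable_continuous; apply/derivable1_diffP.
Qed.

Lemma continuous_phi : continuous phi.
Proof.
rewrite /phi; elim: (index_enum _) => [|k s IH].
  under eq_fun do rewrite big_nil; exact: cst_continuous.
under eq_fun do rewrite big_cons.
move=> y; apply: continuousD; [exact: continuous_phi1|exact: IH].
Qed.

(** Each kernel has an arctangent as primitive, so its integral is at most [pi] whatever [q] and
    [eta]; this keeps the constants uniform as [eta] tends to [0]. *)
Lemma integral_phi_le e : 0 < e ->
  (\int[mu]_(y in `](- e)%R, e[) (phi y)%:E <= (M%:R * pi)%:E)%E.
Proof.
move=> e0.
have mphi k : measurable_fun `](- e), e[ (phi1 k).
  by apply: measurable_funTS; apply: continuous_measurable_fun; apply: continuous_phi1.
rewrite integral_sum_EFin.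
- apply: (@le_trans _ _ (\sum_(k < M) pi%:E)%E); last first.
    by rewrite sumEFin lee_fin sumr_const card_ord mulr_natl.
  apply: lee_sum => k _.
  apply: (@le_trans _ _ (\int[mu]_(y in `[(- e)%R, e]) (phi1 k y)%:E)%E).
    apply: subset_integral_EFin.
    - exact: measurable_itv.
    - exact: measurable_itv.
    - exact: subset_itv_oo_cc.
    - by apply: measurable_funTS; apply: continuous_measurable_fun; apply: continuous_phi1.
    - by move=> y _; apply: phi1_ge0.
  have E : (\int[mu]_(y in `[(- e)%R, e]) (phi1 k y)%:E = (atan ((e + q k) / eta k) - atan ((- e + q k) / eta k))%:E)%E.
    apply: (ftc_closed (F := fun y => atan ((y + q k) / eta k))).
    - by lra.
    - by move=> y _; apply: derive_phi1.
    - by move=> y _; apply: continuous_phi1.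
  rewrite E lee_fin.
  have := atan_ltpi2 ((e + q k) / eta k); have := atan_gtNpi2 ((- e + q k) / eta k).
  lra.
- exact: measurable_itv.
- exact: mphi.
- by move=> k y _; apply: phi1_ge0.
Qed.

End Phi.

(** The arithmetic-geometric inequality with a free weight [lam], applied pointwise. Integrating it
    and choosing [lam] in [optimize_lam] takes the place of Cauchy-Schwarz for integrals. *)
Lemma amgm_quot (R : realType) (n F p lam be ph : R) : 0 < lam -> 0 < be -> 0 < p ->
  be * F ^+ 2 <= ph * p ->
  `|n * F| / (2 * p) <= 4^-1 * (lam * (n ^+ 2 / p) + ph / (lam * be)).
Proof.
move=> l0 b0 p0 H.
have -> : 4^-1 * (lam * (n ^+ 2 / p) + ph / (lam * be)) =
  (lam * n ^+ 2 + lam^-1 * (ph * p / be)) / 2 / (2 * p) by field; rewrite !gt_eqF.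
rewrite ler_wpM2r ?invr_ge0 ?mulr_ge0 ?(ltW p0) // ler_pdivlMr //.
have H2 : lam^-1 * F ^+ 2 <= lam^-1 * (ph * p / be).
  by rewrite ler_wpM2l ?invr_ge0 ?(ltW l0) // ler_pdivlMr // mulrC.
rewrite -lerBlDl; apply: le_trans H2.
have -> : lam^-1 * F ^+ 2 = lam^-1 * `|F| ^+ 2 by rewrite real_normK ?num_real.
have -> : n ^+ 2 = `|n| ^+ 2 by rewrite real_normK ?num_real.
rewrite normrM -subr_ge0.
have -> : lam^-1 * `|F| ^+ 2 - (`|n| * `|F| * 2 - lam * `|n| ^+ 2) = lam^-1 * (lam * `|n| - `|F|) ^+ 2 by field; rewrite gt_eqF.
by rewrite mulr_ge0 ?sqr_ge0 // invr_ge0 ltW.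
Qed.

Lemma quotD_ge0 (R : realType) (u v r : R) : 0 < r -> 0 <= (`|u| + `|v|) / r.
Proof. by move=> r0; rewrite divr_ge0 ?addr_ge0 // ltW. Qed.

Lemma optimize_lam (R : realType) (be al m p W V Jr : R) : 0 < be -> 0 < al -> 0 < m -> 0 < p -> 0 < W ->
  (forall lam, 0 < lam -> p * (al * W - V) <= 2^-1 * lam * Jr + 2^-1 * (m * p / (lam * be))) ->
  be * W ^+ 2 <= 4 * V ^+ 2 / al ^+ 2 * be + 2 * m / (p * al ^+ 2) * Jr.
Proof.
move=> be0 al0 m0 p0 W0 H.
have nz : [/\ be != 0, al != 0, m != 0, p != 0 & W != 0] by split; rewrite gt_eqF.
case: nz => n1 n2 n3 n4 n5.
(* This [lam] makes the last term exactly half of [p * al * W], which is then absorbed on the left.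
   The term with [V] is absorbed in [H3] by completing a square. *)
have /H : 0 < m / (al * be * W) by rewrite divr_gt0 ?mulr_gt0.
have -> : 2^-1 * (m / (al * be * W)) * Jr + 2^-1 * (m * p / (m / (al * be * W) * be)) =
  2^-1 * (m / (al * be * W)) * Jr + 2^-1 * p * al * W.
  by congr (_ + _); field; rewrite n1 n2 n3 n5.
move=> H1.
have H2 : be * W ^+ 2 <= 2 * V / al * be * W + m / (p * al ^+ 2) * Jr.
  have := ler_wpM2l (_ : 0 <= 2 * be * W / (p * al)) H1.
  have -> : 2 * be * W / (p * al) * (p * (al * W - V)) = 2 * be * W ^+ 2 - 2 * V / al * be * W by field; rewrite n2 n4.
  have -> : 2 * be * W / (p * al) * (2^-1 * (m / (al * be * W)) * Jr + 2^-1 * p * al * W) =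
    m / (p * al ^+ 2) * Jr + be * W ^+ 2 by field; rewrite n1 n2 n4 n5.
  move=> h; have : 0 <= 2 * be * W / (p * al) by rewrite divr_ge0 ?mulr_ge0 ?(ltW be0) ?(ltW W0) ?(ltW p0) ?(ltW al0).
  by move=> /h; lra.
have H3 : 2 * (2 * V / al * be * W) <= be * W ^+ 2 + 4 * V ^+ 2 / al ^+ 2 * be.
  rewrite -subr_ge0.
  have -> : be * W ^+ 2 + 4 * V ^+ 2 / al ^+ 2 * be - 2 * (2 * V / al * be * W) = be * (W - 2 * V / al) ^+ 2 by field.
  by rewrite mulr_ge0 ?sqr_ge0 // ltW.
have -> : 2 * m / (p * al ^+ 2) * Jr = 2 * (m / (p * al ^+ 2) * Jr) by ring.
by lra.
Qed.

(** * Lower bound for numerators real on the line *)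

Section LowerReal.
Variable R : realType.
Local Notation C := R[i].
Local Notation toC := (real_complex R).
Local Notation Re := (@complex.Re R).
Local Notation Im := (@complex.Im R).
Local Notation mu := (@lebesgue_measure R).
Variables (M : nat) (q eta : 'I_M -> R) (t : R) (a : 'I_M -> R).
Hypothesis eta0 : forall k, 0 < eta k.
Hypothesis aF : fibF q eta t = \prod_j ('X - (toC (a j))%:P).
Variables (e V0 : R) (N : {poly C}).
Hypothesis e0 : 0 < e.
Hypothesis nodee : forall k, normc (node q eta k) <= e / 8.
Hypothesis ae : forall j, `|a j| <= e / 4.
Hypothesis NV : forall z, normc z <= e -> normc N.[z] <= V0.
Hypothesis Nreal : forall y, Im N.[toC y] = 0.

Local Notation P := (fibP q eta).
Local Notation phi := (phi q eta).

Definition quoN (y : R) : R := sqnormC (N.[toC y] * (P.[toC y])^-1).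
Lemma quoN_ge0 y : 0 <= quoN y.
Proof. by rewrite /quoN -normc_sqr sqr_ge0. Qed.

Definition arcV : R := normc (alpha t) * (V0 * ((e / 8) ^+ M)^-1).

Lemma fibP_ge_eta (z : C) : 0 <= Im z -> \prod_k eta k <= normc P.[z].
Proof.
move=> z0; rewrite fibP_eval nc_prod; apply: ler_prod => k _; rewrite (ltW (eta0 k)) /=.
apply: (le_trans _ (Im_le_nc _)); case: z z0 => u v /= v0.
by rewrite ger0_norm ?addr_ge0 ?(ltW (eta0 k)) // lerDr.
Qed.

Lemma fibP_neq0 (z : C) : 0 <= Im z -> P.[z] != 0.
Proof.
move=> z0; rewrite -nc_gt0; apply: lt_le_trans (fibP_ge_eta z0).
exact: prodr_gt0.
Qed.

(** The radii are tuned: with radius [e / 2] and [|a_j| <= e / 4] the arc lies in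
    [e / 4 <= |z| <= e], and nodes of modulus at most [e / 8] leave every factor of [P] at least
    [e / 8]. *)
Lemma arc_bound (s : C) j th : normc s = 1 -> 0 <= th <= pi ->
  normc (ratH N P (s * conjc (alpha t)) (polarC (a j) (e / 2) th)) <= arcV.
Proof.
move=> s1 th0; rewrite /ratH !ncM s1 mul1r nc_conj /arcV ler_wpM2l ?normc_ge0 //.
set z := polarC _ _ _.
have Ez : z = toC (a j) + toC (e / 2) * unitC th by rewrite /z polarCE.
have nz2 : normc (toC (e / 2) * unitC th) = e / 2.
  by rewrite ncM nc_unitC mulr1 nc_real ger0_norm // divr_ge0 // ltW.
have zu : normc z <= e.
  rewrite Ez; apply: (le_trans (ncD _ _)); rewrite nz2 nc_real.
  apply: (le_trans (lerD (ae j) (lexx _))); move: (e0); lra.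
have zl : e / 4 <= normc z.
  have := ncB z (toC (a j)); rewrite {1}Ez [X in normc X](_ : _ = toC (e / 2) * unitC th); last by ring.
  rewrite nz2 nc_real => h; have := le_trans h (lerD (lexx _) (ae j)); move: (e0); lra.
apply: ler_pM; rewrite ?normc_ge0 ?NV // normcV lef_pV2 ?posrE ?exprn_gt0 ?divr_gt0 //; last first.
  rewrite nc_gt0; apply: fibP_neq0; apply: Im_polar_ge0 => //.
  by rewrite divr_ge0 // ltW.
rewrite fibP_eval nc_prod -[X in _ ^+ X]card_ord -prodr_const; apply: ler_prod => k _.
apply/andP; split; first by rewrite divr_ge0 ?(ltW e0).
have := ncB (z + node q eta k) (node q eta k); rewrite addrK => h.
have := le_trans zl (le_trans h (lerD (lexx _) (nodee k))); move: (e0); lra.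
Qed.

(** On the line [conj(alpha) / P] is the conjugate of [alpha P] divided by [|P|^2], and
    [2 Re(alpha P) = F]. The sign [s] is kept free for [lower_real]. *)
Lemma Re_ratH s y : s ^+ 2 = 1 ->
  `|Re (ratH N P (toC s * conjc (alpha t)) (toC y))| =
  `|Re N.[toC y] * (reA q eta y + t * reB q eta y)| / (2 * sqnormC P.[toC y]).
Proof.
move=> s1; have := sqnorm_fibP_gt0 q eta0 y.
have s1' : `|s| = 1 by apply/eqP; rewrite -sqr_norm_eq1 // s1.
have : N.[toC y] = toC (Re N.[toC y]).
  by have := Nreal y; case: (N.[_]) => u v /= ->.
rewrite /ratH /reA /reB; set n := Re N.[toC y]; move=> -> /=.
rewrite /sqnormC; case: (P.[_]) => u v /= uv0.
have uvn : u ^+ 2 + v ^+ 2 != 0 by rewrite gt_eqF.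
have -> : `|n * (u + t * v)| / (2 * (u ^+ 2 + v ^+ 2)) = `|s * (n * (u + t * v) / (2 * (u ^+ 2 + v ^+ 2)))|.
  by rewrite !normrM s1' mul1r normfV normrM (gtr0_norm uv0) [`|2|]ger0_norm // -normrM.
by congr `|_|; field.
Qed.

Lemma lower_real j lam : 0 < lam ->
  ((pi * (normc (alpha t) * normc (N.[toC (a j)] * (P.[toC (a j)])^-1) - arcV))%:E <=
  2%:E * \int[mu]_(y in `](- e)%R, e[) (4^-1 * (lam * quoN y + phi y / (lam * beta q eta a j)))%:E)%E.
Proof.
move=> lam0; set be := beta q eta a j; set W := normc (_ * _).
have be0 : 0 < be by apply: (beta_gt0 eta0 aF).
pose G y := 4^-1 * (lam * quoN y + phi y / (lam * be)).
have cG : continuous G.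
  have cq : continuous quoN.
    apply: continuous_sqnormC => y; eexists; apply: cderivM; first exact: (cderiv_poly N (cderiv_real y)).
    by apply: cderivV; [apply: fibP_neq0|exact: (cderiv_poly P (cderiv_real y))].
  move=> y; rewrite /G; apply: (@continuousM _ _ (fun=> 4^-1) (fun y => lam * quoN y + phi y / (lam * be))); first exact: cst_continuous.
  apply: (@continuousD _ _ _ (fun y => lam * quoN y) (fun y => phi y / (lam * be))).
    by apply: (@continuousM _ _ (fun=> lam) quoN); [exact: cst_continuous|exact: cq].
  by apply: (@continuousM _ _ phi (fun=> (lam * be)^-1)); [exact: (continuous_phi eta0)|exact: cst_continuous].
have G0 y : 0 <= G y.
  rewrite /G mulr_ge0 // addr_ge0 // mulr_ge0 ?(ltW lam0) ?quoN_ge0 ?phi_ge0 //.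
  by rewrite invr_ge0 mulr_ge0 ?(ltW lam0) ?(ltW be0).
(* The weight [1 / |r|] cancels against [F(y) = r F_j(y)] at [y = a_j + r]. Then [beta_j F_j ^ 2] is
   one term of the nonnegative sum [K = phi |P|^2]. *)
have key (s r : R) : s ^+ 2 = 1 -> r != 0 ->
    `|Re (ratH N P (toC s * conjc (alpha t)) (toC (a j + r)))| / `|r| <= G (a j + r).
  move=> s1 r0; set y := a j + r.
  rewrite (Re_ratH y s1) .
  have -> : reA q eta y + t * reB q eta y = r * rFj a j y.
    apply: (@complexI R); rewrite -fibF_eval_real (fibF_factor aF j) hornerM hornerXsubC Fj_real.
    by rewrite -rmorphB -rmorphM; congr (toC (_ * _)); rewrite /y; ring.
  have Kl : be * rFj a j y ^+ 2 <= phi y * sqnormC P.[toC y].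
    rewrite -fibK_phi // (fibK_sum_sqr eta0 aF) (bigD1 j) //= lerDl; apply: sumr_ge0 => i _.
    by rewrite mulr_ge0 ?sqr_ge0 // ltW // (beta_gt0 eta0 aF).
  have p0 := sqnorm_fibP_gt0 q eta0 y.
  have quoE : quoN y = Re N.[toC y] ^+ 2 / sqnormC P.[toC y].
    rewrite /quoN -normc_sqr ncM exprMn !normcV exprVn !normc_sqr {1}/sqnormC.
    by have := Nreal y; case: (N.[_]) => u v /= ->; rewrite expr0n addr0.
  rewrite /G quoE; set n := Re _; set F := rFj _ _ _ in Kl *; set p := sqnormC _ in Kl p0 quoE *.
  have -> : `|n * (r * F)| / (2 * p) / `|r| = `|n * F| / (2 * p).
    by rewrite mulrCA normrM; field; rewrite gt_eqF //= normr_eq0.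
  exact: amgm_quot.
(* The real part vanishes at [a_j], a root of [F], so the imaginary part there is the modulus up to
   sign; [s] corrects the sign. *)
have [s s1 Es] : exists2 s : R, s ^+ 2 = 1 & Im (ratH N P (toC s * conjc (alpha t)) (toC (a j))) = normc (alpha t) * W.
  have R0 : Re (ratH N P (toC 1 * conjc (alpha t)) (toC (a j))) = 0.
    apply/eqP; rewrite -normr_eq0 Re_ratH ?expr1n //.
    have -> : reA q eta (a j) + t * reB q eta (a j) = 0.
      by apply: (@complexI R); rewrite -fibF_eval_real (root_fibF aF).
    by rewrite mulr0 normr0 mul0r.
  have ratS s : ratH N P (toC s * conjc (alpha t)) (toC (a j)) = toC s * ratH N P (toC 1 * conjc (alpha t)) (toC (a j)).
    by rewrite /ratH rmorph1; ring.
  have nE : normc (ratH N P (toC 1 * conjc (alpha t)) (toC (a j))) = normc (alpha t) * W.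
    by rewrite /ratH rmorph1 mul1r ncM nc_conj.
  have nI : normc (ratH N P (toC 1 * conjc (alpha t)) (toC (a j))) = `|Im (ratH N P (toC 1 * conjc (alpha t)) (toC (a j)))|.
    by move: R0; case: (ratH _ _ _ _) => u v /= ->; rewrite expr0n add0r sqrtr_sqr.
  rewrite -nE nI; set z := ratH _ _ _ _ in ratS *.
  have [h|h] := lerP 0 (Im z).
    by exists 1; rewrite ?expr1n // -/z ger0_norm.
  exists (-1); first by rewrite sqrrN expr1n.
  by rewrite ratS ltr0_norm //; case: (z) => u v /=; rewrite mul0r addr0 mulN1r.
have e20 : 0 < e / 2 by rewrite divr_gt0.
have ncs : normc (toC s) = 1.
  by rewrite nc_real; apply/eqP; rewrite -sqr_norm_eq1 // s1.
have pe0 : 0 < \prod_k eta k by apply: prodr_gt0 => k _.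
have := polar_estimate e20 pe0 fibP_ge_eta (fun th => @arc_bound (toC s) j th ncs).
rewrite Es => /le_trans; apply.
have cs (h : R -> R) : continuous h -> continuous (G \o h).
  by move=> ch r; apply: continuous_comp; [exact: ch|exact: cG].
have cp : continuous (fun r : R => a j + r).
  by move=> r; apply: continuousD; [exact: cst_continuous|exact: cvg_id].
have cm : continuous (fun r : R => a j - r).
  by move=> r; apply: continuousB; [exact: cst_continuous|exact: cvg_id].
have mp := continuous_measurable (D := `]0%R, (e / 2)]) (cs _ cp).
have mm := continuous_measurable (D := `]0%R, (e / 2)]) (cs _ cm).
have mH (h : R -> R) : continuous h -> measurable_fun `]0%R, (e / 2)] (fun r => Re (ratH N P (toC s * conjc (alpha t)) (toC (h r)))).
  move=> ch; exact (proj1 (cmeas_ratH _ _ _ (cmeas_real (continuous_measurable ch)))).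
apply: (@le_trans _ _ (\int[mu]_(r in `]0%R, (e / 2)%R]) (G (a j + r) + G (a j - r))%:E)%E).
  apply: le_integral_EFin.
  - exact: measurable_itv.
  - apply: (measurable_quotD (mH _ cp) (mH _ cm)).
    apply: measurable_funTS; exact: measurable_inv.
  - exact: (measurable_funD mp mm).
  - move=> r; rewrite /= in_itv /= => /andP[r0 _]; exact (quotD_ge0 _ _ r0).
  - move=> r; rewrite /= in_itv /= => /andP[r0 _].
    have rn : r != 0 by rewrite gt_eqF.
    have k1 := key s r s1 rn.
    have := key s (- r) s1; rewrite oppr_eq0 normrN => /(_ rn) k2.
    rewrite (gtr0_norm r0) in k1 k2.
    by rewrite mulrDl lerD.
rewrite ge0_integralD_real.
- have ->: (2%:E = 1 + 1 :> \bar R)%E by [].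
  rewrite ge0_muleDl ?mul1e //; apply: leeD.
  + by apply: integral_shift_le => //; have := ae j; move: (e0); lra.
  + by apply: integral_reflect_le => //; have := ae j; move: (e0); lra.
- exact: measurable_itv.
- exact mp.
- exact mm.
- by move=> r _; apply: G0.
- by move=> r _; apply: G0.
Qed.

Lemma continuous_quoN : continuous quoN.
Proof.
apply: continuous_sqnormC => y; eexists; apply: cderivM; first exact: (cderiv_poly N (cderiv_real y)).
by apply: cderivV; [apply: fibP_neq0|exact: (cderiv_poly P (cderiv_real y))].
Qed.

Lemma lower_real_sqr j :
  ((beta q eta a j * normc (N.[toC (a j)] * (P.[toC (a j)])^-1) ^+ 2)%:E <=
   (4 * arcV ^+ 2 / normc (alpha t) ^+ 2 * beta q eta a j)%:E +
   (2 * M%:R / (pi * normc (alpha t) ^+ 2))%:E * \int[mu]_(y in `](- e)%R, e[) (quoN y)%:E)%E.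
Proof.
have H := lower_real j.
move: H; set be := beta q eta a j; set W := normc (_ * _); set al := normc (alpha t).
set J := (\int[mu]_(y in _) (quoN y)%:E)%E => H.
have be0 : 0 < be by apply: (beta_gt0 eta0 aF).
have al0 : 0 < al by rewrite nc_gt0 alpha_neq0.
have M0 : 0 < M%:R :> R by rewrite ltr0n (leq_ltn_trans _ (ltn_ord j)).
have pi0 := pi_gt0 R.
have k0 : 0 < 2 * M%:R / (pi * al ^+ 2) by rewrite divr_gt0 ?mulr_gt0 ?exprn_gt0.
have J0 : (0 <= J)%E by apply: integral_ge0 => y _; rewrite lee_fin quoN_ge0.
have mq : measurable_fun `](- e)%R, e[ quoN by exact: continuous_measurable continuous_quoN.
have mphi : measurable_fun `](- e)%R, e[ phi by exact: continuous_measurable (continuous_phi eta0).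
have H1 lam : 0 < lam -> ((pi * (al * W - arcV))%:E <= (2^-1 * lam)%:E * J + (2^-1 * (M%:R * pi / (lam * be)))%:E)%E.
  move=> l0; apply: (le_trans (H lam l0)).
  have mlq : measurable_fun `](- e)%R, e[ (fun y => lam * quoN y).
    by apply: measurable_funM => //; exact: measurable_cst.
  have mlp : measurable_fun `](- e)%R, e[ (fun y => phi y / (lam * be)).
    by apply: measurable_funM => //; exact: measurable_cst.
  have i0 : 0 <= (lam * be)^-1 by rewrite invr_ge0 mulr_ge0 // ltW.
  rewrite ge0_integralZ_real; [|exact: measurable_itv|exact: (measurable_funD mlq mlp)| |]; last 2 first.
  - by move=> y _; rewrite addr_ge0 // mulr_ge0 ?(ltW l0) ?quoN_ge0 ?phi_ge0.
  - by rewrite invr_ge0.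
  rewrite ge0_integralD_real; [|exact: measurable_itv|exact: mlq|exact: mlp| |]; last 2 first.
  - by move=> y _; rewrite mulr_ge0 ?(ltW l0) ?quoN_ge0.
  - by move=> y _; rewrite mulr_ge0 ?phi_ge0.
  rewrite ge0_integralZ_real; [|exact: measurable_itv|exact: mq|by move=> y _; exact: quoN_ge0|exact: ltW].
  rewrite -/J muleA -EFinM [2 * 4^-1](_ : _ = 2^-1); last by field.
  rewrite ge0_muleDr ?mule_ge0 ?lee_fin ?(ltW l0) //; last first.
    by apply: integral_ge0 => y _; rewrite lee_fin mulr_ge0 ?phi_ge0.
  rewrite muleA -EFinM leeD2l // [X in (_ <= X)%E]EFinM; apply: lee_wpmul2l; first by rewrite lee_fin invr_ge0.
  rewrite (_ : (\int[mu]_(x in `](- e)%R, e[) (phi x / (lam * be))%:E)%E = \int[mu]_(x in `](- e)%R, e[) ((lam * be)^-1 * phi x)%:E)%E; last first.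
    by apply: eq_integral => y _; rewrite mulrC.
  rewrite ge0_integralZ_real; [|exact: measurable_itv|exact: mphi|by move=> y _; exact: phi_ge0|exact: i0].
  rewrite [M%:R * pi / _]mulrC EFinM; apply: lee_wpmul2l; first by rewrite lee_fin.
  exact: (integral_phi_le q eta0 e0).
(* If the integral is infinite, so is the right-hand side: its coefficient is positive, as the index
   [j] forces [M > 0]. *)
have [Jy|Jy] := eqVneq J +oo%E.
  by rewrite Jy gt0_muley ?lte_fin // addey // leey.
have Jf : J \is a fin_num by rewrite ge0_fin_numE // lt_neqAle Jy leey.
rewrite -(fineK Jf) in H1 J0 *; set Jr := fine J in H1 J0 *.
rewrite -EFinM -EFinD lee_fin; rewrite lee_fin in J0.
have H2 lam : 0 < lam -> pi * (al * W - arcV) <= 2^-1 * lam * Jr + 2^-1 * (M%:R * pi / (lam * be)).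
  by move=> /H1; rewrite -EFinM -EFinD lee_fin.
have W0 : 0 <= W by apply: normc_ge0.
(* The optimal weight has [W] in its denominator, so [W = 0] is treated apart. *)
have [W00|W1] := eqVneq W 0.
  rewrite W00 expr0n mulr0; apply: addr_ge0; last exact: (mulr_ge0 (ltW k0) J0).
  by rewrite mulr_ge0 ?(ltW be0) // divr_ge0 ?sqr_ge0 // mulr_ge0 ?sqr_ge0.
have W2 : 0 < W by rewrite lt_neqAle eq_sym W1.
exact: (optimize_lam be0 al0 M0 pi0 W2 H2).
Qed.

End LowerReal.

Lemma sqr_add_le (R : realType) (u c w g p : R) : c ^+ 2 * w ^+ 2 <= c ^+ 2 * (g * p) ->
  (u + c * w) ^+ 2 <= 2 * u ^+ 2 + 2 * c ^+ 2 * g * p.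
Proof.
move=> h; rewrite -subr_ge0.
have -> : 2 * u ^+ 2 + 2 * c ^+ 2 * g * p - (u + c * w) ^+ 2 =
  (u - c * w) ^+ 2 + 2 * (c ^+ 2 * (g * p) - c ^+ 2 * w ^+ 2) by ring.
by rewrite addr_ge0 ?sqr_ge0 // mulr_ge0 // subr_ge0.
Qed.

(** * Lower bound for complex-valued Q *)

Section LowerComplex.
Variable R : realType.
Local Notation C := R[i].
Local Notation toC := (real_complex R).
Local Notation Re := (@complex.Re R).
Local Notation Im := (@complex.Im R).
Local Notation mu := (@lebesgue_measure R).
Variables (M : nat) (q eta : 'I_M -> R) (t : R) (a : 'I_M -> R).
Hypothesis eta0 : forall k, 0 < eta k.
Hypothesis aF : fibF q eta t = \prod_j ('X - (toC (a j))%:P).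
Variables (e V0 CF : R) (Q : C -> C).
Hypothesis e0 : 0 < e.
Hypothesis e1 : e <= 1.
Hypothesis CF0 : 0 <= CF.
Hypothesis nodee : forall k, normc (node q eta k) <= e / 8.
Hypothesis ae : forall j, `|a j| <= e / 4.
Local Notation P := (fibP q eta).
Local Notation N := (lagr a (fun j => Q (toC (a j)))).
Hypothesis NV : forall z, normc z <= e -> normc N.[z] <= V0.
Hypothesis QN : forall y : R, `|y| < e -> normc (Q (toC y) - N.[toC y]) <= CF * normc (fibF q eta t).[toC y].
Hypothesis mQ : cmeas `](- e)%R, e[ (fun y => Q (toC y)).

Lemma lagr_real (w : 'I_M -> R) y : (lagr a (fun j => toC (w j))).[toC y] =
  toC (\sum_j w j / rFj a j (a j) * rFj a j y).
Proof.
rewrite /lagr horner_sum rmorph_sum; apply: eq_bigr => j _.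
by rewrite hornerZ Fj_real !rmorphM fmorphV.
Qed.

Lemma conj_lagr (v : 'I_M -> C) z : conjc (lagr a v).[conjc z] = (lagr a (fun j => conjc (v j))).[z].
Proof.
rewrite /lagr !horner_sum rmorph_sum; apply: eq_bigr => j _.
rewrite !hornerZ !rmorphM fmorphV /= oppr0; congr (_ * _).
rewrite /Fj !horner_prod rmorph_prod; apply: eq_bigr => i _.
by rewrite !hornerXsubC rmorphB /= conjcK oppr0.
Qed.

Lemma lagr_comb (u v : C) (w1 w2 : 'I_M -> C) z :
  (lagr a (fun j => u * w1 j + v * w2 j)).[z] = u * (lagr a w1).[z] + v * (lagr a w2).[z].
Proof.
rewrite /lagr !horner_sum !mulr_sumr -big_split; apply: eq_bigr => j _ /=.
by rewrite !hornerZ; ring.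
Qed.

Lemma lagr_ext (w1 w2 : 'I_M -> C) : w1 =1 w2 -> lagr a w1 = lagr a w2.
Proof. by move=> E; apply: eq_bigr => j _; rewrite E. Qed.

(** Real ([true]) or imaginary ([false]) parts of the values at the nodes. Real values at real nodes
    have an interpolant that is real on the line. *)
Definition partN (b : bool) : 'I_M -> R := fun j => if b then Re (Q (toC (a j))) else Im (Q (toC (a j))).

Lemma partN_split y : N.[toC y] = (lagr a (fun j => toC (partN true j))).[toC y] + iC R * (lagr a (fun j => toC (partN false j))).[toC y].
Proof.
rewrite -[X in X + _]mul1r -lagr_comb; congr (_.[_]); apply: lagr_ext => j.
by rewrite mul1r /partN; case: (Q _) => u v; rewrite /iC; apply/eqP; rewrite eq_complex /=; apply/andP; split; apply/eqP; ring.
Qed.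

Lemma partN_bound b z : normc z <= e -> normc (lagr a (fun j => toC (partN b j))).[z] <= V0.
Proof.
move=> ze.
(* [u = 1] gives the real part and [u = - i] the imaginary part as [(u w + conj(u w)) / 2].
   Interpolation at real nodes commutes with conjugation, so the bound for [N] is used at [z] and at
   its conjugate. *)
have [u [n1 E]] : exists u : C, normc u = 1 /\
    forall j, toC (partN b j) = (u * toC 2^-1) * Q (toC (a j)) + (conjc u * toC 2^-1) * conjc (Q (toC (a j))).
  case: b; [exists 1|exists (- iC R)]; split.
  - by rewrite normc1.
  - move=> j; rewrite /partN; case: (Q _) => u v.
    by apply/eqP; rewrite eq_complex /=; apply/andP; split; apply/eqP; field.
  - by rewrite ncN /iC /normc expr0n expr1n add0r sqrtr1.
  - move=> j; rewrite /partN; case: (Q _) => u v.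
    by rewrite /iC; apply/eqP; rewrite eq_complex /=; apply/andP; split; apply/eqP; field.
rewrite (lagr_ext E) lagr_comb -conj_lagr.
apply: (le_trans (ncD _ _)); rewrite !ncM !nc_conj n1 mul1r nc_real ger0_norm ?invr_ge0 //.
have h1 := NV ze.
have h2 : normc N.[conjc z] <= V0 by apply: NV; rewrite nc_conj.
by lra.
Qed.

(** Both formulas for [K] are compared at [y = 1], away from all roots: there [K <= M * 5 ^ M],
    because [(1 + q)^2 + eta^2 <= 5], while [F_j ^ 2 >= 4 ^- M], because [|a_i| <= 1 / 4]. The arc
    term of the lower bound carries the factor [beta j]. *)
Lemma beta_le j : beta q eta a j <= M%:R * 20 ^+ M.
Proof.
have be0 k : 0 < beta q eta a k by apply: (beta_gt0 eta0 aF).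
have K1 : beta q eta a j * rFj a j 1 ^+ 2 <= fibK q eta 1.
  rewrite (fibK_sum_sqr eta0 aF) (bigD1 j) //= lerDl; apply: sumr_ge0 => i _.
  by rewrite mulr_ge0 ?sqr_ge0 // ltW.
have ql k : -1 <= q k <= 1 /\ -1 <= eta k <= 1.
  have h := nodee k; have h1 : normc (node q eta k) <= 1 by move: (e1); lra.
  split; rewrite -ler_norml; apply: le_trans h1; [exact: (Re_le_nc (node q eta k))|exact: (Im_le_nc (node q eta k))].
have K2 : fibK q eta 1 <= M%:R * 5 ^+ M.
  rewrite /fibK -[M in M%:R]card_ord mulr_natl -sumr_const; apply: ler_sum => k _.
  have [/andP[q1 q2] /andP[h1 h2]] := ql k.
  apply: (@le_trans _ _ (1 * \prod_(i < M | i != k) 5)).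
    apply: ler_pM; rewrite ?(ltW (eta0 k)) //.
      by apply: prodr_ge0 => i _; rewrite addr_ge0 ?sqr_ge0.
    apply: ler_prod => i _; rewrite addr_ge0 ?sqr_ge0 //=.
    have [/andP[q3 q4] /andP[h3 h4]] := ql i.
    by nra.
  by rewrite mul1r prodr_const ler_weXn2l ?max_card_ord ?ler1n //; apply: (leq_trans (max_card _)); rewrite card_ord.
have K3 : 4^-1 ^+ M <= rFj a j 1 ^+ 2.
  rewrite /rFj -prodrXl; apply: (@le_trans _ _ (\prod_(i < M | i != j) 4^-1)).
    rewrite prodr_const; apply: ler_wiXn2l; rewrite ?invr_ge0 ?invf_le1 ?ler1n //.
    by apply: (leq_trans (max_card _)); rewrite card_ord.
  apply: ler_prod => i _; rewrite invr_ge0 ler0n /=.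
  have := ae i; rewrite ler_norml => /andP[h1 h2].
  have h3 : a i <= 4^-1 by move: (e1); lra.
  by nra.
have := le_trans (le_trans (ler_wpM2l (ltW (be0 j)) K3) K1) K2.
rewrite exprVn ler_pdivrMr ?exprn_gt0 // => /le_trans; apply.
by rewrite -mulrA -exprMn [5 * 4](_ : _ = 20) //; ring.
Qed.

Definition lowC2 : R := 2 * M%:R / (pi * normc (alpha t) ^+ 2).
Definition lowC1 : R := 4 * arcV M t e V0 ^+ 2 / normc (alpha t) ^+ 2 * (M%:R * 20 ^+ M).

Lemma lowC2_ge0 : 0 <= lowC2.
Proof. by rewrite divr_ge0 //; apply: mulr_ge0; rewrite ?pi_ge0 ?sqr_ge0. Qed.

Lemma lowC1_ge0 : 0 <= lowC1.
Proof.
apply: mulr_ge0; last by apply: mulr_ge0; rewrite ?exprn_ge0.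
by apply: divr_ge0; rewrite ?sqr_ge0 //; apply: mulr_ge0; rewrite ?sqr_ge0.
Qed.

Local Notation quo := (fun y : R => sqnormC (Q (toC y) / P.[toC y])).

(** On the line [N] is the first interpolant plus [i] times the second, both real, so [|N|^2] is the
    sum of their squares. *)
Lemma quoN_part b y : quoN q eta (lagr a (fun j => toC (partN b j))) y <= quoN q eta N y.
Proof.
rewrite /quoN !sqnormCM ler_wpM2r //; first by rewrite -normc_sqr sqr_ge0.
rewrite partN_split !lagr_real.
set u := \sum_j _; set w := \sum_(j < M) partN true j / _ * _; set w' := \sum_(j < M) partN false j / _ * _.
have -> : sqnormC (toC w + iC R * toC w') = w ^+ 2 + w' ^+ 2.
  by rewrite /sqnormC /iC /=; congr (_ ^+ 2 + _ ^+ 2); ring.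
have -> : sqnormC (toC u) = u ^+ 2 by rewrite /sqnormC /= expr0n addr0.
by rewrite /u; case: (b); rewrite -/w -/w' ?lerDl ?lerDr sqr_ge0.
Qed.

Lemma quoN_le y : `|y| < e -> quoN q eta N y <= 2 * quo y + 2 * CF ^+ 2 * (1 + t ^+ 2).
Proof.
move=> ye; rewrite /quoN !sqnormCM -[X in _ <= 2 * X + _]sqnormCM.
have p0 := sqnorm_fibP_gt0 q eta0 y.
have Vs (z : C) : sqnormC z^-1 = (sqnormC z)^-1 by rewrite -!normc_sqr normcV exprVn.
rewrite sqnormCM !Vs ler_pdivrMr // mulrDl mulrA divfK ?gt_eqF //.
have h : normc N.[toC y] <= normc (Q (toC y)) + CF * normc (fibF q eta t).[toC y].
  have := ncB (Q (toC y)) (Q (toC y) - N.[toC y]).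
  rewrite opprB addrCA subrr addr0 => /le_trans; apply.
  by rewrite lerD2l; apply: QN.
have h2 : normc (fibF q eta t).[toC y] ^+ 2 <= (1 + t ^+ 2) * sqnormC P.[toC y].
  by rewrite fibF_eval_real nc_real real_normK ?num_real // sqnorm_fibF_le.
rewrite -!normc_sqr; apply: (@le_trans _ _ ((normc (Q (toC y)) + CF * normc (fibF q eta t).[toC y]) ^+ 2)).
  by apply: lerXn2r; rewrite ?nnegrE ?normc_ge0 // addr_ge0 ?mulr_ge0 ?normc_ge0.
have h3 := ler_wpM2l (sqr_ge0 CF) h2; rewrite -normc_sqr in h3.
exact: sqr_add_le.
Qed.

Lemma lower_bound j :
  ((sqnormC (Q (toC (a j))) / fibK q eta (a j))%:E <=
   ((1 + t ^+ 2) * (2 * lowC1 + 2 * lowC2 * (2 * CF ^+ 2 * (1 + t ^+ 2) * (2 * e))))%:E +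
   ((1 + t ^+ 2) * (2 * lowC2 * 2))%:E * \int[mu]_(y in `](- e)%R, e[) (quo y)%:E)%E.
Proof.
have be0 := beta_gt0 eta0 aF j.
have K0 := fibK_root_gt0 q eta0 a j.
have t0 : 0 < 1 + t ^+ 2 by rewrite ltr_pwDl ?sqr_ge0.
set J := (\int[mu]_(y in _) _)%E.
have J0 : (0 <= J)%E by apply: integral_ge0 => y _; rewrite lee_fin -normc_sqr sqr_ge0.
have mq : measurable_fun `](- e)%R, e[ quo.
  apply: meas_sqnorm; apply: cmeasM; first exact: mQ.
  apply: cmeasV; apply: cmeas_poly; apply: cmeas_real; exact: measurable_id.
have mqN := continuous_measurable (D := `](- e)%R, e[) (continuous_quoN eta0 (N := N)).
have JN : (\int[mu]_(y in `](- e)%R, e[) (quoN q eta N y)%:E <= 2%:E * J + (2 * CF ^+ 2 * (1 + t ^+ 2) * (2 * e))%:E)%E.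
  have q0 y : 0 <= quo y by rewrite -normc_sqr sqr_ge0.
  have c0 : 0 <= 2 * CF ^+ 2 * (1 + t ^+ 2) by rewrite !mulr_ge0 ?sqr_ge0 // ltW.
  have m2q : measurable_fun `](- e)%R, e[ (fun y => 2 * quo y).
    by apply: measurable_funM => //; exact: measurable_cst.
  apply: (@le_trans _ _ (\int[mu]_(y in `](- e)%R, e[) (2 * quo y + 2 * CF ^+ 2 * (1 + t ^+ 2))%:E)%E).
    apply: le_integral_EFin.
    - exact: measurable_itv.
    - exact: mqN.
    - by apply: measurable_funD; [exact: m2q|exact: measurable_cst].
    - by move=> y _; exact: quoN_ge0.
    - move=> y; rewrite /= in_itv /= => ye; apply: quoN_le; rewrite ltr_norml; exact ye.
  rewrite ge0_integralD_real; [|exact: measurable_itv|exact: m2q|exact: measurable_cst| |]; last 2 first.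
  - by move=> y _; apply: mulr_ge0.
  - by move=> y _; exact: c0.
  rewrite ge0_integralZ_real; [|exact: measurable_itv|exact: mq|by move=> y _; exact: q0|by []].
  rewrite integral_cst; last exact: measurable_itv.
  rewrite /= lebesgue_measure_itv /= lte_fin ifT; last by move: (e0); lra.
  by rewrite -EFinD -EFinM [e - - e](_ : _ = 2 * e) //; ring.
have part b : ((beta q eta a j * normc (toC (partN b j) * (P.[toC (a j)])^-1) ^+ 2)%:E <=
    lowC1%:E + lowC2%:E * (2%:E * J + (2 * CF ^+ 2 * (1 + t ^+ 2) * (2 * e))%:E))%E.
  have rl y : Im (lagr a (fun j => toC (partN b j))).[toC y] = 0 by rewrite lagr_real.
  have := lower_real_sqr eta0 aF e0 nodee ae (partN_bound b) rl j.
  rewrite (lagr_eval eta0 aF) => /le_trans; apply; apply: leeD.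
    rewrite lee_fin /lowC1 ler_wpM2l ?beta_le //.
    by rewrite divr_ge0 ?sqr_ge0 // mulr_ge0 ?sqr_ge0.
  apply: lee_wpmul2l; first by rewrite lee_fin lowC2_ge0.
  apply: le_trans JN; apply: le_integral_EFin.
  - exact: measurable_itv.
  - exact (continuous_measurable (continuous_quoN eta0 (N := lagr a (fun j => toC (partN b j))))).
  - exact: mqN.
  - by move=> y _; exact: quoN_ge0.
  - by move=> y _; exact: quoN_part.
(* At a root [|P|^2 = (1 + t^2) beta_j K], which trades [beta_j |Q / P|^2] for [|Q|^2 / K]. *)
have EQ : sqnormC (Q (toC (a j))) / fibK q eta (a j) = (1 + t ^+ 2) *
   (beta q eta a j * normc (toC (partN true j) * (P.[toC (a j)])^-1) ^+ 2 + beta q eta a j * normc (toC (partN false j) * (P.[toC (a j)])^-1) ^+ 2).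
  rewrite !ncM !exprMn !nc_real !normcV !exprVn normc_sqr (sqnorm_fibP_root eta0 aF).
  rewrite !real_normK ?num_real // /partN /sqnormC.
  by field; rewrite !gt_eqF.
rewrite EQ EFinM; have := leeD (part true) (part false).
move/(lee_wpmul2l (_ : (0 <= (1 + t ^+ 2)%:E)%E)).
rewrite lee_fin (ltW t0) => /(_ isT) /le_trans; apply.
have [Jy|Jy] := eqVneq J +oo%E.
  have M0 : 0 < M%:R :> R by rewrite ltr0n (leq_ltn_trans _ (ltn_ord j)).
  have l2 : 0 < lowC2 by rewrite divr_gt0 ?mulr_gt0 ?pi_gt0 ?exprn_gt0 ?nc_gt0 ?alpha_neq0.
  have -> : (((1 + t ^+ 2) * (2 * lowC2 * 2))%:E * J = +oo)%E.
    by rewrite Jy gt0_muley // lte_fin mulr_gt0 // mulr_gt0 // mulr_gt0.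
  by rewrite leey.
have Jf : J \is a fin_num by rewrite ge0_fin_numE // lt_neqAle Jy leey.
rewrite -(fineK Jf) -!EFinM -!EFinD -?EFinM -?EFinD -?EFinM -?EFinD lee_fin.
by rewrite le_eqVlt; apply/orP; left; apply/eqP; ring.
Qed.

End LowerComplex.

(** * Orders of vanishing and upper bound for the fiber integral *)

Section Orders.
Variable R : realType.
Local Notation C := R[i].
Local Notation toC := (real_complex R).
Local Notation Re := (@complex.Re R).
Local Notation Im := (@complex.Im R).

Lemma vanishesP (f : R -> C) n :
  vanishes_to f n <-> exists K : R, \forall x \near (0 : R), normc (f x) <= K * `|x| ^+ n.
Proof.
split.
  move=> [r [r0 [K H]]]; exists K; apply/near0P; exists r; split => // x /H.
  by rewrite norm_eq_nc -[rC _]/(toC _) lecR.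
move=> [K /near0P [r [r0 H]]]; exists r; split => //; exists K => x /H.
by rewrite norm_eq_nc -[rC _]/(toC _) lecR.
Qed.

Lemma near0_lt (e : R) : 0 < e -> \forall x \near (0 : R), `|x| < e.
Proof. by move=> e0; apply/near0P; exists e. Qed.

Lemma an_unit (g : R -> R) : analytic g -> g 0 != 0 ->
  \forall x \near (0 : R), `|g 0| / 2 <= `|g x| /\ `|g x| <= 2 * `|g 0|.
Proof.
move=> /an_continuous0/cvgrPdist_lt cg g0; have h0 : 0 < `|g 0| / 2 by rewrite divr_gt0 // normr_gt0.
apply: filterS (cg _ h0) => x h.
have h1 := ler_normD (g 0 - g x) (g x); rewrite subrK in h1.
have h2 := ler_normB (g 0) (g 0 - g x); rewrite opprB addrCA subrr addr0 in h2.
by split; lra.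
Qed.

Lemma expr_norm_le (x : R) m n : `|x| <= 1 -> (n <= m)%N -> `|x| ^+ m <= `|x| ^+ n.
Proof. by move=> x1 nm; apply: ler_wiXn2l. Qed.

(** A quantitative form of vanishing to order at most [k], meaningful for functions not known to be
    analytic. *)
Definition lower_order (f : R -> R) (k : nat) :=
  exists2 c : R, 0 < c & \forall x \near (0 : R), c * `|x| ^+ k <= f x.

Lemma an_order_bounds (g : R -> R) : analytic g -> ~ (\forall x \near (0 : R), g x = 0) ->
  exists m, lower_order (fun x => `|g x|) m /\ exists K, \forall x \near (0 : R), `|g x| <= K * `|x| ^+ m.
Proof.
move=> ag ng; have [//|[m [h [ah h0 E]]]] := an_order ag.
have u := an_unit ah h0; exists m; split.
  exists (`|h 0| / 2); first by rewrite divr_gt0 // normr_gt0.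
  apply: filterS2 E u => x -> [h1 _]; rewrite normrM normrX mulrC.
  by rewrite ler_wpM2l // exprn_ge0.
exists (2 * `|h 0|); apply: filterS2 E u => x -> [_ h2]; rewrite normrM normrX mulrC.
by rewrite ler_wpM2r // exprn_ge0.
Qed.

Lemma an_order_dichotomy (g : R -> R) N : analytic g ->
  (exists K, \forall x \near (0 : R), `|g x| <= K * `|x| ^+ N) \/
  exists2 k, (k < N)%N & lower_order (fun x => `|g x|) k.
Proof.
move=> ag; have [g0|] := pselect (\forall x \near (0 : R), g x = 0).
  by left; exists 0; apply: filterS g0 => x ->; rewrite normr0 mul0r.
move=> /(an_order_bounds ag) [m [lm [K HK]]].
have [mN|Nm] := ltnP m N; first by right; exists m.
left; exists `|K|; apply: filterS2 HK (near0_lt ltr01) => x h x1.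
apply: (le_trans h); apply: (@le_trans _ _ (`|K| * `|x| ^+ m)).
  by rewrite ler_wpM2r ?exprn_ge0 // ler_norm.
by rewrite ler_wpM2l // expr_norm_le // ltW.
Qed.

Lemma low_perturb (u g : R -> R) k N K : (k < N)%N -> lower_order (fun x => `|g x|) k ->
  (\forall x \near (0 : R), `|u x - g x| <= K * `|x| ^+ N) -> lower_order (fun x => `|u x|) k.
Proof.
move=> kN [c c0 Hc] HK; exists (c / 2); first by rewrite divr_gt0.
have d0 : 0 < c / (2 * (`|K| + 1)) by rewrite divr_gt0 // mulr_gt0 // ltr_wpDl.
apply: filterS2 (near0_lt d0) (filterI (near0_lt ltr01) (filterI Hc HK)) => x xd [x1 [h1 h2]].
have h3 : K * `|x| ^+ N <= c / 2 * `|x| ^+ k.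
  apply: (@le_trans _ _ ((`|K| + 1) * (`|x| * `|x| ^+ k))).
    apply: (@le_trans _ _ ((`|K| + 1) * `|x| ^+ N)).
      by rewrite ler_wpM2r ?exprn_ge0 // (le_trans (ler_norm _)) // lerDl.
    by rewrite ler_wpM2l ?addr_ge0 // -exprS expr_norm_le // ltW.
  rewrite mulrA ler_wpM2r ?exprn_ge0 //.
  move: xd; rewrite ltr_pdivlMr ?mulr_gt0 ?ltr_wpDl // => xd.
  by nra.
have h4 := ler_normB (u x) (u x - g x); rewrite opprB addrCA subrr addr0 in h4.
have -> : c / 2 * `|x| ^+ k = c * `|x| ^+ k - c / 2 * `|x| ^+ k by field.
by lra.
Qed.

(** Analyticity of [f] is not asked: its real and imaginary parts up to [O(|x| ^+ N)] decide every
    order below [N]. *)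
Lemma complex_order_dichotomy (f : R -> C) (g1 g2 : R -> R) N K : analytic g1 -> analytic g2 ->
  (\forall x \near (0 : R), `|Re (f x) - g1 x| <= K * `|x| ^+ N) ->
  (\forall x \near (0 : R), `|Im (f x) - g2 x| <= K * `|x| ^+ N) ->
  vanishes_to f N \/ exists2 k, (k < N)%N & lower_order (fun x => normc (f x)) k.
Proof.
move=> a1 a2 H1 H2.
have [[K1 v1]|[k kN l1]] := an_order_dichotomy N a1; last first.
  right; exists k => //; have [c c0 h] := low_perturb kN l1 H1; exists c => //.
  by apply: filterS h => x /le_trans; apply; apply: Re_le_nc.
have [[K2 v2]|[k kN l1]] := an_order_dichotomy N a2; last first.
  right; exists k => //; have [c c0 h] := low_perturb kN l1 H2; exists c => //.
  by apply: filterS h => x /le_trans; apply; apply: Im_le_nc.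
left; apply/vanishesP; exists (K1 + K + (K2 + K)).
apply: filterS2 (filterI H1 H2) (filterI v1 v2) => x [h1 h2] [h3 h4].
apply: (le_trans (nc_le_ReIm _)).
have h5 := ler_normD (Re (f x) - g1 x) (g1 x); rewrite subrK in h5.
have h6 := ler_normD (Im (f x) - g2 x) (g2 x); rewrite subrK in h6.
by rewrite !mulrDl; lra.
Qed.

Lemma an_lip (g : R -> R) : analytic g -> g 0 = 0 ->
  exists2 A, 1 <= A & \forall x \near (0 : R), `|g x| <= A * `|x|.
Proof.
move=> ag g0; have [[K HK]|[k kN [c c0 /nbhs_singleton]]] := an_order_dichotomy 1 ag.
  exists (Num.max 1 K); first by rewrite le_max lexx.
  apply: filterS HK => x /le_trans; apply; rewrite expr1 ler_wpM2r // le_max lexx orbT //.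
by move: kN; rewrite ltnS leqn0 => /eqP ->; rewrite g0 normr0 expr0 mulr1 leNgt c0.
Qed.

Lemma an_prod (I : Type) (s : seq I) (Q : pred I) (f : I -> R -> R) : (forall i, analytic (f i)) ->
  analytic (fun x => \prod_(i <- s | Q i) f i x).
Proof.
move=> af; elim: s => [|i s IH].
  by apply: an_ext (an_cst 1); apply: near0_all => x; rewrite big_nil.
apply: (an_ext (f := fun x => (if Q i then f i x else 1) * \prod_(i <- s | Q i) f i x)).
  by apply: near0_all => x; rewrite big_cons; case: (Q i); rewrite ?mul1r.
by apply: an_mul IH; case: (Q i); [apply: af|apply: an_cst].
Qed.

Lemma an_horner (p : {poly R}) : analytic (fun x => p.[x]).
Proof.
apply: (an_ext (f := fun x => \sum_(i < size p) p`_i * x ^+ i)).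
  by apply: near0_all => x; rewrite horner_coef.
by apply: an_sum => i; apply: an_mul (an_cst _) (an_exp _ (an_id _)).
Qed.

Lemma an_fibK (M : nat) (L : 'I_M -> nat) (q : 'I_M -> {poly R}) (g : R -> R) : analytic g ->
  analytic (fun x => fibK (qx q x) (ex L x) (g x)).
Proof.
move=> ag; apply: an_sum => k; apply: an_mul; first exact: an_exp (an_id _).
apply: an_prod => i; apply: an_add; apply: an_exp; last exact: an_exp (an_id _).
by apply: an_add => //; apply: an_horner.
Qed.

(** Composing the double series with a branch is avoided: a truncation is a polynomial in [x] and
    [g x], hence analytic, and the error is [O(|x| ^+ N)] because [|g x| <= A * |x|]. *)
Lemma series2_order_dichotomy (c : nat -> nat -> C) r K (g : R -> R) N : 0 < r -> 0 <= K ->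
  (forall m n, normc (c m n) * r ^+ (m + n) <= K) -> analytic g -> g 0 = 0 ->
  let f x := eval_series2 c (toC x) (toC (g x)) in
  vanishes_to f N \/ exists2 k, (k < N)%N & lower_order (fun x => normc (f x)) k.
Proof.
move=> r0 K0 cK ag g0 f; have [A A1 HA] := an_lip ag g0.
have A0 : 0 < A by apply: lt_le_trans A1.
(* [h] stands for the real or the imaginary part; additivity and real homogeneity are what the two
   share. *)
have part (h : C -> R) (hD : {morph h : x y / x + y}) (h0 : h 0 = 0) (hs : forall z x, h (z * toC x) = h z * x) :
    analytic (fun x => h (psum2 c (toC x) (toC (g x)) N)).
  apply: (an_ext (f := fun x => \sum_(m < N) \sum_(n < N) h (c m n) * (x ^+ m * g x ^+ n))).
    apply: near0_all => x; rewrite /psum2 (big_morph h hD h0); apply: eq_bigr => m _.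
    rewrite (big_morph h hD h0); apply: eq_bigr => n _.
    by rewrite -hs rmorphM !rmorphXn mulrA.
  apply: an_sum => m; apply: an_sum => n; apply: an_mul (an_cst _) (an_mul _ _).
    exact: an_exp (an_id _).
  exact: an_exp.
have d0 : 0 < r / (2 * A) by rewrite divr_gt0 // mulr_gt0.
have appr : \forall x \near (0 : R), normc (f x - psum2 c (toC x) (toC (g x)) N) <= 16 * K * (A / r) ^+ N * `|x| ^+ N.
  apply: filterS2 HA (near0_lt d0) => x h xd.
  have [||||_ _ /(_ N) H] := @eval_series2_approx _ c r K r0 K0 cK (toC x) (toC (g x)) (A * `|x| / r).
  - by rewrite nc_real divfK ?gt_eqF // ler_peMl.
  - by rewrite nc_real divfK ?gt_eqF.
  - by rewrite divr_ge0 ?mulr_ge0 ?(ltW A0) ?(ltW r0).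
  - rewrite ler_pdivrMr //; move: xd; rewrite ltr_pdivlMr ?mulr_gt0 // => xd.
    by nra.
  - apply: (le_trans H); rewrite -[X in _ <= X]mulrA -exprMn [A / r * _](_ : _ = A * `|x| / r) //.
    by rewrite mulrAC.
apply: (complex_order_dichotomy (K := 16 * K * (A / r) ^+ N)
  (part Re (fun x y => raddfD _ x y) erefl _) (part Im (fun x y => raddfD _ x y) erefl _)).
- by move=> [u v] x /=; rewrite mulr0 subr0.
- by move=> [u v] x /=; rewrite mulr0 add0r.
- by apply: filterS appr => x; apply: le_trans; rewrite -raddfB; apply: Re_le_nc.
- by apply: filterS appr => x; apply: le_trans; rewrite -raddfB; apply: Im_le_nc.
Qed.

End Orders.

(** * Iterated integrals of nonnegative functions over rectangles *)

Section Tonelli.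
Context d1 d2 (T1 : measurableType d1) (T2 : measurableType d2) (R : realType).
Variables (m1 : {sigma_finite_measure set T1 -> \bar R}) (m2 : {sigma_finite_measure set T2 -> \bar R}).
Variables (A1 : set T1) (A2 : set T2) (f : T1 * T2 -> R).
Hypotheses (mA1 : measurable A1) (mA2 : measurable A2).
Hypothesis mf : measurable_fun (A1 `*` A2) f.
Hypothesis f0 : forall p, 0 <= f p.

Let g := (EFin \o f) \_ (A1 `*` A2).

Let gE x y : g (x, y) = if (x \in A1) && (y \in A2) then (f (x, y))%:E else 0%E.
Proof. by rewrite /g patchE in_setX. Qed.

Let g0 p : (0 <= g p)%E.
Proof. by rewrite /g patchE; case: ifP => // _; rewrite lee_fin. Qed.

Let mg : measurable_fun setT g.
Proof.
apply: (proj1 (measurable_restrictT _ _)); first exact: measurableX.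
exact/measurable_EFinP.
Qed.

Let innerE x : A1 x -> (\int[m2]_y g (x, y) = \int[m2]_(y in A2) (f (x, y))%:E)%E.
Proof.
move=> xA; rewrite [RHS]integral_mkcond; apply: eq_integral => y _.
by rewrite gE patchE mem_set.
Qed.

Lemma measurable_inner : measurable_fun A1 (fun x => \int[m2]_(y in A2) (f (x, y))%:E)%E.
Proof.
have hT : measurable_fun setT (fubini_F m2 g) by apply: measurable_fun_fubini_tonelli_F.
have h := measurable_funTS (D := A1) hT.
apply: eq_measurable_fun h => x; rewrite inE => xA.
by rewrite /fubini_F innerE.
Qed.

Lemma tonelli_rect :
  (\int[m1 \x m2]_(p in A1 `*` A2) (f p)%:E = \int[m1]_(x in A1) \int[m2]_(y in A2) (f (x, y))%:E)%E.
Proof.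
have mA : measurable (A1 `*` A2) by apply: measurableX.
rewrite integral_mkcond (fubini_tonelli1 _ mg g0) [RHS]integral_mkcond.
apply: eq_integral => x _; rewrite patchE /fubini_F.
case: ifPn => [|xA]; first by rewrite inE => xA; rewrite innerE.
by apply: integral0_eq => y _; rewrite gE (negbTE xA).
Qed.

End Tonelli.

(** * Divergence of the integral of 1/x *)

Section InverseNotIntegrable.
Variable R : realType.
Local Notation mu := (@lebesgue_measure R).

Lemma inv_not_integrable (del c : R) : 0 < del -> 0 < c ->
  (\int[mu]_(x in `]0%R, del[) (c * x^-1)%:E = +oo)%E.
Proof.
move=> d0 c0.
have mi D : measurable_fun D (fun x : R => c * x^-1).
  by apply: measurable_funTS; apply: measurable_funM; [exact: measurable_cst|exact: measurable_inv].
have cinv (x : R) : 0 < x -> {for x, continuous (fun x : R => c * x^-1)}.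
  move=> x0; have x1 : x != 0 by rewrite gt_eqF.
  exact: (continuousM (@cst_continuous _ _ c x) (inv_continuous x1)).
have key ep : 0 < ep -> ep < del / 2 -> ((c * (ln (del / 2) - ln ep))%:E <= \int[mu]_(x in `]0%R, del[) (c * x^-1)%:E)%E.
  move=> e0 ed.
  have E : (\int[mu]_(x in `[ep, (del / 2)%R]) (c * x^-1)%:E = (c * ln (del / 2) - c * ln ep)%:E)%E.
    apply: (ftc_closed (F := fun x => c * ln x) ed).
    - move=> x; rewrite in_itv /= => /andP[ex _].
      have x0 : 0 < x by apply: lt_le_trans ex.
      apply: rderiv_eq (rderivM (is_derive_cst c x 1) (is_derive1_ln x0)) _.
      by rewrite mulr0 addr0.
    - move=> x; rewrite in_itv /= => /andP[ex _]; apply: cinv.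
      by apply: lt_le_trans ex.
  rewrite mulrBr -E; apply: subset_integral_EFin.
  - exact: measurable_itv.
  - exact: measurable_itv.
  - move=> x /=; rewrite !in_itv /= => /andP[h1 h2].
    rewrite (lt_le_trans e0 h1) (le_lt_trans h2) // ltr_pdivrMr //.
    by rewrite mulr_natr mulr2n ltrDl.
  - exact: mi.
  - move=> x /=; rewrite in_itv /= => /andP[h1 _]; rewrite mulr_ge0 ?invr_ge0 ?(ltW c0) //; exact: ltW.
set I := (\int[mu]_(x in _) _)%E in key *.
have [//|Iy] := eqVneq I +oo%E.
have I0 : (0 <= I)%E.
  apply: integral_ge0 => x /=; rewrite in_itv /= => /andP[h1 _].
  by rewrite lee_fin mulr_ge0 ?invr_ge0 ?(ltW c0) //; exact: ltW.
have If : I \is a fin_num by rewrite ge0_fin_numE // lt_neqAle Iy leey.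
rewrite -(fineK If) in key I0; set Ir := fine I in key I0.
(* Chosen so that the lower bound [key] equals [Ir + 1], one more than the supposed finite value of
   the integral. *)
pose ep := expR (ln (del / 2) - (Ir + 1) / c).
have l2 : 0 < Ir + 1 by rewrite lee_fin in I0; rewrite ltr_wpDl.
have := key ep (expR_gt0 _); rewrite lee_fin /ep expRK.
have -> : c * (ln (del / 2) - (ln (del / 2) - (Ir + 1) / c)) = Ir + 1 by field; rewrite gt_eqF.
rewrite leNgt ltrDl ltr01 /= => H; exfalso; have : false; last by []; apply: H.
rewrite -[ltRHS]lnK ?posrE ?divr_gt0 // ltr_expR gtrBl divr_gt0 //.
Qed.

End InverseNotIntegrable.

Section IntegralFinite.
Context d (T : measurableType d) (R : realType).
Variables (m : {measure set T -> \bar R}) (D : set T) (f : T -> \bar R).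
Hypotheses (mD : measurable D) (fD : (m D < +oo)%E) (mf : measurable_fun D f).
Hypothesis f0 : forall x, D x -> (0 <= f x)%E.

Lemma integral_cst_lt c : 0 <= c -> (\int[m]_(x in D) c%:E < +oo)%E.
Proof.
move=> c0; rewrite integral_cst //.
by apply: lte_mul_pinfty => //; rewrite lee_fin.
Qed.

Lemma integral_affine_lt c1 c2 : 0 <= c1 -> 0 <= c2 -> (\int[m]_(x in D) f x < +oo)%E ->
  (\int[m]_(x in D) (c1%:E + c2%:E * f x) < +oo)%E.
Proof.
move=> h1 h2 fi.
have mc : measurable_fun D (fun x => c2%:E * f x)%E by apply: measurable_funeM.
rewrite ge0_integralD //.
- apply: lte_add_pinfty; first exact: integral_cst_lt.
  rewrite ge0_integralZl_EFin //.
  by apply: lte_mul_pinfty => //; rewrite lee_fin.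
- by move=> x Dx; apply: mule_ge0; rewrite ?lee_fin ?f0.
Qed.

(** In the application the null set is the point [0], over which no fiber bound is available. *)
Lemma integral_bounded_lt (N : set T) c : measurable N -> m N = 0%E -> 0 <= c ->
  (forall x, D x -> ~ N x -> (f x <= c%:E)%E) -> (\int[m]_(x in D) f x < +oo)%E.
Proof.
move=> mN N0 c0 H; rewrite (ge0_negligible_integral mN) //.
apply: (@le_lt_trans _ _ (\int[m]_(x in D `\` N) c%:E)%E).
  apply: ge0_le_integral => //.
  - exact: measurableD.
  - by move=> x [Dx _]; apply: f0.
  - by apply: measurable_funS mf => //; apply: subDsetl.
  - by move=> x [Dx Nx]; apply: H.
rewrite integral_cst; last exact: measurableD.
apply: lte_mul_pinfty => //.
apply: le_lt_trans fD; apply: le_measure; rewrite ?inE //; exact: measurableD.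
Qed.

End IntegralFinite.

(** * Upper bound for the fiber integral *)

Section Upper.
Variable R : realType.
Local Notation C := R[i].
Local Notation toC := (real_complex R).
Local Notation mu := (@lebesgue_measure R).
Variables (M : nat) (q eta : 'I_M -> R) (t : R) (a : 'I_M -> R).
Hypothesis eta0 : forall k, 0 < eta k.
Hypothesis aF : fibF q eta t = \prod_j ('X - (toC (a j))%:P).
Variables (Q : C -> C) (CF C1 e : R).
Hypothesis e0 : 0 < e.
Hypothesis CF0 : 0 <= CF.
Hypothesis C10 : 0 <= C1.
Local Notation P := (fibP q eta).
Local Notation N := (lagr a (fun j => Q (toC (a j)))).
Hypothesis HC : forall j, sqnormC (Q (toC (a j))) <= C1 * fibK q eta (a j).
Hypothesis QN : forall y : R, `|y| < e -> normc (Q (toC y) - N.[toC y]) <= CF * normc (fibF q eta t).[toC y].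
Hypothesis mQ : cmeas `](- e)%R, e[ (fun y => Q (toC y)).

Lemma sqr_sum_le (I : Type) (s : seq I) (f : I -> R) :
  (\sum_(i <- s) f i) ^+ 2 <= 2 ^+ size s * \sum_(i <- s) f i ^+ 2.
Proof.
elim: s => [|i s IH]; first by rewrite !big_nil expr0n mulr0.
rewrite !big_cons /= [2 ^+ _.+1]exprS.
set S := \sum_(i <- s) f i in IH *; set T := \sum_(i <- s) f i ^+ 2 in IH *.
have h : 1 <= 2 ^+ size s :> R by rewrite exprn_ege1 // ler1n.
have h2 := sqr_ge0 (f i - S).
have h3 : f i ^+ 2 <= 2 ^+ size s * f i ^+ 2 by rewrite ler_peMl ?sqr_ge0.
have -> : 2 * 2 ^+ size s * (f i ^+ 2 + T) = 2 * (2 ^+ size s * f i ^+ 2) + 2 * (2 ^+ size s * T) by ring.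
have -> : (f i + S) ^+ 2 = 2 * f i ^+ 2 + 2 * S ^+ 2 - (f i - S) ^+ 2 by ring.
by lra.
Qed.

(** Since [K(a_j) = beta_j F_j(a_j)^2], the hypothesis bounds the square of the interpolation
    coefficient of [F_j] by [C1 * beta_j]; the sum of the [beta_j F_j(y)^2] is [K(y)]. *)
Lemma sqnorm_lagr_le y : sqnormC N.[toC y] <= 2 ^+ M * C1 * fibK q eta y.
Proof.
rewrite -normc_sqr /lagr horner_sum.
apply: (@le_trans _ _ ((\sum_(j < M) normc (((Q (toC (a j)) / toC (rFj a j (a j))) *: Fj a j).[toC y])) ^+ 2)).
  by apply: lerXn2r; rewrite ?nnegrE ?normc_ge0 ?nc_sum //; apply: sumr_ge0 => j _; apply: normc_ge0.
apply: (le_trans (sqr_sum_le _ _)).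
have -> : size (index_enum 'I_M) = M by rewrite /index_enum unlock -enumT size_enum_ord.
rewrite -mulrA ler_wpM2l ?exprn_ge0 // (fibK_sum_sqr eta0 aF) mulr_sumr; apply: ler_sum => j _.
rewrite hornerZ Fj_real !ncM !exprMn normcV !nc_real exprVn !real_normK ?num_real // normc_sqr mulrA.
rewrite ler_wpM2r ?sqr_ge0 // ler_pdivrMr ?exprn_even_gt0 ?(rFj_neq0 eta0 aF) //.
by rewrite -mulrA -(betaK eta0 aF).
Qed.

Lemma upper_point y : `|y| < e ->
  sqnormC (Q (toC y) / P.[toC y]) <= 2 * (2 ^+ M * C1) * phi q eta y + 2 * CF ^+ 2 * (1 + t ^+ 2).
Proof.
move=> ye; have p0 := sqnorm_fibP_gt0 q eta0 y.
have Vs (z : C) : sqnormC z^-1 = (sqnormC z)^-1 by rewrite -!normc_sqr normcV exprVn.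
rewrite sqnormCM !Vs ler_pdivrMr // mulrDl.
have h : normc (Q (toC y)) <= normc N.[toC y] + CF * normc (fibF q eta t).[toC y].
  have := ncD N.[toC y] (Q (toC y) - N.[toC y]).
  rewrite addrC subrK => /le_trans; apply.
  by rewrite lerD2l; apply: QN.
have h2 : normc (fibF q eta t).[toC y] ^+ 2 <= (1 + t ^+ 2) * sqnormC P.[toC y].
  by rewrite fibF_eval_real nc_real real_normK ?num_real // sqnorm_fibF_le.
rewrite -normc_sqr; apply: (@le_trans _ _ ((normc N.[toC y] + CF * normc (fibF q eta t).[toC y]) ^+ 2)).
  by apply: lerXn2r; rewrite ?nnegrE ?normc_ge0 // addr_ge0 ?mulr_ge0 ?normc_ge0.
apply: (le_trans (sqr_add_le _ (ler_wpM2l (sqr_ge0 CF) h2))).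
rewrite lerD2r -!mulrA ler_wpM2l // normc_sqr mulrA.
by rewrite -fibK_phi // -mulrA mulrA; apply: sqnorm_lagr_le.
Qed.

Lemma upper_bound :
  (\int[mu]_(y in `](- e)%R, e[) (sqnormC (Q (toC y) / P.[toC y]))%:E <=
   (2 * (2 ^+ M * C1) * (M%:R * pi) + 2 * CF ^+ 2 * (1 + t ^+ 2) * (2 * e))%:E)%E.
Proof.
have mphi : measurable_fun `](- e)%R, e[ (phi q eta) by exact: continuous_measurable (continuous_phi eta0).
have k0 : 0 <= 2 * (2 ^+ M * C1) by rewrite mulr_ge0 // mulr_ge0 // exprn_ge0.
have c0 : 0 <= 2 * CF ^+ 2 * (1 + t ^+ 2).
  by apply: mulr_ge0; [apply: mulr_ge0; rewrite ?sqr_ge0|rewrite addr_ge0 ?sqr_ge0].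
have mk : measurable_fun `](- e)%R, e[ (fun y => 2 * (2 ^+ M * C1) * phi q eta y).
  by apply: measurable_funM; [exact: measurable_cst|exact: mphi].
apply: (@le_trans _ _ (\int[mu]_(y in `](- e)%R, e[) (2 * (2 ^+ M * C1) * phi q eta y + 2 * CF ^+ 2 * (1 + t ^+ 2))%:E)%E).
  apply: le_integral_EFin.
  - exact: measurable_itv.
  - apply: meas_sqnorm; apply: cmeasM; first exact: mQ.
    apply: cmeasV; apply: cmeas_poly; apply: cmeas_real; exact: measurable_id.
  - by apply: measurable_funD; [exact: mk|exact: measurable_cst].
  - by move=> y _; rewrite -normc_sqr sqr_ge0.
  - move=> y; rewrite /= in_itv /= => ye; apply: upper_point; rewrite ltr_norml; exact ye.
have mc : measurable_fun `](- e)%R, e[ (fun=> 2 * CF ^+ 2 * (1 + t ^+ 2)) by exact: measurable_cst.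
rewrite ge0_integralD_real; [|exact: measurable_itv|exact: mk|exact: mc| |]; last 2 first.
- by move=> y _; rewrite mulr_ge0 ?phi_ge0.
- by move=> y _; exact: c0.
rewrite ge0_integralZ_real; [|exact: measurable_itv|exact: mphi|by move=> y _; apply: phi_ge0|exact: k0].
rewrite integral_cst; last exact: measurable_itv.
rewrite /= lebesgue_measure_itv /= lte_fin ifT; last by move: (e0); lra.
rewrite -EFinD -EFinM [e - - e](_ : _ = 2 * e); last by ring.
rewrite EFinD leeD2r // [X in (_ <= X)%E]EFinM; apply: lee_wpmul2l; first by rewrite lee_fin.
exact: (integral_phi_le q eta0 e0).
Qed.

End Upper.

(** * The integrability criterion *)

Lemma leq_uphalf2 n : (n <= uphalf n * 2)%N. Proof. lia. Qed.
Lemma ltn_uphalf2 k n : (k < uphalf n)%N -> (k * 2 < n)%N. Proof. lia. Qed.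

Section Assembly.
Variable R : realType.
Local Notation C := R[i].
Local Notation toC := (real_complex R).
Local Notation Re := (@complex.Re R).
Local Notation Im := (@complex.Im R).
Local Notation mu := (@lebesgue_measure R).

(** In characteristic zero the integers already provide more distinct roots than the degree of the
    difference allows. *)
Lemma poly_eq_horner (p1 p2 : {poly C}) : (forall z, p1.[z] = p2.[z]) -> p1 = p2.
Proof.
move=> E; apply/eqP; rewrite -subr_eq0; apply/eqP.
apply: (@roots_geq_poly_eq0 _ _ [seq (k%:R : C) | k <- iota 0 (size (p1 - p2))]).
- by apply/allP => z _; apply/rootP; rewrite hornerD hornerN E subrr.
- by rewrite map_inj_uniq ?iota_uniq // => i j /eqP; rewrite eqr_nat => /eqP.
- by rewrite size_map size_iota.
Qed.

Lemma an_small (g : R -> R) (e : R) : analytic g -> g 0 = 0 -> 0 < e -> \forall x \near (0 : R), `|g x| <= e.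
Proof.
move=> /an_continuous0/cvgrPdist_lt cg g0 e0; apply: filterS (cg _ e0) => x.
by rewrite g0 sub0r normrN => /ltW.
Qed.

Lemma near0_andI (P Q : R -> Prop) : (\forall x \near (0 : R), P x) -> (\forall x \near (0 : R), Q x) ->
  \forall x \near (0 : R), P x /\ Q x.
Proof. exact: filterI. Qed.

Lemma near0_and (P Q : R -> Prop) : (\forall x \near (0 : R), P x) -> (\forall x \near (0 : R), Q x) ->
  exists e : R, 0 < e /\ forall x : R, `|x| < e -> P x /\ Q x.
Proof. by move=> HP HQ; apply/near0P; apply: near0_andI. Qed.

Lemma square_itv (e : R) : [set p : R * R | `|p.1| < e /\ `|p.2| < e] = `](- e), e[%classic `*` `](- e), e[%classic.
Proof.
apply/seteqP; split => [[x y]|[x y]] /=; rewrite !in_itv /= -!ltr_norml; by move=> [].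
Qed.

Variables (M : nat) (L : 'I_M -> nat) (q : 'I_M -> {poly R}) (t : R).
Hypothesis hL : forall j, (0 < L j)%N.
Hypothesis hq0 : forall j, (q j).[0] = 0.
Variable a : 'I_M -> R -> R.
Hypothesis aan : forall j, analytic (a j).
Hypothesis a0 : forall j, a j 0 = 0.
Hypothesis aF : \forall x \near (0 : R), fibF (qx q x) (ex L x) t = \prod_j ('X - (toC (a j x))%:P).
Variables (c : nat -> nat -> C) (r K : R).
Hypothesis r0 : 0 < r.
Hypothesis K0 : 0 <= K.
Hypothesis cK : forall m n, normc (c m n) * r ^+ (m + n) <= K.

Local Notation Qv x y := (eval_series2 c (toC x) (toC y)).
Local Notation PP x := (fibP (qx q x) (ex L x)).
Local Notation KK j x := (fibK (qx q x) (ex L x) (a j x)).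

Lemma node_small (e : R) : 0 < e -> \forall x \near (0 : R), forall k, normc (node (qx q x) (ex L x) k) <= e.
Proof.
move=> e0; apply: near0_forall => k; have e20 : 0 < e / 2 by rewrite divr_gt0.
have h1 : \forall x \near (0 : R), `|qx q x k| <= e / 2.
  by apply: an_small => //; [apply: an_horner|apply: hq0].
have h2 : \forall x \near (0 : R), `|ex L x k| <= e / 2.
  apply: an_small => //; first by apply: an_exp; apply: an_id.
  by rewrite /ex expr0n muln_eq0 /= eqn0Ngt hL.
apply: filterS2 h1 h2 => x h1 h2; apply: (le_trans (nc_le_ReIm _)) => /=.
by rewrite [X in _ <= X](splitr e) lerD.
Qed.

(** A pointwise limit of polynomials in [u] and [v]; the bounds by [r / 2] keep the points where the
    partial sums converge. *)
Lemma cmeas_Q d (T : measurableType d) (D : set T) (u v : T -> R) : measurable D ->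
  measurable_fun D u -> measurable_fun D v ->
  (forall p, D p -> `|u p| <= r / 2 /\ `|v p| <= r / 2) -> cmeas D (fun p => Qv (u p) (v p)).
Proof.
move=> mD mu mv H.
have mS N : cmeas D (fun p => psum2 c (toC (u p)) (toC (v p)) N).
  apply: cmeas_sum => m; apply: cmeas_sum => n.
  by apply: cmeasM; [apply: cmeasM; [apply: cmeas_cst|]|]; apply: cmeasX; apply: cmeas_real.
have cv p : D p -> ((fun N => Re (psum2 c (toC (u p)) (toC (v p)) N)) @ \oo --> Re (Qv (u p) (v p))) /\
   ((fun N => Im (psum2 c (toC (u p)) (toC (v p)) N)) @ \oo --> Im (Qv (u p) (v p))).
  move=> Dp; have [h1 h2] := H p Dp.
  have [||||cR cI _] := @eval_series2_approx _ c r K r0 K0 cK (toC (u p)) (toC (v p)) 2^-1 => //.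
  - by rewrite nc_real mulrC.
  - by rewrite nc_real mulrC.
split.
  apply: (measurable_fun_cvg (h := fun N p => Re (psum2 c (toC (u p)) (toC (v p)) N))) => [N|p Dp].
    exact: (proj1 (mS N)).
  exact: (proj1 (cv p Dp)).
apply: (measurable_fun_cvg (h := fun N p => Im (psum2 c (toC (u p)) (toC (v p)) N))) => [N|p Dp].
  exact: (proj2 (mS N)).
exact: (proj2 (cv p Dp)).
Qed.

Lemma cmeas_P d (T : measurableType d) (D : set T) (u v : T -> R) : measurable D ->
  measurable_fun D u -> measurable_fun D v -> cmeas D (fun p => (PP (u p)).[toC (v p)]).
Proof.
move=> mD mu mv.
apply: (cmeas_ext (g := fun p => \prod_k (toC (v p) + (polyRC (q k) + iC R *: 'X^(2 * L k)).[toC (u p)]))).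
  by move=> p; rewrite fibP_eval; apply: eq_bigr => k _; rewrite factor_eval.
apply: cmeas_prod => k; apply: cmeasD; first exact: cmeas_real.
by apply: cmeas_poly; apply: cmeas_real.
Qed.

Definition CQ : R := 4 * K * (2 / r) ^+ M.

Lemma CQ_ge0 : 0 <= CQ.
Proof. by rewrite mulr_ge0 ?exprn_ge0 ?divr_ge0 ?(ltW r0) // mulr_ge0. Qed.

Lemma branch_value_le (e : R) : 0 < e -> e <= 1 -> e <= r / 2 ->
  exists c1 c2 : R, [/\ 0 <= c1, 0 <= c2 & \forall x \near (0 : R), x != 0 -> forall j,
  ((sqnormC (Qv x (a j x)) / KK j x)%:E <=
   c1%:E + c2%:E * \int[mu]_(y in `](- e)%R, e[) (sqnormC (Qv x y / (PP x).[toC y]))%:E)%E].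
Proof.
(* [V0] bounds [|N| <= |Q| + CQ * |F|] on [|z| <= e]: the first term is at most [16 * K], and
   [|F| <= 2 ^ M] since each factor is at most [e + e / 4 <= 2]. *)
move=> e0 e1 er; pose V0 := 16 * K + CQ * 2 ^+ M.
have l1 := lowC1_ge0 M t e V0; have l2 := lowC2_ge0 M t; have CQ0 := CQ_ge0.
exists ((1 + t ^+ 2) * (2 * lowC1 M t e V0 + 2 * lowC2 M t * (2 * CQ ^+ 2 * (1 + t ^+ 2) * (2 * e)))),
  ((1 + t ^+ 2) * (2 * lowC2 M t * 2)).
have t0 : 0 <= 1 + t ^+ 2 by rewrite addr_ge0 ?sqr_ge0.
split.
- apply: mulr_ge0 => //; apply: addr_ge0; first exact: mulr_ge0.
  apply: mulr_ge0; first exact: mulr_ge0.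
  apply: mulr_ge0; last by rewrite mulr_ge0 // ltW.
  by apply: mulr_ge0 => //; rewrite mulr_ge0 ?sqr_ge0.
- by apply: mulr_ge0 => //; apply: mulr_ge0 => //; apply: mulr_ge0.
have e8 : 0 < e / 8 by rewrite divr_gt0.
have ha : \forall x \near (0 : R), forall j, `|a j x| <= e / 4.
  by apply: near0_forall => j; apply: an_small; rewrite ?divr_gt0.
apply: filterS2 (filterI aF (near0_lt e0)) (filterI ha (node_small e8)) => x [aFx xe] [ax nx] x0 j.
have eta0 k : 0 < ex L x k by apply: ex_gt0.
have xr : normc (toC x) <= r / 2 by rewrite nc_real (le_trans (ltW xe)).
have ar i : `|a i x| <= r / 2 by apply: (le_trans (ax i)); lra.
have QN z : normc z <= e -> normc (eval_series2 c (toC x) z - (lagr (a^~ x) (fun j => Qv x (a j x))).[z]) <= CQ * normc (fibF (qx q x) (ex L x) t).[z].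
  by move=> ze; apply: (lagrange_approx r0 K0 cK eta0 aFx ar xr); apply: le_trans er.
apply: (lower_bound (Q := eval_series2 c (toC x)) (V0 := V0) eta0 aFx e0 e1 CQ0 nx ax).
- move=> z ze.
  have hQ : normc (eval_series2 c (toC x) z) <= 16 * K.
    by apply: (eval_series2_bound r0 K0 cK xr); apply: le_trans er.
  have := ncB (eval_series2 c (toC x) z) (eval_series2 c (toC x) z - (lagr (a^~ x) (fun j => Qv x (a j x))).[z]).
  rewrite opprB addrCA subrr addr0 => /le_trans; apply; apply: lerD => //.
  apply: (le_trans (QN z ze)); rewrite ler_wpM2l // aFx horner_prod nc_prod.
  rewrite -[X in _ ^+ X]card_ord -prodr_const; apply: ler_prod => i _; rewrite normc_ge0 /=.
  rewrite hornerXsubC; apply: (le_trans (ncB _ _)); rewrite nc_real.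
  have := lerD ze (ax i); move=> /le_trans; apply; lra.
- by move=> y ye; apply: QN; rewrite nc_real ltW.
- apply: (cmeas_Q (u := fun=> x) (v := fun y => y)).
  + exact: measurable_itv.
  + exact: measurable_cst.
  + exact: measurable_id.
  + move=> y; rewrite /= in_itv /= -ltr_norml => ye; split; first by rewrite -nc_real.
    by apply: (le_trans (ltW ye)).
Qed.

Lemma fiber_integral_bounded (C1 : R) : 0 <= C1 ->
  (\forall x \near (0 : R), forall j, sqnormC (Qv x (a j x)) <= C1 * `|KK j x|) ->
  exists e C2 : R, [/\ 0 < e, e <= r / 2, 0 <= C2 & forall x, `|x| < e -> x != 0 ->
  (\int[mu]_(y in `](- e)%R, e[) (sqnormC (Qv x y / (PP x).[toC y]))%:E <= C2%:E)%E].
Proof.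
move=> C10 HC; have r20 : 0 < r / 2 by rewrite divr_gt0.
have ha : \forall x \near (0 : R), forall j, `|a j x| <= r / 2.
  by apply: near0_forall => j; apply: an_small.
have [e' [e'0 He']] := near0_and (near0_andI aF ha) HC.
pose e := Num.min e' (r / 2); have e0 : 0 < e by rewrite lt_min e'0.
have er : e <= r / 2 by rewrite ge_min lexx orbT.
exists e, (2 * (2 ^+ M * C1) * (M%:R * pi) + 2 * CQ ^+ 2 * (1 + t ^+ 2) * (2 * e)); split => //.
  apply: addr_ge0; apply: mulr_ge0.
  - by rewrite mulr_ge0 // mulr_ge0 // exprn_ge0.
  - by rewrite mulr_ge0 // pi_ge0.
  - by apply: mulr_ge0; [rewrite mulr_ge0 ?sqr_ge0|rewrite addr_ge0 ?sqr_ge0].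
  - by rewrite mulr_ge0 // ltW.
move=> x xe x0; have [|[aFx ax] HCx] := He' x; first by apply: lt_le_trans xe _; rewrite ge_min lexx.
have eta0 k : 0 < ex L x k by apply: ex_gt0.
have xr : normc (toC x) <= r / 2 by rewrite nc_real (le_trans (ltW xe)).
apply: (upper_bound (Q := eval_series2 c (toC x)) eta0 aFx e0 CQ_ge0 C10).
- move=> j; apply: (le_trans (HCx j)); rewrite gtr0_norm //.
  exact: (fibK_root_gt0 (qx q x) eta0 (a^~ x) j).
- move=> y ye; apply: (lagrange_approx r0 K0 cK eta0 aFx ax xr).
  by rewrite nc_real (le_trans (ltW ye)).
- apply: (cmeas_Q (u := fun=> x) (v := fun y => y)).
  + exact: measurable_itv.
  + exact: measurable_cst.
  + exact: measurable_id.
  + move=> y; rewrite /= in_itv /= -ltr_norml => ye; split; first by rewrite -nc_real.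
    by apply: (le_trans (ltW ye)).
Qed.

Definition QP (p : R * R) : C := Qv p.1 p.2 / (PP p.1).[toC p.2].

Lemma cmeas_QP (A B : set R) : measurable A -> measurable B ->
  (forall x, A x -> `|x| <= r / 2) -> (forall y, B y -> `|y| <= r / 2) -> cmeas (A `*` B) QP.
Proof.
move=> mA mB hA hB; have mAB : measurable (A `*` B) by exact: measurableX.
have m1 : measurable_fun (A `*` B) (@fst R R) by apply: measurable_funTS; exact: measurable_fst.
have m2 : measurable_fun (A `*` B) (@snd R R) by apply: measurable_funTS; exact: measurable_snd.
apply: cmeasM.
  by apply: cmeas_Q => // p [/= p1 p2]; split; [apply: hA|apply: hB].
by apply: cmeasV; apply: cmeas_P.
Qed.

Lemma L2_upper (C1 : R) : 0 <= C1 ->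
  (\forall x \near (0 : R), forall j, sqnormC (Qv x (a j x)) <= C1 * `|KK j x|) -> L2loc QP.
Proof.
move=> C10 /(fiber_integral_bounded C10) [e [C2 [e0 er C20 H]]]; exists e; split=> //.
rewrite /L2_on square_itv.
have mI : measurable (`](- e), e[%classic : set R) by exact: measurable_itv.
have hI (y : R) : `](- e), e[%classic y -> `|y| < e by rewrite /= in_itv /= -ltr_norml.
have cm := cmeas_QP mI mI (fun y hy => le_trans (ltW (hI y hy)) er) (fun y hy => le_trans (ltW (hI y hy)) er).
split; first exact: measurableX.
split; first exact: (proj1 cm).
split; first exact: (proj2 cm).
have ms := meas_sqnorm cm.
have s0 p : 0 <= sqnormC (QP p) by rewrite -normc_sqr sqr_ge0.
rewrite (tonelli_rect mu mu mI mI ms s0).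
apply: (@integral_bounded_lt _ _ R mu _ _ _ _ _ _ [set 0] C2).
- exact: mI.
- by rewrite /= lebesgue_measure_itv /= lte_fin ifT ?ltry //; move: e0; lra.
- exact: (measurable_inner mu mI mI ms s0).
- by move=> x _; apply: integral_ge0 => y _; rewrite lee_fin s0.
- exact: measurable_set1.
- exact: lebesgue_measure_set1.
- exact: C20.
- move=> x xI xN; apply: H; first exact: hI.
  by apply/eqP => x0; apply: xN.
Qed.

Lemma L2_lower j : L2loc QP ->
  ~ (exists2 c0 : R, 0 < c0 & \forall x \near (0 : R), x != 0 -> c0 / `|x| <= sqnormC (Qv x (a j x)) / `|KK j x|).
Proof.
move=> [e' [e'0 [mU [mR [mI fin]]]]] [c0 c00 Hc].
have r20 : 0 < r / 2 by rewrite divr_gt0.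
pose e := Num.min e' (Num.min 1 (r / 2)).
have e0 : 0 < e by rewrite !lt_min e'0 ltr01.
have ee' : e <= e' by rewrite ge_min lexx.
have e1 : e <= 1 by rewrite !ge_min lexx orbT.
have er : e <= r / 2 by rewrite !ge_min lexx !orbT.
have [c1 [c2 [c10 c20 Hl]]] := branch_value_le e0 e1 er.
have [d' [d'0 Hd]] := near0_and Hl Hc.
pose d := Num.min d' e; have d0 : 0 < d by rewrite lt_min d'0.
have dd' : d <= d' by rewrite ge_min lexx.
have de : d <= e by rewrite ge_min lexx orbT.
(* The half [x > 0] suffices, because [1 / x] already has infinite integral over it. [d <= e] keeps
   this rectangle inside the region of integrability and convergence. *)
pose A : set R := `]0%R, d[%classic; pose B : set R := `](- e)%R, e[%classic.
have mA : measurable A by exact: measurable_itv.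
have mB : measurable B by exact: measurable_itv.
have hA x : A x -> 0 < x /\ `|x| < d.
  by rewrite /A /= in_itv /= => /andP[h1 h2]; rewrite gtr0_norm.
have hB y : B y -> `|y| < e by rewrite /B /= in_itv /= -ltr_norml.
have cm : cmeas (A `*` B) QP.
  apply: cmeas_QP => // [x /hA [_ h]|y /hB h]; last by rewrite (le_trans (ltW h)).
  by rewrite (le_trans (ltW h)) // (le_trans de).
have ms := meas_sqnorm cm.
have s0 p : 0 <= sqnormC (QP p) by rewrite -normc_sqr sqr_ge0.
have sub : A `*` B `<=` [set p : R * R | `|p.1| < e' /\ `|p.2| < e'].
  move=> [x y] [/= /hA [_ h1] /hB h2]; split; first exact: lt_le_trans h1 (le_trans de ee').
  exact: lt_le_trans h2 ee'.
have mAB : measurable (A `*` B) by exact: measurableX.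
have finAB : (\int[mu \x mu]_(p in A `*` B) (sqnormC (QP p))%:E < +oo)%E.
  apply: le_lt_trans fin; apply: subset_integral_EFin => //.
  exact: (meas_sqnorm (conj mR mI)).
rewrite (tonelli_rect mu mu mA mB ms s0) in finAB.
have mJ := measurable_inner mu mA mB ms s0.
pose J x := (\int[mu]_(y in B) (sqnormC (QP (x, y)))%:E)%E.
have J0 x : A x -> (0 <= J x)%E by move=> _; apply: integral_ge0 => y _; rewrite lee_fin s0.
have fA : (mu A < +oo)%E by rewrite /A /= lebesgue_measure_itv /= lte_fin d0 -EFinB ltry.
have fin2 : (\int[mu]_(x in A) (c1%:E + c2%:E * J x) < +oo)%E.
  by apply: integral_affine_lt; [exact: mA|exact: fA|exact: mJ|exact: J0|exact: c10|exact: c20|exact: finAB].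
move: fin2; apply/negP; rewrite -leNgt -(inv_not_integrable d0 c00).
apply: ge0_le_integral.
- exact: mA.
- by move=> x /hA [x0 _]; rewrite lee_fin mulr_ge0 ?invr_ge0 ?(ltW c00) ?(ltW x0).
- apply/measurable_EFinP; apply: measurable_funTS; apply: measurable_funM; [exact: measurable_cst|exact: measurable_inv].
- apply: emeasurable_funD; first exact: measurable_cst.
  exact: measurable_funeM.
move=> x /hA [x0 xd]; have xn : x != 0 by rewrite gt_eqF.
have [|h1 h2] := Hd x; first exact: lt_le_trans xd dd'.
apply: le_trans (h1 xn j); rewrite lee_fin.
have := h2 xn; rewrite (gtr0_norm x0) gtr0_norm //.
by apply: (fibK_root_gt0 (qx q x) _ (a^~ x) j) => k; apply: ex_gt0.
Qed.

(** With [n] the order of [g], the inequality amounts to [f] vanishing to order [uphalf n], half of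
    [n] rounded up. Otherwise [f] has order [k] with [2 * k <= n - 1], and [|f|^2 / |g|] is at least
    a multiple of [1 / |x|]. *)
Lemma order_condition_dichotomy (f : R -> C) (g : R -> R) : analytic g -> ~ (\forall x \near (0 : R), g x = 0) ->
  (forall N, vanishes_to f N \/ exists2 k, (k < N)%N & lower_order (fun x => normc (f x)) k) ->
  ((Ord (fun x => toC (g x)) <= Ord f * 2%:E)%E /\
   exists2 C1, 0 <= C1 & \forall x \near (0 : R), sqnormC (f x) <= C1 * `|g x|) \/
  (~ (Ord (fun x => toC (g x)) <= Ord f * 2%:E)%E /\
   exists2 c0, 0 < c0 & \forall x \near (0 : R), x != 0 -> c0 / `|x| <= sqnormC (f x) / `|g x|).
Proof.
move=> ag ng dich.
have [n [[cg cg0 lg] [Kg ug]]] := an_order_bounds ag ng.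
have le1 : \forall x \near (0 : R), `|x| < 1 by exact: near0_lt.
(* A lower bound by [|x| ^+ k] and an upper bound by [|x| ^+ m] are compared at one small [x > 0];
   this turns estimates into values of [Ord]. *)
have lv (h : R -> C) k m : lower_order (fun x => normc (h x)) k -> vanishes_to h m -> (m <= k)%N.
  move=> [c' c'0 l'] /vanishesP [K' v']; rewrite leqNgt; apply/negP => km.
  have [e1 [e10 H1]] := near0_and (near0_andI l' v') le1.
  pose x := Num.min (e1 / 2) (c' / (2 * (`|K'| + 1))).
  have k1 : 0 < `|K'| + 1 by rewrite ltr_wpDl.
  have x0 : 0 < x by rewrite lt_min !divr_gt0 // mulr_gt0.
  have xe : `|x| < e1.
    rewrite gtr0_norm //; apply: (@le_lt_trans _ _ (e1 / 2)); first by rewrite ge_min lexx.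
    by move: e10; lra.
  have [[h1 h2] h3] := H1 x xe; have := le_trans h1 h2; rewrite leNgt => /negP; apply.
  apply: (@le_lt_trans _ _ ((`|K'| + 1) * (`|x| * `|x| ^+ k))).
    apply: (@le_trans _ _ ((`|K'| + 1) * `|x| ^+ m)).
      by rewrite ler_wpM2r ?exprn_ge0 // (le_trans (ler_norm _)) // lerDl.
    by rewrite ler_wpM2l ?(ltW k1) // -exprS expr_norm_le // ltW.
  rewrite mulrA ltr_pM2r; last by rewrite exprn_gt0 // normr_gt0 gt_eqF.
  rewrite (gtr0_norm x0); apply: (@le_lt_trans _ _ ((`|K'| + 1) * (c' / (2 * (`|K'| + 1))))).
    by rewrite ler_wpM2l ?(ltW k1) // ge_min lexx orbT.
  have -> : (`|K'| + 1) * (c' / (2 * (`|K'| + 1))) = c' / 2 by field; rewrite gt_eqF.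
  by move: c'0; lra.
have OrdG : Ord (fun x => toC (g x)) = n%:R%:E.
  apply/eqP; rewrite eq_le; apply/andP; split.
    apply: ge_ereal_sup => _ [m vm <-]; rewrite lee_fin ler_nat.
    apply: (lv _ _ _ _ vm); exists cg => //.
    by apply: filterS lg => x; rewrite nc_real.
  apply: ereal_sup_ubound; exists n => //; apply/vanishesP; exists Kg.
  by apply: filterS ug => x; rewrite nc_real.
have e2 : (0 <= 2%:E :> \bar R)%E by rewrite lee_fin.
have [vf|[k kn lf]] := dich (uphalf n).
  left; split.
    have : (((uphalf n)%:R : R)%:E <= Ord f)%E by apply: ereal_sup_ubound; exists (uphalf n).
    move=> /(lee_wpmul2r e2) /(le_trans _); apply.
    by rewrite OrdG -EFinM lee_fin -natrM ler_nat leq_uphalf2.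
  move/vanishesP: vf => [Kf vf]; exists (Kf ^+ 2 / cg); first by rewrite divr_ge0 ?sqr_ge0 // ltW.
  apply: filterS2 (near0_andI vf lg) le1 => x [h1 h2] h3.
  rewrite -normc_sqr; apply: (@le_trans _ _ ((Kf * `|x| ^+ uphalf n) ^+ 2)).
    by apply: lerXn2r; rewrite ?nnegrE ?normc_ge0 // (le_trans (normc_ge0 _) h1).
  rewrite exprMn -exprM -[X in _ <= X]mulrA ler_wpM2l ?sqr_ge0 //.
  rewrite ler_pdivlMl //; apply: le_trans h2; rewrite ler_wpM2l ?(ltW cg0) //.
  by apply: expr_norm_le; [exact: ltW|exact: leq_uphalf2].
right; split.
  rewrite OrdG => H.
  have : (Ord f <= (k%:R : R)%:E)%E.
    by apply: ge_ereal_sup => _ [m vm <-]; rewrite lee_fin ler_nat; apply: (lv _ _ _ lf vm).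
  move=> /(lee_wpmul2r e2) h.
  by have := le_trans H h; rewrite -EFinM lee_fin -natrM ler_nat leqNgt ltn_uphalf2.
have [cf cf0 lf'] := lf.
have Kg1 : 0 < `|Kg| + 1 by rewrite ltr_wpDl.
exists (cf ^+ 2 / (`|Kg| + 1)); first by rewrite divr_gt0 // exprn_gt0.
apply: filterS2 (near0_andI lf' ug) (near0_andI lg le1) => x [h1 h2] [h3 h4] x0.
have ax0 : 0 < `|x| by rewrite normr_gt0.
have g0 : 0 < `|g x| by apply: lt_le_trans h3; rewrite mulr_gt0 // exprn_gt0.
rewrite ler_pdivlMr //.
apply: (@le_trans _ _ (cf ^+ 2 / (`|Kg| + 1) / `|x| * ((`|Kg| + 1) * `|x| ^+ n))).
  rewrite ler_wpM2l ?divr_ge0 ?sqr_ge0 ?(ltW Kg1) //; apply: (le_trans h2).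
  by rewrite ler_wpM2r ?exprn_ge0 // (le_trans (ler_norm _)) // lerDl.
have n0 := ltn_uphalf2 kn.
have -> : cf ^+ 2 / (`|Kg| + 1) / `|x| * ((`|Kg| + 1) * `|x| ^+ n) = cf ^+ 2 * `|x| ^+ n.-1.
  by rewrite -[in LHS](ltn_predK n0) [`|x| ^+ _.+1]exprS; field; rewrite !gt_eqF.
apply: (@le_trans _ _ ((cf * `|x| ^+ k) ^+ 2)).
  by rewrite exprMn -exprM ler_wpM2l ?sqr_ge0 // expr_norm_le ?(ltW h4) // -ltnS (ltn_predK n0).
rewrite -normc_sqr; apply: lerXn2r; rewrite ?nnegrE ?normc_ge0 //.
by rewrite mulr_ge0 ?exprn_ge0 // ltW.
Qed.

Lemma Ord_near (f g : R -> C) : (\forall x \near (0 : R), f x = g x) -> Ord f = Ord g.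
Proof.
move=> E; rewrite /Ord; congr (ereal_sup [set _ | _ in _]); apply/seteqP; split => n /= /vanishesP [K' H];
  apply/vanishesP; exists K'; apply: filterS2 E H => x E H; [rewrite -E|rewrite E]; exact: H.
Qed.

Lemma L2_iff_order : L2loc QP <-> forall j,
  (Ord (fun x => toC (KK j x)) <= Ord (fun x => Qv x (a j x)) * 2%:E)%E.
Proof.
have dich j := order_condition_dichotomy (f := fun x => Qv x (a j x)) (an_fibK L q (aan j)).
have nz j : ~ (\forall x \near (0 : R), KK j x = 0).
  move=> /near0P [e [e0 He]]; have h : e / 2 != 0 by rewrite gt_eqF // divr_gt0.
  have := fibK_root_gt0 (qx q (e / 2)) (fun k => ex_gt0 L k h) (a^~ (e / 2)) j.
  by rewrite He ?ltxx // gtr0_norm ?divr_gt0 //; move: e0; lra.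
have sd j N := series2_order_dichotomy N r0 K0 cK (aan j) (a0 j).
split=> [HL j|H].
  by have [[]|[_ Hc]] // := dich j (nz j) (sd j); case: (L2_lower HL Hc).
have /boolp.choice [C1 HC] : forall j, exists C1, 0 <= C1 /\ \forall x \near (0 : R), sqnormC (Qv x (a j x)) <= C1 * `|KK j x|.
  by move=> j; have [[_ [C1 C10 h]]|[]] := dich j (nz j) (sd j); first by exists C1.
(* A single constant for all branches: the sum dominates each [C1 j]. *)
apply: (@L2_upper (\sum_j C1 j)); first by apply: sumr_ge0 => j _; case: (HC j).
apply: near0_forall => j; have [_ h] := HC j; apply: filterS h => x /le_trans; apply.
rewrite ler_wpM2r // (bigD1 j) //= lerDl; apply: sumr_ge0 => i _; by case: (HC i).
Qed.

End Assembly.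

Theorem theorem5p1 (R : realType) (M : nat) (L : 'I_M -> nat)
  (q : 'I_M -> {poly R})
  (hL : forall j, (0 < L j)%N)
  (hdeg : forall j, (size (q j) <= 2 * L j)%N)
  (hq0 : forall j, (q j).[0] = 0)
  (t : R) :
  let P := Ppoly q L in
  let A := Apoly P in
  let B := Bpoly P in
  let F := A + (rC t)%:P%:P * B in
  let G := A^`() + (rC t)%:P%:P * B^`() in
  let branches (b : 'I_M -> nat -> R) :=
    (forall j, conv_series1 (b j)) /\
    (forall j, eval_series1 (b j) 0 = 0) /\
    (exists e : R, 0 < e /\ forall x : R, `|x| < e -> forall y : R[i],
       eval2 F (rC x) y = \prod_(j < M) (y - rC (eval_series1 (b j) x))) in
  (exists b, branches b) /\
  forall b, branches b ->
  forall c : nat -> nat -> R[i], conv_series2 c ->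
    (L2loc (fun p : R * R =>
       eval_series2 c (rC p.1) (rC p.2) / eval2 P (rC p.1) (rC p.2))
     <->
     forall j : 'I_M,
       (Ord (fun x : R => eval_series2 c (rC x) (rC (eval_series1 (b j) x)))
         * 2%:E
        >= Ord (fun x : R =>
              (eval2 B (rC x) (rC (eval_series1 (b j) x)) *
               eval2 G (rC x) (rC (eval_series1 (b j) x)))%R))%E).
Proof.
move=> P A B F G branches; split.
  by have [b [b1 b2 b3]] := branches_exist t hL hq0; exists b; split => //; split.
move=> b [bc [b0 [e [e0 He]]]] c [r [r0 [K HK]]].
pose a j x := eval_series1 (b j) x.
have aan j : analytic (a j) by exists (b j); apply: germ_series.
(* The branches are arbitrary here, not the constructed ones; agreement of values at every complex
   [y] is turned into an identity of polynomials in [y]. *)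
have aF : \forall x \near (0 : R), fibF (qx q x) (ex L x) t = \prod_j ('X - (real_complex R (a j x))%:P).
  apply/near0P; exists e; split => // x xe; apply: poly_eq_horner => z.
  rewrite -ev_F -eval2E He // horner_prod; apply: eq_bigr => j _.
  by rewrite hornerXsubC.
have cK m n : normc (c m n) * r ^+ (m + n) <= K.
  by have := HK m n; rewrite norm_eq_nc -[rC (_ ^+ _)]/(real_complex R _) -[rC K]/(real_complex R K) -rmorphM lecR.
have K0 : 0 <= K by apply: le_trans (cK 0%N 0%N); rewrite mulr_ge0 ?normc_ge0 // exprn_ge0 // ltW.
have main := L2_iff_order hL hq0 aan b0 aF r0 K0 cK.
have -> : (fun p : R * R => eval_series2 c (rC p.1) (rC p.2) / eval2 P (rC p.1) (rC p.2)) = QP L q c.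
  by apply/funext => p; rewrite eval2E -[rC p.1]/(real_complex R _) ev_P.
(* On a branch [F] vanishes, so [B F_y] is the Wronskian [K] there and has the same order. *)
have OE j : Ord (fun x : R => eval2 B (rC x) (rC (eval_series1 (b j) x)) * eval2 G (rC x) (rC (eval_series1 (b j) x))) =
   Ord (fun x => real_complex R (fibK (qx q x) (ex L x) (a j x))).
  apply: Ord_near; apply: filterS aF => x aFx.
  rewrite !eval2E -[rC x]/(real_complex R x) ev_B ev_G -[rC _]/(real_complex R (a j x)).
  by rewrite fibB_real (deriv_fibF aFx) -rmorphM -(fibK_root aFx).
by rewrite main; split => H j; [rewrite OE|rewrite -OE]; apply: H.
Qed.
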